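(* Let $n\ge4$ and let $Z\in\mathbb{R}^{n\times4}$ be totally positive satisfying Assumption (G). Then the closed strata of the algebraic boundary $\partial_a\mathcal{A}_n$ come in exactly 14 types, namely the types $(3,\mathrm{I})$; $(2,\mathrm{I}),(2,\mathrm{II}),(2,\mathrm{III})$; $(1,\mathrm{I}),(1,\mathrm{II}),(1,\mathrm{III}),(1,\mathrm{IV})$; $(0,\mathrm{I}),\dots,(0,\mathrm{VI})$ listed below (a stratum of type $(d,\cdot)$ has dimension $d$; so there are $1,3,4,6$ types in dimensions $3,2,1,0$). The number of strata of each type is: $(3,\mathrm{I})$: $n$; $(2,\mathrm{I})$: $n$; $(2,\mathrm{II})$: $n$; $(2,\mathrm{III})$: $\binom n2-n$; $(1,\mathrm{I})$: $n$; $(1,\mathrm{II})$: $n(n-2)$; $(1,\mathrm{III})$: $n(n-4)$; $(1,\mathrm{IV})$: $\binom n3-n(n-3)$; $(0,\mathrm{I})$: $\binom n2$; $(0,\mathrm{II})$: $\frac n2(n-5)$; $(0,\mathrm{III})$: $n(n-4)$; $(0,\mathrm{IV})$: $n\binom{n-3}{2}$; $(0,\mathrm{V})$: $n\binom{n-5}{2}$; $(0,\mathrm{VI})$: $\frac{n}{24}(n-5)(n-6)(n-7)$ (here a stratum of type $(0,\mathrm{VI})$ is the pair of points given by one admissible index set $\{i,j,k,l\}$).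
   Context: $Z\in\mathbb{R}^{n\times4}$ is totally positive (all $4\times 4$ minors positive); its rows $Z_1,\dots,Z_n$ are viewed as points of $\mathbb{P}^3$, indices cyclic mod $n$ ($Z_{n+1}=Z_1$, etc.). The amplituhedron $\mathcal{A}_n\subset\mathrm{Gr}_{\mathbb{R}}(2,4)$ is the image of the totally nonnegative Grassmannian $\mathrm{Gr}(2,n)_{\geq0}$ (row spans of $2\times n$ real rank-2 matrices with all $2\times2$ minors $\geq0$ up to common sign) under $\mathrm{rowspan}(X)\mapsto\mathrm{rowspan}(XZ)$. For a line $AB$, $\langle AB\,ij\rangle$ is the determinant of the matrix with rows $A,B,Z_i,Z_j$. The algebraic boundary $\partial_a\mathcal{A}_n$ (Zariski closure in $\mathrm{Gr}_{\mathbb{C}}(2,4)$ of the Euclidean boundary of $\mathcal{A}_n$) is the union of the $n$ hyperplane sections $D_i=\{AB\in\mathrm{Gr}_{\mathbb{C}}(2,4):\langle AB\,i(i+1)\rangle=0\}$, $i\in[n]$ (with $D_n$ given by $\langle AB\,1n\rangle=0$). The strata of $\partial_a\mathcal{A}_n$ are obtained by stratifying by intersections: starting from $D_1,\dots,D_n$, one repeatedly takes irreducible components of intersections of strata; these are the closed strata. Assumption (G): there is no line $AB$ for which more than $4$ of $\langle AB\,i(i+1)\rangle$, $i\in[n]$, vanish. Schubert conditions on lines $AB$ in $\mathbb{P}^3$: $L_{ij}$: $AB$ meets the line $Z_iZ_j$; $V_i$: $Z_i\in AB$; $P_{(i-1)i(i+1)}$: $AB$ lies in the plane spanned by $Z_{i-1},Z_i,Z_{i+1}$.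 Juxtaposition denotes intersection. Types: $(3,\mathrm{I},i)$: $L_{i(i+1)}$. $(2,\mathrm{I},i)$: $V_i$; $(2,\mathrm{II},i)$: $P_{(i-1)i(i+1)}$; $(2,\mathrm{III},ij)$: $L_{i(i+1)}L_{j(j+1)}$ with $\{i,i+1\}\cap\{j,j+1\}=\emptyset$. $(1,\mathrm{I},i)$: $V_iL_{(i-1)(i+1)}$; $(1,\mathrm{II},ij)$: $V_iL_{j(j+1)}$ with $i\notin\{j,j+1\}$; $(1,\mathrm{III},ij)$: $P_{(i-1)i(i+1)}L_{j(j+1)}$ with $\{i-1,i,i+1\}\cap\{j,j+1\}=\emptyset$; $(1,\mathrm{IV},ijk)$: $L_{i(i+1)}L_{j(j+1)}L_{k(k+1)}$ with the pairs $\{s,s+1\}$, $s\in\{i,j,k\}$, pairwise disjoint. $(0,\mathrm{I},ij)$: $V_iV_j$, $i\ne j$; $(0,\mathrm{II},ij)$: $P_{(i-1)i(i+1)}P_{(j-1)j(j+1)}$ with $\{i-1,i,i+1\}\cap\{j-1,j,j+1\}=\emptyset$; $(0,\mathrm{III},ij)$: $V_iL_{(i-1)(i+1)}L_{j(j+1)}$ with $\{i-1,i,i+1\}\cap\{j,j+1\}=\emptyset$; $(0,\mathrm{IV},ijk)$: $V_iL_{j(j+1)}L_{k(k+1)}$ with $\{j,j+1\}\cap\{k,k+1\}=\emptyset$ and $i\notin\{j,j+1,k,k+1\}$; $(0,\mathrm{V},ijk)$: $P_{(i-1)i(i+1)}L_{j(j+1)}L_{k(k+1)}$ with $\{s,s+1\}\cap\{i-1,i,i+1\}=\emptyset$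 for $s\in\{j,k\}$ and $\{j,j+1\}\cap\{k,k+1\}=\emptyset$; $(0,\mathrm{VI},ijkl)$: $L_{i(i+1)}L_{j(j+1)}L_{k(k+1)}L_{l(l+1)}$ with the four pairs pairwise disjoint (a set of two points).
   Formalization: For n = 4 the stated counts (n/2)(n-5) = -2 of type (0,II) and (n/24)(n-5)(n-6)(n-7) = -1 of type (0,VI) are negative; the formal theorem takes these counts, and that of type (0,V), to be 0 there (negative factors n-5, n-6, n-7 read as 0); for n >= 5 the counts are as stated. *)

(* Defs.v *)
From HB Require Import structures.
From Stdlib Require Reals.
From mathcomp Require Import all_boot all_order all_algebra.
From mathcomp Require Import complex.
From mathcomp Require Import Rstruct.
From mathcomp Require mpoly.

Set Implicit Arguments.
Unset Strict Implicit.
Unset Printing Implicit Defensive.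

Import Order.TTheory GRing.Theory Num.Theory.
Local Open Scope ring_scope.

Notation RR := Rdefinitions.R.
Definition CC := RR[i].

Definition totally_positive (n : nat) (Z : 'M[RR]_(n, 4)) : Prop :=
  forall s : 'I_4 -> 'I_n, (forall a b : 'I_4, (a < b)%N -> (s a < s b)%N) ->
    0 < \det (rowsub s Z).

(** Subsets of Gr_C(2,4): a line AB is represented by a rank-2 matrix
    M : 'M[CC]_(2,4) with rows A, B; a "set" is a predicate on such matrices. *)
Definition gset := 'M[CC]_(2, 4) -> Prop.

Definition rank2 (M : 'M[CC]_(2, 4)) : Prop := \rank M = 2%N.

Definition seteq (X Y : gset) : Prop := forall M, X M <-> Y M.
Definition subset (X Y : gset) : Prop := forall M, X M -> Y M.
Definition inter (X Y : gset) : gset := fun M => X M /\ Y M.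

Definition is_gset (X : gset) : Prop :=
  (forall M, X M -> rank2 M) /\
  (forall M N, rank2 M -> rank2 N -> (M == N)%MS -> X M -> X N).

(** Zariski-closed subsets of Gr_C(2,4) (quotient topology of the Stiefel
    variety of rank-2 2x4 matrices): zero loci of families of polynomials in
    the 8 matrix entries. *)
Definition zclosed (X : gset) : Prop :=
  is_gset X /\
  exists F : mpoly.mpoly (2 * 4) CC -> Prop,
    forall M, X M <-> (rank2 M /\ forall f, F f -> mpoly.meval (mxvec M 0) f = 0).

Definition irreducible (X : gset) : Prop :=
  zclosed X /\ (exists M, X M) /\
  forall Y1 Y2, zclosed Y1 -> zclosed Y2 ->
    subset X (fun M => Y1 M \/ Y2 M) -> subset X Y1 \/ subset X Y2.

Definition component (X Y : gset) : Prop :=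
  irreducible Y /\ subset Y X /\
  forall W, irreducible W -> subset Y W -> subset W X -> subset W Y.

Definition has_chain (X : gset) (d : nat) : Prop :=
  exists f : nat -> gset,
    (forall k, (k <= d)%N -> irreducible (f k) /\ subset (f k) X) /\
    (forall k, (k < d)%N -> subset (f k) (f k.+1) /\ ~ subset (f k.+1) (f k)).

Definition has_dim (X : gset) (d : nat) : Prop :=
  has_chain X d /\ ~ has_chain X d.+1.

Section Boundary.
Variables (n : nat) (Z : 'M[RR]_(n, 4)).

Definition Zc : 'M[CC]_(n, 4) := map_mx (fun x : RR => (x%:C)%C) Z.
Definition zpt (i : 'I_n) : 'rV[CC]_4 := row i Zc.
Definition succ (i : 'I_n) : 'I_n := ordS i.
Definition pred (i : 'I_n) : 'I_n := ord_pred i.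

Definition bracket (M : 'M[CC]_(2, 4)) (i j : 'I_n) : CC :=
  \det (col_mx M (col_mx (zpt i) (zpt j))).

Definition Dset (i : 'I_n) : gset := fun M => rank2 M /\ bracket M i (succ i) = 0.

Definition Lset (i j : 'I_n) : gset :=
  fun M => rank2 M /\ (0 < \rank (M :&: col_mx (zpt i) (zpt j))%MS)%N.
Definition Vset (i : 'I_n) : gset := fun M => rank2 M /\ (zpt i <= M)%MS.
Definition Pset (i : 'I_n) : gset :=
  fun M => rank2 M /\ (M <= col_mx (zpt (pred i)) (col_mx (zpt i) (zpt (succ i))))%MS.

Definition Lnext (i : 'I_n) : gset := Lset i (succ i).

Inductive stratum : gset -> Prop :=
| stratum_D i : stratum (Dset i)
| stratum_comp A B Y : stratum A -> stratum B -> component (inter A B) Y -> stratum Y.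

Definition is_stratum (X : gset) : Prop := exists Y, stratum Y /\ seteq X Y.

Definition assumptionG : Prop :=
  forall M : 'M[CC]_(2, 4), rank2 M ->
    (#|[set i : 'I_n | bracket M i (succ i) == 0%R]| <= 4)%N.

Definition pr (i : 'I_n) : {set 'I_n} := [set i; succ i].
Definition tr (i : 'I_n) : {set 'I_n} := [set pred i; i; succ i].

Definition L4 (i j k l : 'I_n) : gset :=
  inter (Lnext i) (inter (Lnext j) (inter (Lnext k) (Lnext l))).
Definition adm4 (i j k l : 'I_n) : Prop :=
  [disjoint pr i & pr j] /\ [disjoint pr i & pr k] /\ [disjoint pr i & pr l] /\
  [disjoint pr j & pr k] /\ [disjoint pr j & pr l] /\ [disjoint pr k & pr l].

End Boundary.

Inductive stype :=
| T3_I
| T2_I | T2_II | T2_III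
| T1_I | T1_II | T1_III | T1_IV
| T0_I | T0_II | T0_III | T0_IV | T0_V | T0_VI.

Definition tdim (t : stype) : nat :=
  match t with
  | T3_I => 3
  | T2_I | T2_II | T2_III => 2
  | T1_I | T1_II | T1_III | T1_IV => 1
  | _ => 0
  end%N.

(** X is a stratum-candidate of type t (for (0,VI): X is one of the points,
    i.e. an irreducible component, of L_{i(i+1)}L_{j(j+1)}L_{k(k+1)}L_{l(l+1)}). *)
Definition has_type (n : nat) (Z : 'M[RR]_(n, 4)) (t : stype) (X : gset) : Prop :=
  let L := Lnext Z in let V := Vset Z in let P := Pset Z in
  let s := @succ n in let p := @pred n in
  match t with
  | T3_I => exists i, seteq X (L i)
  | T2_I => exists i, seteq X (V i)
  | T2_II => exists i, seteq X (P i)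
  | T2_III => exists i j, [disjoint pr i & pr j] /\ seteq X (inter (L i) (L j))
  | T1_I => exists i, seteq X (inter (V i) (Lset Z (p i) (s i)))
  | T1_II => exists i j, i \notin pr j /\ seteq X (inter (V i) (L j))
  | T1_III => exists i j, [disjoint tr i & pr j] /\ seteq X (inter (P i) (L j))
  | T1_IV => exists i j k,
      [/\ [disjoint pr i & pr j], [disjoint pr i & pr k] & [disjoint pr j & pr k]] /\
      seteq X (inter (L i) (inter (L j) (L k)))
  | T0_I => exists i j, i != j /\ seteq X (inter (V i) (V j))
  | T0_II => exists i j, [disjoint tr i & tr j] /\ seteq X (inter (P i) (P j))
  | T0_III => exists i j, [disjoint tr i & pr j] /\
      seteq X (inter (V i) (inter (Lset Z (p i) (s i)) (L j)))
  | T0_IV => exists i j k,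
      [/\ [disjoint pr j & pr k], i \notin pr j & i \notin pr k] /\
      seteq X (inter (V i) (inter (L j) (L k)))
  | T0_V => exists i j k,
      [/\ [disjoint pr j & tr i], [disjoint pr k & tr i] & [disjoint pr j & pr k]] /\
      seteq X (inter (P i) (inter (L j) (L k)))
  | T0_VI => exists i j k l, adm4 i j k l /\ component (L4 Z i j k l) X
  end.

(** Number of strata of each type (for (0,VI): number of admissible index
    sets, i.e. of two-point sets L L L L).  Natural-number arithmetic;
    truncated subtraction. *)
Definition tcount (n : nat) (t : stype) : nat :=
  match t with
  | T3_I => n
  | T2_I => n
  | T2_II => n
  | T2_III => 'C(n, 2) - n
  | T1_I => n
  | T1_II => n * (n - 2)
  | T1_III => n * (n - 4)
  | T1_IV => 'C(n, 3) - n * (n - 3)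
  | T0_I => 'C(n, 2)
  | T0_II => (n * (n - 5)) %/ 2
  | T0_III => n * (n - 4)
  | T0_IV => n * 'C(n - 3, 2)
  | T0_V => n * 'C(n - 5, 2)
  | T0_VI => (n * (n - 5) * (n - 6) * (n - 7)) %/ 24
  end%N.

(* Main.v *)
Require Import Defs.
From HB Require Import structures.
From Stdlib Require Reals.
From mathcomp Require Import all_boot all_order all_algebra.
From mathcomp Require Import complex.
From mathcomp Require Import Rstruct.
From mathcomp Require Import mpoly.
From mathcomp Require boolp.
From mathcomp Require Import ring lra zify.
Import Order.TTheory GRing.Theory Num.Theory.
Local Open Scope ring_scope.

Set Implicit Arguments.
Unset Strict Implicit.
Unset Printing Implicit Defensive.

Notation subset := Defs.subset.

(* Write L_a for L_{a(a+1)}. Every stratum is the set G (V, P, A) of the lines satisfying V_i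
   (i in V), P_i (i in P) and L_a (a in A) for suitable index sets, or one of the two points of
   L_i L_j L_k L_l; on V_i the condition L_{(i-1)(i+1)} amounts to P_i. Each of these sets
   contains the image of an affine space, which each of its lines meets after a generic
   perturbation; hence it is irreducible. The algebraic dependence of many polynomials in few
   parameters bounds the length of its chains, and explicit flags attain the bound.

   Beyond the independence of any four points Z_i, positivity enters through two facts, both
   consequences of three-term Pluecker relations: no line satisfies V_i, P_i, L_j, L_k with
   disjoint indices, and four disjoint L_a have exactly two common transversals, because a
   discriminant is positive. By (G) a line satisfies at most four L_a; a case analysis then shows that the conditions met by a line M are implied by a
   normal form nd M, which belongs to one of the 14 types. A component of an intersection of two
   strata is G (nd M) for a generic point M of it, and nd M recovers the index sets of a stratum
   from its generic point, so strata are counted by counting index sets. These are independent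
   sets in paths and cycles, up to a choice of i. *)

(** * Polynomial functions on 2 x 4 matrices *)

(** A set of lines is here a GL_2-invariant set of 2 by 4 matrices, with equations in the eight
    entries. Transcendence degrees therefore exceed dimensions by 4, and each parametrization
    carries an additional 2 by 2 matrix.

    Irreducibility and dimension reduce to polynomials in one variable: two points of a parameter
    space are joined by an affine line, on which finitely many nonzero polynomials have a common
    non-root.

    The delicate point of the counting is that a set of lines does not visibly determine its index
    sets, since conditions imply one another; for example V_i and L_{i+1} give P_{i+1}. So only
    admissible index sets are allowed, and two of them are compared through the conditions met by a
    generic line and through the dimension.

    Type (0,VI) is treated apart throughout, because its index set describes a reducible set. By (G)
    no fifth L_a holds at either of its points, so the index set can be read off at each of them. *)

Notation M24 := 'M[CC]_(2, 4).

Definition polyn (f : M24 -> CC) :=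
  exists p : mpoly.mpoly (2 * 4) CC, forall M, f M = mpoly.meval (mxvec M 0) p.

Lemma polyn_ext f g : f =1 g -> polyn f -> polyn g.
Proof. by move=> fg [p Hp]; exists p => M; rewrite -fg. Qed.

Lemma polynC c : polyn (fun=> c).
Proof. by exists (mpoly.mpolyC _ c) => M; rewrite mpoly.mevalC. Qed.

Lemma polyn_coord i j : polyn (fun M => M i j).
Proof.
exists (mpoly.mpolyX _ (mpoly.mnm1 (mxvec_index i j))) => M.
by rewrite mpoly.mevalXU mxvecE.
Qed.

Lemma polynD f g : polyn f -> polyn g -> polyn (fun M => f M + g M).
Proof. by move=> [p Hp] [q Hq]; exists (p + q) => M; rewrite mpoly.mevalD Hp Hq. Qed.

Lemma polynM f g : polyn f -> polyn g -> polyn (fun M => f M * g M).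
Proof. by move=> [p Hp] [q Hq]; exists (p * q) => M; rewrite mpoly.mevalM Hp Hq. Qed.

Lemma polyn_sum (I : Type) (r : seq I) (P : pred I) (F : I -> M24 -> CC) :
  (forall i, polyn (F i)) -> polyn (fun M => \sum_(i <- r | P i) F i M).
Proof.
move=> HF; elim: r => [|i r IH].
  by apply: polyn_ext (polynC 0) => M; rewrite big_nil.
have [Pi|nPi] := boolP (P i).
  by apply: polyn_ext (polynD (HF i) IH) => M; rewrite big_cons Pi.
by apply: polyn_ext IH => M; rewrite big_cons (negbTE nPi).
Qed.

Lemma polyn_prod (I : Type) (r : seq I) (P : pred I) (F : I -> M24 -> CC) :
  (forall i, polyn (F i)) -> polyn (fun M => \prod_(i <- r | P i) F i M).
Proof.
move=> HF; elim: r => [|i r IH].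
  by apply: polyn_ext (polynC 1) => M; rewrite big_nil.
have [Pi|nPi] := boolP (P i).
  by apply: polyn_ext (polynM (HF i) IH) => M; rewrite big_cons Pi.
by apply: polyn_ext IH => M; rewrite big_cons (negbTE nPi).
Qed.

Lemma polynX f k : polyn f -> polyn (fun M => f M ^+ k).
Proof.
move=> Hf; apply: polyn_ext (polyn_prod (index_iota 0 k) xpredT (fun _ : nat => Hf)) => M.
by rewrite prodr_const_nat subn0.
Qed.

Lemma polyn_comp f (G : M24 -> M24) :
  polyn f -> (forall i j, polyn (fun M => G M i j)) -> polyn (fun M => f (G M)).
Proof.
move=> [p Hp] HG.
pose g M := \sum_(m <- mpoly.msupp p)
   mpoly.mcoeff m p * \prod_i (mxvec (G M) 0 i) ^+ mpoly.fun_of_multinom m i.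
apply: (@polyn_ext g) => [M|]; first by rewrite Hp mpoly.mevalE.
apply: polyn_sum => m; apply: polynM; first exact: polynC.
apply: polyn_prod => i; apply: polynX.
case/mxvec_indexP: i => i j.
by apply: polyn_ext (HG i j) => M; rewrite mxvecE.
Qed.

Lemma polyn_det k (G : M24 -> 'M[CC]_k) :
  (forall i j, polyn (fun M => G M i j)) -> polyn (fun M => \det (G M)).
Proof.
move=> HG; rewrite /determinant; apply: polyn_sum => s.
by apply: polynM; [exact: polynC | exact: polyn_prod].
Qed.

Lemma poly_neq0_ex (p : {poly CC}) : p != 0 -> exists u, p.[u] != 0.
Proof.
move=> pN0; pose rs := [seq (k%:R : CC) | k <- iota 0 (size p)].
have urs : uniq rs.
  by rewrite map_inj_uniq ?iota_uniq // => a b /eqP; rewrite eqr_nat => /eqP.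
have [/allP allr|/allPn[x _ Hx]] := boolP (all (root p) rs); last by exists x.
have := max_poly_roots pN0 (introT allP allr) urs.
by rewrite size_map size_iota ltnn.
Qed.

(** * Functions that are polynomial along every affine line *)

Section LineDegree.
Variable m : nat.
Implicit Types (F G : 'rV[CC]_m -> CC).

(** A substitute for total degree that needs no multivariate polynomials on the parameter space: the
    arguments below only restrict F to affine lines, where a parameter off the roots can be
    chosen. *)
Definition ldeg K F :=
  forall p q, exists Q : {poly CC}, (size Q <= K.+1)%N /\ forall u, F (p + u *: q) = Q.[u].

Lemma ldeg_ext K F G : F =1 G -> ldeg K F -> ldeg K G.
Proof. by move=> FG H p q; have [Q [s e]] := H p q; exists Q; split=> // u; rewrite -FG. Qed.

Lemma ldeg_le K K' F : (K <= K')%N -> ldeg K F -> ldeg K' F.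
Proof. by move=> le H p q; have [Q [s e]] := H p q; exists Q; split=> //; apply: leq_trans s _. Qed.

Lemma ldegC K c : ldeg K (fun=> c).
Proof.
by move=> p q; exists c%:P; split=> [|u]; rewrite ?hornerC // (leq_trans (size_polyC_leq1 _)).
Qed.

Lemma ldeg_coord j : ldeg 1 (fun p => p 0 j).
Proof.
move=> p q; exists ((q 0 j)%:P * 'X + (p 0 j)%:P); split=> [|u].
  by rewrite size_MXaddC; case: ifP => // _; apply: size_polyC_leq1.
by rewrite !mxE !hornerE addrC mulrC.
Qed.

Lemma ldegD K F G : ldeg K F -> ldeg K G -> ldeg K (fun p => F p + G p).
Proof.
move=> HF HG p q; have [P [sP eP]] := HF p q; have [Q [sQ eQ]] := HG p q.
exists (P + Q); split=> [|u]; last by rewrite hornerD eP eQ.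
by apply: leq_trans (size_polyD _ _) _; rewrite geq_max sP sQ.
Qed.

Lemma ldegM K K' F G : ldeg K F -> ldeg K' G -> ldeg (K + K') (fun p => F p * G p).
Proof.
move=> HF HG p q; have [P [sP eP]] := HF p q; have [Q [sQ eQ]] := HG p q.
exists (P * Q); split=> [|u]; last by rewrite hornerM eP eQ.
by apply: leq_trans (size_polyMleq _ _) _; lia.
Qed.

Lemma ldeg_sum K (I : Type) (r : seq I) (F : I -> 'rV_m -> CC) :
  (forall i, ldeg K (F i)) -> ldeg K (fun p => \sum_(i <- r) F i p).
Proof.
move=> HF; elim: r => [|i r IH].
  by apply: ldeg_ext (ldegC K 0) => p; rewrite big_nil.
by apply: ldeg_ext (ldegD (HF i) IH) => p; rewrite big_cons.
Qed.

Lemma ldegX K F k : ldeg K F -> ldeg (K * k) (fun p => F p ^+ k).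
Proof.
move=> HF; elim: k => [|k IH]; first exact: ldegC.
apply: ldeg_ext (ldeg_le _ (ldegM HF IH)) => [p|]; first by rewrite exprS.
by rewrite mulnS.
Qed.

Lemma ldeg_prod K (I : Type) (r : seq I) (F : I -> 'rV_m -> CC) :
  (forall i, ldeg K (F i)) -> ldeg (K * size r) (fun p => \prod_(i <- r) F i p).
Proof.
move=> HF; elim: r => [|i r IH].
  by apply: ldeg_ext (ldegC _ 1) => p; rewrite big_nil.
apply: ldeg_ext (ldeg_le _ (ldegM (HF i) IH)) => [p|]; first by rewrite big_cons.
by rewrite /= mulnS.
Qed.

Lemma ldeg_polyn K f (Phi : 'rV[CC]_m -> M24) : polyn f ->
  (forall i j, ldeg K (fun p => Phi p i j)) -> exists D, ldeg D (fun p => f (Phi p)).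
Proof.
move=> [P HP] HPhi.
pose T mm (i : 'I_(2 * 4)) (p : 'rV[CC]_m) :=
  (mxvec (Phi p) 0 i) ^+ mpoly.fun_of_multinom mm i.
suff: forall r : seq (mpoly.multinom (2 * 4)), exists D,
   ldeg D (fun p => \sum_(mm <- r) mpoly.mcoeff mm P * \prod_i T mm i p).
  move=> /(_ (mpoly.msupp P)) [D HD]; exists D.
  by apply: ldeg_ext HD => p; rewrite HP mpoly.mevalE.
elim=> [|mm r [D HD]].
  by exists 0%N; apply: ldeg_ext (ldegC 0 0) => p; rewrite big_nil.
have [E HE] : exists E, ldeg E (fun p => \prod_i T mm i p).
  have HT i : ldeg (K * \max_i mpoly.fun_of_multinom mm i) (T mm i).
    apply: (@ldeg_le (K * mpoly.fun_of_multinom mm i)).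
      by rewrite leq_mul2l leq_bigmax orbT.
    apply: ldegX; case/mxvec_indexP: i => i j.
    by apply: ldeg_ext (HPhi i j) => p; rewrite mxvecE.
  by eexists; apply: ldeg_prod HT.
exists (E + D)%N.
have H1 := ldegM (ldegC 0 (mpoly.mcoeff mm P)) HE.
apply: ldeg_ext (ldegD (ldeg_le _ H1) (ldeg_le _ HD)) => [p||]; last 2 first.
- by rewrite add0n leq_addr.
- by rewrite leq_addl.
by rewrite big_cons.
Qed.

(** The coordinates are freed one at a time: along a coordinate direction F is a polynomial of
    degree at most K that vanishes at K + 1 values. *)
Lemma ldeg_grid K F : ldeg K F ->
  (forall g : {ffun 'I_m -> 'I_K.+1}, F (\row_j (g j)%:R) = 0) -> forall p, F p = 0.
Proof.
move=> HF H0.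
(* The coordinates below s are arbitrary, the others still take grid values. *)
suff H s : (s <= m)%N -> forall p : 'rV[CC]_m,
    (forall j : 'I_m, (s <= j)%N -> exists k : 'I_K.+1, p 0 j = k%:R) -> F p = 0.
  by move=> p; apply: (H m (leqnn m)) => j; rewrite leqNgt ltn_ord.
elim: s => [_ p Hp|s IH ltsm p Hp].
  have G j : exists k : 'I_K.+1, p 0 j == k%:R by have [k /eqP ek] := Hp j isT; exists k.
  rewrite -(H0 [ffun j => xchoose (G j)]); congr F; apply/rowP => j.
  by rewrite !mxE ffunE; apply/eqP; exact: (xchooseP (G j)).
pose o := Ordinal ltsm.
have [Q [sQ eQ]] := HF p (delta_mx 0 o).
have HQ (k : 'I_K.+1) : Q.[k%:R - p 0 o] = 0.
  rewrite -eQ; apply: (IH (ltnW ltsm)) => j lesj.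
  have [->|nej] := eqVneq j o.
    by exists k; rewrite !mxE !eqxx mulr1 addrCA subrr addr0.
  have [|k' e'] := Hp j; first by rewrite ltn_neqAle lesj andbT; apply: contraNneq nej => e; apply/eqP/val_inj.
  by exists k'; rewrite !mxE eqxx (negbTE nej) mulr0 addr0.
suff Q0 : Q = 0 by have := eQ 0; rewrite scale0r addr0 Q0 horner0.
apply: (@roots_geq_poly_eq0 _ _ [seq (k%:R - p 0 o : CC) | k : 'I_K.+1]).
- by apply/allP => x /mapP[k _ ->]; apply/eqP.
- by rewrite map_inj_uniq ?enum_uniq // => a b /addIr/eqP; rewrite eqr_nat => /eqP/val_inj.
by rewrite size_map size_enum_ord.
Qed.

(* Siegel-type count: there are more monomials of degree < N in each of the k > m
   functions than grid points needed to detect the vanishing of such a monomial. *)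
Lemma ldeg_dependent k D (P : 'I_k -> 'rV[CC]_m -> CC) : (m < k)%N ->
  (forall i, ldeg D (P i)) ->
  exists N (c : {ffun 'I_k -> 'I_N} -> CC), (exists e, c e != 0) /\
    forall p, \sum_e c e * \prod_i P i p ^+ e i = 0.
Proof.
move=> ltmk HP.
(* With N exponents per function there are N ^ k >= N ^ (m + 1) monomials, of degree at most K along
   lines. The grid has (K + 1) ^ m <= ((D * k + 1) * N) ^ m < N ^ (m + 1) points, because (D * k +
   1) ^ m < N. So the evaluation matrix has a nonzero left kernel. *)
pose N := ((D * k).+1 ^ m).+1.
pose K := (D * N * k)%N.
pose mon (e : {ffun 'I_k -> 'I_N}) p := \prod_i P i p ^+ e i.
pose pt (g : {ffun 'I_m -> 'I_K.+1}) : 'rV[CC]_m := \row_j (g j)%:R.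
pose A : 'M[CC]_(_, _) := \matrix_(a < #|{ffun 'I_k -> 'I_N}|,
   b < #|{ffun 'I_m -> 'I_K.+1}|) mon (enum_val a) (pt (enum_val b)).
have Hmon e : ldeg K (mon e).
  have H i : ldeg (D * N) (fun p => P i p ^+ e i).
    by apply: ldeg_le (ldegX _ (HP i)); rewrite leq_mul2l (ltnW (ltn_ord _)) orbT.
  apply: ldeg_le (ldeg_prod (index_enum 'I_k) H).
  by rewrite -[size _]/(size (index_enum 'I_k)) /index_enum -enumT size_enum_ord.
have /rowV0Pn[v /sub_kermxP vA vN0] : kermx A != 0.
  rewrite kermx_eq0 /row_free neq_ltn; apply/orP; left.
  apply: leq_ltn_trans (rank_leq_col A) _.
  rewrite !card_ffun !card_ord.
  apply: (@leq_ltn_trans (((D * k).+1 * N) ^ m)).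
    have [m0|m_gt0] := posnP m; first by rewrite m0.
    by rewrite leq_exp2r // mulSn /K mulnAC addnC -addn1 leq_add2l.
  rewrite expnMn; apply: (@leq_trans (N ^ m.+1)).
    by rewrite expnS ltn_mul2r expn_gt0 /= /N ltnS leqnn.
  by rewrite leq_pexp2l.
exists N, (fun e => v 0 (enum_rank e)); split.
  have /rV0Pn[j Hj] := vN0; exists (enum_val j); by rewrite enum_valK.
apply: (@ldeg_grid K) => [|g].
  apply: ldeg_sum => e; exact: (ldegM (ldegC 0 _) (Hmon e)).
move/rowP/(_ (enum_rank g)): vA; rewrite !mxE => {2}<-.
rewrite (reindex (@enum_rank {ffun 'I_k -> 'I_N})) /=; last first.
  by exists enum_val => x _; rewrite ?enum_rankK ?enum_valK.
by apply: eq_bigr => e _; rewrite !mxE !enum_rankK.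
Qed.

End LineDegree.

(** * Irreducibility and transcendence degree *)

(** Primality of the vanishing ideal among all polynomials in the entries, not only among those with
    a GL_2-invariant zero set. *)
Definition prime_set (X : gset) := forall f g, polyn f -> polyn g ->
  (forall M, X M -> f M * g M = 0) ->
  (forall M, X M -> f M = 0) \/ (forall M, X M -> g M = 0).

(* dep k X says that the functions on X have transcendence degree less than k. *)
Definition dep k (X : gset) := forall P : 'I_k -> M24 -> CC, (forall i, polyn (P i)) ->
  exists N (c : {ffun 'I_k -> 'I_N} -> CC), (exists e, c e != 0) /\
    forall M, X M -> \sum_e c e * \prod_i P i M ^+ e i = 0.

Lemma dep_sub k (X Y : gset) : subset Y X -> dep k X -> dep k Y.
Proof.
move=> YX dX P HP; have [N [c [c0 Hc]]] := dX P HP.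
by exists N, c; split=> // M /YX /Hc.
Qed.

(* A polynomial relation between f, P_1, ..., P_k on X can be divided by a power of f,
   and then restricts to a nontrivial relation between P_1, ..., P_k on Y. *)
Lemma dep_step k (X Y : gset) f : prime_set X -> subset Y X -> polyn f ->
  (forall M, Y M -> f M = 0) -> (exists2 M, X M & f M != 0) -> dep k.+1 X -> dep k Y.
Proof.
move=> pX YX Hf fY [M0 XM0 fM0] dX P HP.
pose P' (i : 'I_k.+1) := if unlift ord0 i is Some j then P j else f.
have HP' i : polyn (P' i) by rewrite /P'; case: (unlift _ _).
have [N [c [[e0 ce0] Hc]]] := dX P' HP'.
pose m := [arg min_(e < e0 | c e != 0) (e ord0 : nat)].
have [cm mmin] : c m != 0 /\ forall e, c e != 0 -> (m ord0 <= e ord0)%N.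
  by rewrite /m; case: arg_minnP.
pose T (e : {ffun 'I_k.+1 -> 'I_N}) M := \prod_j P j M ^+ e (lift ord0 j).
pose G M := \sum_e c e * (f M ^+ (e ord0 - m ord0) * T e M).
have pT e : polyn (T e) by apply: polyn_prod => j; apply: polynX.
have pG : polyn G.
  apply: polyn_sum => e; apply: polynM; first exact: polynC.
  by apply: polynM; first exact: polynX.
have G0 M : X M -> G M = 0.
  have [|fm|] := pX _ _ (polynX (m ord0) Hf) pG.
  - move=> {}M XM; rewrite -(Hc M XM) mulr_sumr; apply: eq_bigr => e _.
    rewrite big_ord_recl /P' unlift_none.
    under [in RHS]eq_bigr => j _ do rewrite liftK.
    have [->|ce] := eqVneq (c e) 0; first by rewrite !mul0r mulr0.
    by rewrite mulrCA; congr (_ * _); rewrite mulrA -exprD subnKC ?mmin.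
  - by move=> _; have /eqP := fm M0 XM0; rewrite expf_eq0 (negbTE fM0) andbF.
  - exact.
(* On Y, where f vanishes, only the terms with the minimal exponent of f survive; [ext] lists
   them. *)
pose ext (e : {ffun 'I_k -> 'I_N}) : {ffun 'I_k.+1 -> 'I_N} :=
  [ffun i => if unlift ord0 i is Some j then e j else m ord0].
exists N, (c \o ext); split.
  exists [ffun j => m (lift ord0 j)] => /=; rewrite (_ : ext _ = m) //.
  by apply/ffunP => i; rewrite ffunE; case: unliftP => [j|] ->; rewrite ?ffunE.
move=> M YM; rewrite -[RHS](G0 M (YX _ YM)) /G.
rewrite [RHS](bigID (fun e : {ffun 'I_k.+1 -> 'I_N} => e ord0 == m ord0)) /= [X in _ = _ + X]big1 ?addr0; last first.
  move=> e ne; have [->|ce] := eqVneq (c e) 0; first by rewrite mul0r.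
  have lt : (m ord0 < e ord0)%N by rewrite ltn_neqAle mmin // andbT eq_sym.
  by rewrite fY // expr0n subn_eq0 leqNgt lt /= mul0r mulr0.
rewrite [RHS](reindex ext) /=; last first.
  exists (fun e : {ffun 'I_k.+1 -> 'I_N} => [ffun j => e (lift ord0 j)]) => e.
    by move=> _; apply/ffunP => j; rewrite !ffunE liftK.
  rewrite inE => /eqP e0m.
  by apply/ffunP => i; rewrite ffunE; case: unliftP => [j|] ->; rewrite ?ffunE.
apply: eq_big => [e|e _]; first by rewrite ffunE unlift_none eqxx.
rewrite ffunE unlift_none subnn expr0 mul1r; congr (_ * _).
by apply: eq_bigr => j _; rewrite ffunE liftK.
Qed.

Lemma eqmx_unitP (M N : M24) : (M == N)%MS -> exists2 g, g \in unitmx & N = g *m M.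
Proof. by case/andP=> MN NM; apply/eqmxMunitP; rewrite MN NM. Qed.

Lemma unit_rank2 g (M : M24) : g \in unitmx -> (rank2 (g *m M) <-> rank2 M).
Proof. by move=> gU; rewrite /rank2 (eqmxMfull M) ?row_full_unit. Qed.

Lemma gset_unit X g M : is_gset X -> g \in unitmx -> X M -> X (g *m M).
Proof.
move=> [Xr XE] gU XM; have rM := Xr _ XM.
apply: XE XM => //; first by apply/unit_rank2.
by apply/eqmxP/eqmx_sym/eqmxMfull; rewrite row_full_unit.
Qed.

Definition pval (p : mpoly.mpoly (2 * 4) CC) (M : M24) := mpoly.meval (mxvec M 0) p.

(** Irreducibility concerns only GL_2-invariant closed sets, so f is replaced by the set [Y f] of
    the M on whose whole orbit f vanishes. If M in X were in neither [Y f1] nor [Y f2], say with f1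
    (g1 M) and f2 (g2 M) nonzero, some invertible matrix on the line through g1 and g2 would make
    both factors nonzero at a point of X. *)
Lemma irr_prime X : irreducible X -> prime_set X.
Proof.
move=> [[gX zX] [_ irr]] f1 f2 pf1 pf2 f12.
pose Y (f : M24 -> CC) : gset := fun M => rank2 M /\ forall g, g \in unitmx -> f (g *m M) = 0.
have zY f : polyn f -> zclosed (Y f).
  move=> [p Hp]; split.
    split=> [M []//|M N rM rN /eqmx_unitP[g gU ->] [_ HM]]; split=> [|h hU].
      by apply/unit_rank2.
    by rewrite mulmxA HM // unitmx_mul hU.
  (* The equations of [Y f] are the translates of f by all invertible g. *)
  exists (fun q => exists2 g, g \in unitmx & forall M, pval q M = f (g *m M)) => M; split.
    by move=> [rM HM]; split=> // q [g gU Hq]; rewrite -/(pval q M) Hq HM.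
  move=> [rM HM]; split=> // g gU.
  have [q Hq] : polyn (fun M => f (g *m M)).
    apply: polyn_comp; first by exists p.
    move=> i j; apply: (@polyn_ext (fun M => \sum_l g i l * M l j)) => [N|].
      by rewrite mxE.
    by apply: polyn_sum => l; apply: polynM; [exact: polynC | exact: polyn_coord].
  by rewrite Hq HM //; exists g => // N; rewrite Hq.
have cov : subset X (fun M => Y f1 M \/ Y f2 M).
  move=> M XM; have rM := gX.1 _ XM.
  case: (boolp.pselect (Y f1 M)) => [|n1]; first by left.
  right; split=> // g2 g2U.
  have [g1 g1U f1N] : exists2 g, g \in unitmx & f1 (g *m M) != 0.
    apply: boolp.contrapT => H; apply: n1; split=> // g gU.
    by apply/eqP; apply: boolp.contrapT => /negP H'; apply: H; exists g.
  apply/eqP; apply: contraT => f2N.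
  pose G (u : 'rV[CC]_1) : 'M[CC]_2 := g1 + u 0 0 *: (g2 - g1).
  have dG K f : ldeg K (fun u => f (G u *m M)) -> exists Q : {poly CC},
      forall u, f ((g1 + u *: (g2 - g1)) *m M) = Q.[u].
    move=> H; have [Q [_ eQ]] := H 0 (const_mx 1).
    by exists Q => u; rewrite -eQ /G !mxE add0r mulr1.
  have HG i j : ldeg 1 (fun u => (G u *m M) i j).
    apply: (@ldeg_ext _ _ (fun u => \sum_l (g1 i l + u 0 0 * (g2 - g1) i l) * M l j)).
      by move=> u; rewrite mxE; apply: eq_bigr => l _; rewrite !mxE.
    apply: ldeg_sum => l; apply: (@ldegM _ 1 0); last exact: ldegC.
    apply: ldegD; first exact: ldegC.
    by apply: (@ldegM _ 1 0); [exact: ldeg_coord | exact: ldegC].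
  have [D1 /dG[Q1 e1]] := ldeg_polyn pf1 HG.
  have [D2 /dG[Q2 e2]] := ldeg_polyn pf2 HG.
  have [Q3 e3] : exists Q : {poly CC}, forall u, \det (g1 + u *: (g2 - g1)) = Q.[u].
    pose B i j : {poly CC} := (g1 i j)%:P + ((g2 - g1) i j)%:P * 'X.
    exists (\det (\matrix_(i, j) B i j)) => u.
    rewrite -horner_evalE -det_map_mx; congr (\det _); apply/matrixP => i j.
    by rewrite !mxE /= horner_evalE !hornerE !mxE mulrC.
  have [u] : exists u, (Q1 * Q2 * Q3).[u] != 0.
    apply: poly_neq0_ex; rewrite !mulf_neq0 //.
    - by apply: contraNneq f1N => Q0; have := e1 0; rewrite scale0r addr0 Q0 horner0 => ->.
    - by apply: contraNneq f2N => Q0; have := e2 1; rewrite scale1r addrC subrK Q0 horner0 => ->.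
    apply: contraTneq g1U => Q0; have := e3 0; rewrite scale0r addr0 Q0 horner0 => d0.
    by rewrite unitmxE d0 unitr0.
  rewrite !hornerE -e1 -e2 -e3 => dN; move/eqP: (dN); case; rewrite f12 ?mul0r //.
  apply: gset_unit => //; rewrite unitmxE unitfE.
  by apply: contraNneq dN => ->; rewrite mulr0.
have unpack f : subset X (Y f) -> forall M, X M -> f M = 0.
  by move=> H M /H[_ /(_ 1%:M (unitmx1 _ _))]; rewrite mul1mx.
by have [/unpack H|/unpack H] := irr _ _ (zY _ pf1) (zY _ pf2) cov; [left|right].
Qed.

Lemma det2E (F : comPzRingType) (A : 'M[F]_2) :
  \det A = A ord0 ord0 * A ord_max ord_max - A ord0 ord_max * A ord_max ord0.
Proof.
rewrite (expand_det_row _ ord0) !big_ord_recl big_ord0 /cofactor !det_mx11 !mxE /=.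
rewrite addr0 expr0 expr1 mul1r mulN1r mulrN.
by congr (_ * _ - _ * _); congr (A _ _); apply: val_inj.
Qed.

(* Already the orbit of M under GL_2 has transcendence degree 4. *)
Lemma not_dep4 X M : is_gset X -> X M -> ~ dep 4 X.
Proof.
move=> gX XM dX; have rM : row_free M by rewrite /row_free (gX.1 _ XM).
have /row_freeP[B MB] := rM.
(* As [M *m B] is the identity, [P] reads off the four entries of g at N = g M. *)
pose P (i : 'I_4) (N : M24) := (N *m B) (inord (i %/ 2)) (inord (i %% 2)).
have pP i : polyn (P i).
  apply: (@polyn_ext (fun N => \sum_l N (inord (i %/ 2)) l * B l (inord (i %% 2)))) => [N|].
    by rewrite /P mxE.
  by apply: polyn_sum => l; apply: polynM; [exact: polyn_coord | exact: polynC].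
have [N [c [[e0 ce0] Hc]]] := dX P pP.
have N0 : (0 < N)%N by apply: leq_ltn_trans (ltn_ord (e0 ord0)).
(* Kronecker substitution: the four entries of g are u, u^N, u^(N^2), u^(N^3). *)
pose ka (e : {ffun 'I_4 -> 'I_N}) : nat := (\sum_(i < 4) N ^ i * e i)%N.
have kaI : injective ka.
  move=> e e'; rewrite /ka !big_ord_recl !big_ord0 /= /bump /= !expnS expn0 => H.
  have digit a b a' b' : (a < N)%N -> (a' < N)%N ->
      (a + N * b = a' + N * b' -> a = a' /\ b = b')%N.
    move=> la la' E; have aa : a = a'.
      have := congr1 (modn^~ N) E.
      by rewrite !(addnC _ (N * _)%N) !(mulnC N) !modnMDl !modn_small.
    by split=> //; move: E; rewrite aa => /addnI /eqP; rewrite eqn_pmul2l // => /eqP.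
  set i1 := lift ord0 ord0 in H; set i2 := lift ord0 (lift ord0 ord0) in H.
  set i3 := lift ord0 (lift ord0 (lift ord0 ord0)) in H.
  have [h0 {}H] := digit (e ord0) (e i1 + N * (e i2 + N * e i3))%N (e' ord0)
     (e' i1 + N * (e' i2 + N * e' i3))%N (ltn_ord _) (ltn_ord _) ltac:(nia).
  have [h1 {}H] := digit _ _ _ _ (ltn_ord _) (ltn_ord _) H.
  have [h2 h3] := digit _ _ _ _ (ltn_ord _) (ltn_ord _) H.
  apply/ffunP => i; apply: val_inj.
  by case: (unliftP ord0 i) => [j|] -> //; case: (unliftP ord0 j) => [k|] -> //;
     case: (unliftP ord0 k) => [l|] -> //; rewrite (ord1 l).
pose q : {poly CC} := \sum_e (c e)%:P * 'X^(ka e).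
have qN0 : q != 0.
  apply: contraNneq ce0 => q0; have := congr1 (coefp (ka e0)) q0.
  rewrite /= coef0 /q coef_sum (bigD1 e0) //= big1 ?addr0 => [|e ne].
    by rewrite coefCM coefXn eqxx mulr1 => ->.
  by rewrite coefCM coefXn (inj_eq kaI) eq_sym (negbTE ne) mulr0.
(* The determinant of g after the substitution. It is zero when N = 1, but then the relation is a
   single nonzero constant. *)
pose dt : {poly CC} := 'X^(1 + N ^ 3) - 'X^(N + N ^ 2).
have [N1|N1] := eqVneq N 1%N.
  have q1 u : q.[u] = 0.
    rewrite -[RHS](Hc _ XM) /q horner_sum; apply: eq_bigr => e _.
    have e0' i : e i = 0%N :> nat by have := ltn_ord (e i); lia.
    rewrite hornerCM hornerXn /ka big1 ?expr0 => [|i _]; last by rewrite e0' muln0.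
    by rewrite big1 // => i _; rewrite e0'.
  by have [u] := poly_neq0_ex qN0; rewrite q1 eqxx.
have dtN0 : dt != 0.
  apply/eqP => d0; have := congr1 (coefp (1 + N ^ 3)) d0.
  rewrite /= coefB !coefXn eqxx coef0 (_ : _ == _ = false) ?subr0.
    by move/eqP; rewrite oner_eq0.
  by apply/eqP; rewrite !expnS expn0; nia.
have [u] := poly_neq0_ex (mulf_neq0 qN0 dtN0); rewrite hornerM mulf_eq0 negb_or => /andP[qu du].
pose g : 'M[CC]_2 := \matrix_(a, b) u ^+ (N ^ (2 * a + b)).
have gU : g \in unitmx.
  rewrite unitmxE unitfE det2E !mxE /= !muln0 !muln1 !addn0 add0n -!exprD.
  by move: du; rewrite /dt !hornerE.
move/eqP: qu; apply.
rewrite -[RHS](Hc _ (gset_unit gX gU XM)) /q horner_sum; apply: eq_bigr => e _.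
rewrite hornerCM hornerXn /ka; congr (_ * _).
rewrite -prodrXr; apply: eq_bigr => i _.
rewrite /P -mulmxA MB mulmx1 mxE exprM !inordK ?ltn_pmod ?ltn_divLR //.
by rewrite mulnC -divn_eq.
Qed.

(** Each strict inclusion lowers the transcendence degree by [dep_step], so a chain of length d
    would give [dep 4] for its smallest member, against [not_dep4]. The 4 is the dimension of
    GL_2. *)
Lemma chain_bound X d : is_gset X -> dep (4 + d) X -> ~ has_chain X d.
Proof.
move=> gX dX [f [firr fstep]].
have H k : (k <= d)%N -> dep (4 + (d - k)) (f (d - k)%N).
  elim: k => [_|k IH ltkd]; first by rewrite subn0; apply: dep_sub dX; apply: (firr d _).2.
  have [|sub nsub] := fstep (d - k.+1)%N; first lia.
  have [irr1 _] := firr (d - k.+1)%N ltac:(lia).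
  have [irr2 _] := firr (d - k)%N (leq_subr _ _).
  have e : (d - k.+1).+1 = (d - k)%N by lia.
  rewrite e in sub nsub.
  have [[[gs _] [F HF]] _] := irr1.
  have [M [M2 nM1]] : exists M, f (d - k)%N M /\ ~ f (d - k.+1)%N M.
    apply: boolp.contrapT => nex; apply: nsub => M HM.
    by apply: boolp.contrapT => nM; apply: nex; exists M.
  have [p Fp pM] : exists2 p, F p & pval p M != 0.
    apply: boolp.contrapT => nex; apply: nM1; apply/HF; split.
      by have [[[gr _] _] _] := irr2; apply: gr.
    move=> p Fp; apply/eqP; apply: boolp.contrapT => /negP pM; by apply: nex; exists p.
  apply: (@dep_step _ (f (d - k)%N) _ (pval p)) => //.
  - exact: irr_prime.
  - by exists p.
  - by move=> N /HF[_ /(_ p Fp)].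
  - by exists M.
  by rewrite -addnS e; apply: IH; apply: ltnW.
have := H d (leqnn d); rewrite subnn addn0.
have [[zf [[M fM] _]] _] := firr 0%N (leq0n _).
exact: (not_dep4 zf.1 fM).
Qed.

(** * Sets of lines swept out by an affine family of matrices *)

Section Parametrization.
Variables (d : nat) (X : gset) (A : M24) (C : 'I_d -> M24).
Let phi (t : 'rV[CC]_d) := A + \sum_k t 0 k *: C k.
Hypotheses (zX : zclosed X) (Xphi : forall t, X (phi t)).
(** Up to a change of basis, all but finitely many members of some pencil M + u D lie in the image
    of [phi]. The value u = 0 may be an exception, so M itself need not lie in the image. *)
Hypothesis dense : forall M, X M -> exists (D : M24) (h : {poly CC}), h != 0 /\
  forall u, h.[u] != 0 -> exists t, ((M + u *: D)%R == phi t)%MS.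

(** The parameters include a 2 by 2 matrix because X contains all the matrices that span one of its
    lines. *)
Let Phi (p : 'rV[CC]_(2 * 2 + d)) : M24 := vec_mx (lsubmx p) *m phi (rsubmx p).
Let dt (p : 'rV[CC]_(2 * 2 + d)) := \det (vec_mx (lsubmx p) : 'M_2).

Lemma ldeg_param i j : ldeg 2 (fun p => Phi p i j).
Proof.
apply: (@ldeg_ext _ _ (fun p => \sum_l p 0 (lshift d (mxvec_index i l)) *
    (A l j + \sum_k p 0 (rshift (2 * 2) k) * C k l j))).
  move=> p; rewrite mxE; apply: eq_bigr => l _; rewrite !mxE summxE.
  by congr (_ * (_ + _)); apply: eq_bigr => k _; rewrite !mxE.
apply: ldeg_sum => l; apply: (@ldegM _ 1 1); first exact: ldeg_coord.
apply: ldegD; first exact: ldegC.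
by apply: ldeg_sum => k; apply: (@ldegM _ 1 0); [exact: ldeg_coord | exact: ldegC].
Qed.

Lemma ldeg_param_det : ldeg 2 dt.
Proof.
apply: (@ldeg_ext _ _ (fun p =>
    p 0 (lshift d (mxvec_index ord0 ord0)) * p 0 (lshift d (mxvec_index ord_max ord_max)) +
    (p 0 (lshift d (mxvec_index ord0 ord_max)) * p 0 (lshift d (mxvec_index ord_max ord0))) * -1)).
  by move=> p; rewrite /dt det2E !mxE mulrN1.
apply: ldegD; first by apply: (@ldegM _ 1 1); apply: ldeg_coord.
apply: (@ldegM _ 2 0); last exact: ldegC.
by apply: (@ldegM _ 1 1); apply: ldeg_coord.
Qed.

Lemma param_in p : dt p != 0 -> X (Phi p).
Proof. by move=> dN; apply: gset_unit; rewrite ?zX.1 // ?unitmxE ?unitfE //; case: zX. Qed.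

(** Along the pencil given by [dense], f is a nonzero polynomial in u, hence nonzero at some u where
    h is nonzero too. *)
Lemma param_dense f M : polyn f -> X M -> f M != 0 ->
  exists p, dt p != 0 /\ f (Phi p) != 0.
Proof.
move=> pf XM fM; have [D [h [hN0 Hh]]] := dense XM.
have [K HK] : exists K, ldeg K (fun u : 'rV[CC]_1 => f (M + u 0 0 *: D)).
  apply: ldeg_polyn pf _ => i j.
  apply: (@ldeg_ext _ 1 (fun u => M i j + u 0 0 * D i j)) => [u|]; first by rewrite !mxE.
  apply: ldegD; first exact: ldegC.
  by apply: (@ldegM _ 1 0); [exact: ldeg_coord | exact: ldegC].
have [Q [_ eQ]] := HK 0 (const_mx 1).
have eQ' u : f (M + u *: D) = Q.[u] by rewrite -eQ !mxE add0r mulr1.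
have QN0 : Q != 0.
  by apply: contraNneq fM => Q0; have := eQ' 0; rewrite scale0r addr0 Q0 horner0 => ->.
have [u] := poly_neq0_ex (mulf_neq0 QN0 hN0).
rewrite hornerM mulf_eq0 negb_or -eQ' => /andP[fu /Hh[t et]].
have et' : (phi t == (M + u *: D)%R)%MS by rewrite andbC.
have [g gU eg] := eqmx_unitP et'.
exists (row_mx (mxvec g) t); rewrite /dt /Phi row_mxKl row_mxKr mxvecK -eg; split=> //.
Qed.

(** If neither closed set contains X, each has an equation that is nonzero at some parameter, p1 or
    p2. On the line through p1 and p2 both equations and the determinant are nonzero polynomials in
    u, so some point of X lies in neither set. *)
Lemma param_irreducible : irreducible X.
Proof.
split=> //; split; first by exists (phi 0).
move=> Y1 Y2 [[_ gY1] [F1 H1]] [[_ gY2] [F2 H2]] cov.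
have sep Y F : (forall M, Y M <-> rank2 M /\ (forall f, F f -> pval f M = 0)) ->
    ~ subset X Y -> exists2 f, F f & exists2 M, X M & pval f M != 0.
  move=> HY nXY; apply: boolp.contrapT => nex; apply: nXY => M XM; apply/HY; split.
    by case: zX => [[+ _] _]; apply.
  move=> f Ff; apply/eqP; apply: boolp.contrapT => /negP fM; apply: nex.
  by exists f => //; exists M.
have [|n1] := boolp.pselect (subset X Y1); first by left.
right; apply: boolp.contrapT => n2.
have [f1 F1f [M1 XM1 f1M]] := sep _ _ H1 n1.
have [f2 F2f [M2 XM2 f2M]] := sep _ _ H2 n2.
have pf (f : {mpoly CC[2 * 4]}) : polyn (pval f) by exists f.
have [p1 [d1 {}f1M]] := param_dense (pf f1) XM1 f1M.
have [p2 [d2 {}f2M]] := param_dense (pf f2) XM2 f2M.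
have [K1 /(_ p1 (p2 - p1))[Q1 [_ e1]]] := ldeg_polyn (pf f1) ldeg_param.
have [K2 /(_ p1 (p2 - p1))[Q2 [_ e2]]] := ldeg_polyn (pf f2) ldeg_param.
have [Q3 [_ e3]] := ldeg_param_det p1 (p2 - p1).
have [u] : exists u, (Q1 * Q2 * Q3).[u] != 0.
  apply: poly_neq0_ex; rewrite !mulf_neq0 //.
  - by apply: contraNneq f1M => Q0; have := e1 0; rewrite scale0r addr0 Q0 horner0 => ->.
  - by apply: contraNneq f2M => Q0; have := e2 1; rewrite scale1r addrC subrK Q0 horner0 => ->.
  by apply: contraNneq d1 => Q0; have := e3 0; rewrite scale0r addr0 Q0 horner0 => ->.
rewrite !hornerM !mulf_eq0 !negb_or -e1 -e2 -e3 => /andP[/andP[g1 g2] g3].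
case: (cov _ (param_in g3)) => [/H1[_ /(_ _ F1f)]|/H2[_ /(_ _ F2f)]] /eqP.
  by rewrite (negbTE g1).
by rewrite (negbTE g2).
Qed.

(** There are 4 + d parameters, so any 4 + d + 1 polynomials satisfy a relation on the image of
    [Phi]; by density it holds on X. *)
Lemma param_dim : ~ has_chain X d.+1.
Proof.
apply: chain_bound; first by case: zX.
move=> P pP.
have HD i : exists D, ldeg D (fun p => P i (Phi p)) by apply: ldeg_polyn ldeg_param.
pose D := fun i => sval (boolp.cid (HD i)).
have HDi i : ldeg (\max_i D i) (fun p => P i (Phi p)).
  by apply: ldeg_le (svalP (boolp.cid (HD i))); rewrite (leq_bigmax (F := D)).
have [N [c [c0 Hc]]] := ldeg_dependent (P := fun i p => P i (Phi p)) ltac:(by rewrite addnS) HDi.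
exists N, c; split=> // M XM; apply/eqP; apply: contraT => cM.
have pS : polyn (fun M => \sum_e c e * \prod_i P i M ^+ e i).
  apply: polyn_sum => e; apply: polynM; first exact: polynC.
  by apply: polyn_prod => i; apply: polynX.
by have [p [_]] := param_dense pS XM cM; rewrite Hc eqxx.
Qed.

End Parametrization.

(** * Lines in projective space *)

Notation pt4 := 'rV[CC]_4.

Definition ind4 (e0 e1 e2 e3 : pt4) :=
  \det (col_mx (col_mx e0 e1) (col_mx e2 e3)) != 0.

Section Combinations.
Variables e0 e1 e2 e3 : pt4.
Implicit Types (v w : pt4) (M N : M24).

Let E : 'M_4 := col_mx (col_mx e0 e1) (col_mx e2 e3).

Lemma mul_E (x : 'rV[CC]_(1 + 1 + (1 + 1))) : x *m E =
  (lsubmx (lsubmx x)) 0 0 *: e0 + (rsubmx (lsubmx x)) 0 0 *: e1 +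
  ((lsubmx (rsubmx x)) 0 0 *: e2 + (rsubmx (rsubmx x)) 0 0 *: e3).
Proof.
rewrite -{1}[x]hsubmxK /E mul_row_col.
rewrite -{1}[lsubmx x]hsubmxK -{1}[rsubmx x]hsubmxK !mul_row_col.
by rewrite {1}[lsubmx (lsubmx x)]mx11_scalar {1}[rsubmx (lsubmx x)]mx11_scalar
  {1}[lsubmx (rsubmx x)]mx11_scalar {1}[rsubmx (rsubmx x)]mx11_scalar !mul_scalar_mx.
Qed.

Lemma ind4_eq0 a b c d : ind4 e0 e1 e2 e3 ->
  a *: e0 + b *: e1 + c *: e2 + d *: e3 = 0 -> [/\ a = 0, b = 0, c = 0 & d = 0].
Proof.
rewrite /ind4 -unitfE -unitmxE => EU H.
pose x : 'rV[CC]_(1 + 1 + (1 + 1)) :=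
  row_mx (row_mx a%:M b%:M) (row_mx c%:M d%:M).
have x0 : x = 0.
  rewrite -[x](mulmxK EU) (_ : x *m _ = 0) ?mul0mx // mul_E.
  by rewrite /x !(row_mxKl, row_mxKr) !mxE !mulr1n addrA.
have /eq_row_mx[/eq_row_mx[a0 b0] /eq_row_mx[c0 d0]] :
    x = row_mx (row_mx 0 0) (row_mx 0 0) by rewrite x0 !row_mx0.
split; [move: a0|move: b0|move: c0|move: d0] => /matrixP/(_ 0 0);
  by rewrite !mxE mulr1n.
Qed.

Lemma ind4_span v : ind4 e0 e1 e2 e3 ->
  exists a b c d, v = a *: e0 + b *: e1 + c *: e2 + d *: e3.
Proof.
rewrite /ind4 -unitfE -unitmxE => EU.
by rewrite -[v](mulmxKV EU) mul_E addrA; do 4 eexists.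
Qed.

End Combinations.

Lemma sub_col2P (v x y : pt4) :
  reflect (exists a b, v = a *: x + b *: y) (v <= col_mx x y)%MS.
Proof.
apply: (iffP submxP) => [[u ->]|[a [b ->]]].
  exists (lsubmx (u : 'rV_(1 + 1)) 0 0), (rsubmx (u : 'rV_(1 + 1)) 0 0).
  rewrite -[X in X *m _](hsubmxK (u : 'rV_(1 + 1))) mul_row_col.
  by rewrite -!mul_scalar_mx -!mx11_scalar.
by exists (row_mx a%:M b%:M); rewrite mul_row_col !mul_scalar_mx.
Qed.

Lemma sub_col3P (v x y z : pt4) :
  reflect (exists a b c, v = a *: x + b *: y + c *: z) (v <= col_mx x (col_mx y z))%MS.
Proof.
apply: (iffP submxP) => [[u ->]|[a [b [c ->]]]].
  exists (lsubmx (u : 'rV_(1 + 2)) 0 0), (lsubmx (rsubmx (u : 'rV_(1 + 2)) : 'rV_(1 + 1)) 0 0),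
    (rsubmx (rsubmx (u : 'rV_(1 + 2)) : 'rV_(1 + 1)) 0 0).
  rewrite -[X in X *m _](hsubmxK (u : 'rV_(1 + 2))) mul_row_col.
  rewrite -[X in _ + X *m _](hsubmxK (rsubmx (u : 'rV_(1 + 2)) : 'rV_(1 + 1))) mul_row_col.
  by rewrite -!mul_scalar_mx -!mx11_scalar addrA.
exists (row_mx a%:M (row_mx b%:M c%:M)).
by rewrite mul_row_col [X in _ = _ + X]mul_row_col !mul_scalar_mx addrA.
Qed.

Lemma rank2_col (v w : pt4) :
  rank2 (col_mx v w) <-> (forall a b, a *: v + b *: w = 0 -> a = 0 /\ b = 0).
Proof.
split=> [r a b H|H].
  have rf : row_free (col_mx v w) by rewrite /row_free r.
  have : row_mx a%:M b%:M *m col_mx v w = 0 by rewrite mul_row_col !mul_scalar_mx.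
  move=> /(congr1 (mulmx^~ (pinvmx (col_mx v w)))); rewrite -mulmxA mulmxVp // mulmx1 mul0mx.
  move=> /(congr1 (fun x : 'rV_(1 + 1) => (lsubmx x 0 0, rsubmx x 0 0))).
  by rewrite row_mxKl row_mxKr !mxE !mulr1n => -[].
suff: row_free (col_mx v w) by rewrite /row_free => /eqP.
apply: inj_row_free => u; rewrite -{1}[u](hsubmxK (u : 'rV_(1 + 1))) mul_row_col.
rewrite {1}[lsubmx _]mx11_scalar {1}[rsubmx _]mx11_scalar !mul_scalar_mx => /H[a0 b0].
rewrite -[u](hsubmxK (u : 'rV_(1 + 1))) [lsubmx _]mx11_scalar [rsubmx _]mx11_scalar a0 b0.
by rewrite !raddf0 row_mx0.
Qed.

Lemma eqmx_sub2 (M N : M24) : rank2 N -> (N <= M)%MS -> (M == N)%MS.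
Proof.
move=> rN NM; rewrite NM andbT.
by rewrite -(geq_leqif (mxrank_leqif_sup NM)) rN rank_leq_row.
Qed.

Lemma line_of2 (M : M24) (v w : pt4) : rank2 (col_mx v w) ->
  (v <= M)%MS -> (w <= M)%MS -> (M == col_mx v w)%MS.
Proof. by move=> r vM wM; apply: eqmx_sub2 => //; rewrite (col_mx_sub v w M) vM. Qed.

Lemma rank2_other (M : M24) (v : pt4) : rank2 M -> v != 0 -> (v <= M)%MS ->
  exists w, rank2 (col_mx v w) /\ (M == col_mx v w)%MS.
Proof.
move=> rM v0 vM.
have [w wM nw] : exists2 w : pt4, (w <= M)%MS & ~~ (w <= v)%MS.
  have /row_subPn[i Hi] : ~~ (M <= v)%MS.
    by apply/negP => /mxrankS; rewrite rM rank_rV v0.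
  by exists (row i M) => //; apply: row_sub.
have r : rank2 (col_mx v w).
  apply/rank2_col => a b H; have b0 : b = 0.
    apply: contraNeq nw => b0; apply/sub_rVP; exists (- (b^-1 * a)).
    apply: (scalerI b0); rewrite !scalerA mulrN mulrA divff // mul1r scaleNr.
    by apply/eqP; rewrite -subr_eq0 opprK addrC H.
  move/eqP: H; rewrite b0 scale0r addr0 scaler_eq0 (negbTE v0) orbF => /eqP.
  by [].
by exists w; split=> //; apply: line_of2.
Qed.

Definition meets (M : M24) (p q : pt4) :=
  exists a b, (a, b) != (0, 0) /\ ((a *: p + b *: q)%R <= M)%MS.

Lemma meets_det (M : M24) (p q : pt4) : rank2 M ->
  (\det (col_mx M (col_mx p q)) = 0 <-> meets M p q).
Proof.
move=> rM; have rf : row_free M by rewrite /row_free rM.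
split=> [/eqP/det0P[u u0 Hu]|[a [b [ab /submxP[x Hx]]]]].
  move: Hu; rewrite -{1}[u](hsubmxK (u : 'rV_(2 + 2))) mul_row_col.
  set x := lsubmx _; set y : 'rV_(1 + 1) := rsubmx _.
  rewrite -{1}[y]hsubmxK mul_row_col [lsubmx y]mx11_scalar [rsubmx y]mx11_scalar.
  rewrite !mul_scalar_mx => H.
  exists (lsubmx y 0 0), (rsubmx y 0 0); split; last first.
    by move/eqP: H; rewrite addrC addr_eq0 => /eqP ->; rewrite -mulNmx submxMl.
  apply: contraNneq u0 => -[a0 b0].
  have y0 : y = 0.
    by rewrite -[y]hsubmxK [lsubmx y]mx11_scalar [rsubmx y]mx11_scalar a0 b0 !raddf0 row_mx0.
  move: H; rewrite a0 b0 !scale0r !addr0 => /eqP.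
  rewrite mulmx_free_eq0 // => /eqP x0.
  by rewrite -[u](hsubmxK (u : 'rV_(2 + 2))) -/x -/y x0 y0 row_mx0.
apply/eqP/det0P; exists (row_mx (- x) (row_mx a%:M b%:M) : 'rV_(2 + (1 + 1))).
  apply: contraNneq ab => /(congr1 (fun v : 'rV_(2 + (1 + 1)) => rsubmx v)).
  rewrite row_mxKr => /(congr1 (fun v : 'rV_(1 + 1) => (lsubmx v 0 0, rsubmx v 0 0))).
  by rewrite row_mxKl row_mxKr !mxE !mulr1n => ->.
by rewrite mul_row_col [X in _ + X]mul_row_col !mul_scalar_mx Hx mulNmx addNr.
Qed.

Lemma meets_eqmx (M N : M24) p q : (M == N)%MS -> meets M p q -> meets N p q.
Proof. by case/andP=> MN _ [a [b [ab H]]]; exists a, b; split=> //; apply: submx_trans MN. Qed.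

(** Schubert conditions for arbitrary points: besides the Z_i, the arguments use auxiliary points
    such as the intersection of a line with a plane. *)
Definition SL (p q : pt4) : gset := fun M => rank2 M /\ meets M p q.
Definition SV (p : pt4) : gset := fun M => rank2 M /\ (p <= M)%MS.
Definition SP (p q r : pt4) : gset := fun M => rank2 M /\ (M <= col_mx p (col_mx q r))%MS.
Definition Spt (N : M24) : gset := fun M => rank2 M /\ (M == N)%MS.

Lemma zclosed_ext X Y : seteq X Y -> zclosed X -> zclosed Y.
Proof.
move=> XY [[gr gE] [F HF]]; split; last by exists F => M; rewrite -XY.
by split=> [M /XY/gr //|M N rM rN MN /XY HM]; apply/XY; apply: gE HM.
Qed.

Lemma zclosed_inter X Y : zclosed X -> zclosed Y -> zclosed (inter X Y).
Proof.
move=> [[gX gX'] [F HF]] [[gY gY'] [G HG]]; split.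
  split=> [M [/gX //]|M N rM rN MN [HX HY]].
  by split; [apply: gX' HX | apply: gY' HY].
exists (fun f => F f \/ G f) => M; split.
  by move=> [/HF[rM HM] /HG[_ HM']]; split=> // f [/HM|/HM'].
by move=> [rM HM]; split; [apply/HF|apply/HG]; split=> // f Hf; apply: HM; [left|right].
Qed.

Lemma zclosed_polyn (I : Type) (f : I -> M24 -> CC) (X : gset) :
  (forall i, polyn (f i)) -> (forall M N, rank2 M -> (M == N)%MS -> X M -> X N) ->
  (forall M, rank2 M -> (X M <-> forall i, f i M = 0)) ->
  (forall M, X M -> rank2 M) -> zclosed X.
Proof.
move=> pf XE Hf Xr; split; first by split=> // M N rM _; apply: XE.
exists (fun p => exists i, forall M, pval p M = f i M) => M; split=> [XM|[rM HM]].
  by have rM := Xr _ XM; split=> // p [i Hp]; rewrite -/(pval p M) Hp (Hf M rM).1.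
apply/(Hf M rM) => i; have [p Hp] := pf i; rewrite Hp; apply: HM.
by exists i => N; rewrite Hp.
Qed.

Lemma eqmx_rank2 (M N : M24) : (M == N)%MS -> rank2 M -> rank2 N.
Proof. by move=> /eqmxP MN; rewrite /rank2 MN. Qed.

Lemma polyn_det_col (p q : pt4) : polyn (fun M => \det (col_mx M (col_mx p q))).
Proof.
apply: (@polyn_det 4 (fun M => col_mx M (col_mx p q) : 'M_(2 + 2))) => i j.
case: (splitP (i : 'I_(2 + 2))) => k ek.
  have -> : i = lshift 2 k by apply: val_inj.
  by apply: (@polyn_ext (fun M => M k j)) => [M|]; [rewrite (col_mxEu M (col_mx p q) k j) | exact: polyn_coord].
have -> : i = rshift 2 k by apply: val_inj.
by apply: polyn_ext (polynC (col_mx p q k j)) => M; rewrite (col_mxEd M (col_mx p q) k j).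
Qed.

Lemma zclosed_SL p q : zclosed (SL p q).
Proof.
apply: (@zclosed_polyn unit (fun _ M => \det (col_mx M (col_mx p q)))).
- by move=> _; apply: polyn_det_col.
- by move=> M N rM MN [_ H]; split; [apply: eqmx_rank2 rM | apply: meets_eqmx H].
- move=> M rM; split=> [[_ /(meets_det _ _ rM) H] _ //|H].
  by split=> //; apply/meets_det => //; apply: H.
by move=> M [].
Qed.

Lemma zclosed_SP p q r : zclosed (SP p q r).
Proof.
pose A := cokermx (col_mx p (col_mx q r)).
apply: (@zclosed_polyn ('I_2 * 'I_4)%type (fun ij M => (M *m A) ij.1 ij.2)).
- move=> [i j]; apply: (@polyn_ext (fun M => \sum_l M i l * A l j)) => [M|].
    by rewrite mxE.
  by apply: polyn_sum => l; apply: polynM; [exact: polyn_coord | exact: polynC].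
- by move=> M N rM MN [_ H]; split; [apply: eqmx_rank2 rM | case/andP: MN => _ /submx_trans->].
- move=> M rM; rewrite /SP submxE; split=> [[_ /eqP H] [i j]|H].
    by rewrite /A H mxE.
  by split=> //; apply/eqP/matrixP => i j; rewrite (H (i, j)) mxE.
by move=> M [].
Qed.

Lemma zclosed_Spt N : zclosed (Spt N).
Proof.
apply: (@zclosed_polyn ('I_2 * 'I_4)%type (fun ij M => (M *m cokermx N) ij.1 ij.2)).
- move=> [i j]; apply: (@polyn_ext (fun M => \sum_l M i l * cokermx N l j)) => [M|].
    by rewrite mxE.
  by apply: polyn_sum => l; apply: polynM; [exact: polyn_coord | exact: polynC].
- move=> M N' rM MN [_ H]; split; first by apply: eqmx_rank2 rM.
  case/andP: MN H => a b /andP[c d].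
  by rewrite (submx_trans b c) (submx_trans d a).
- move=> M rM; rewrite /Spt; split=> [[_ /andP[+ _]] [i j]|H].
    by rewrite submxE => /eqP ->; rewrite mxE.
  split=> //; have MN : (M <= N)%MS.
    by rewrite submxE; apply/eqP/matrixP => i j; rewrite (H (i, j)) mxE.
  by rewrite andbC; apply: eqmx_sub2.
by move=> M [].
Qed.

(** The equations say that M meets the join of p with each coordinate point. If p were not on M, all
    coordinate vectors would lie in the span of M and p, which has dimension at most 3. *)
Lemma zclosed_SV p : p != 0 -> zclosed (SV p).
Proof.
move=> p0; apply: (@zclosed_polyn 'I_4 (fun k M => \det (col_mx M (col_mx p (delta_mx 0 k))))).
- by move=> k; apply: polyn_det_col.
- by move=> M N rM MN [_ H]; split; [apply: eqmx_rank2 rM | case/andP: MN => /(submx_trans H)].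
- move=> M rM; split=> [[_ pM] k|H].
    apply/meets_det => //; exists 1, 0; rewrite scale1r scale0r addr0; split=> //.
    by rewrite xpair_eqE oner_eq0.
  split=> //; apply: contraT => npM.
  have sub : (1%:M <= col_mx M p)%MS.
    apply/row_subP => k; rewrite rowE mulmx1.
    have [a [b [ab Hab]]] := (meets_det _ _ rM).1 (H k).
    have b0 : b != 0.
      apply: contraNneq npM => b0; move: Hab; rewrite b0 scale0r addr0 eqmx_scale //.
      by apply: contraNneq ab => ->; rewrite b0.
    rewrite -(eqmx_scale _ b0) -(addKr (a *: p) (b *: _)) addrC.
    rewrite -addsmxE addmx_sub_adds //.
    by rewrite -scaleNr scalemx_sub.
  have := mxrankS sub; rewrite mxrank1 => /leq_trans/(_ (rank_leq_row _)).
  by [].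
by move=> M [].
Qed.

(** The chain condition bounds the dimension from above; the lower bound comes from flags of
    strata. *)
Definition irrdim (X : gset) d := irreducible X /\ ~ has_chain X d.+1.

Ltac vring := apply/rowP => ?; rewrite !mxE /=; ring.
Ltac vfield := apply/rowP => ?; rewrite !mxE /=; field; do ?[apply/andP; split].

Lemma sub_col_mx (v w x y : pt4) a b c d : v = a *: x + b *: y -> w = c *: x + d *: y ->
  (col_mx v w <= col_mx x y)%MS.
Proof.
by move=> ev ew; rewrite (col_mx_sub v w) !(introT (sub_col2P _ _ _)) //; [exists c, d | exists a, b].
Qed.

Lemma sub_col_mx3 (v w x y z : pt4) a b c a' b' c' :
  v = a *: x + b *: y + c *: z -> w = a' *: x + b' *: y + c' *: z ->
  (col_mx v w <= col_mx x (col_mx y z))%MS.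
Proof.
move=> ev ew; rewrite (col_mx_sub v w) !(introT (sub_col3P _ _ _ _)) //.
  by exists a', b', c'.
by exists a, b, c.
Qed.

(** The form in which the parametrization results are applied: a line is given by two points, and
    inclusion of the spans suffices because [phi t] has rank 2. *)
Lemma irrdim_param d (X : gset) (a a' : pt4) (c c' : 'I_d -> pt4) : zclosed X ->
  let phi (t : 'rV_d) := col_mx (a + \sum_k t 0 k *: c k) (a' + \sum_k t 0 k *: c' k) in
  (forall t : 'rV_d, X (phi t)) ->
  (forall M, X M -> exists (v w v' w' : pt4) (h : {poly CC}),
     [/\ (M == col_mx v w)%MS, h != 0 & forall u, h.[u] != 0 ->
      exists t : 'rV_d, (phi t <= col_mx (v + u *: v')%R (w + u *: w')%R)%MS]) ->
  irrdim X d.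
Proof.
move=> zX phi XP dense.
pose C k : M24 := col_mx (c k) (c' k).
pose A : M24 := col_mx a a'.
have phiE (t : 'rV[CC]_d) : A + \sum_k t 0 k *: C k = phi t.
  have -> : \sum_k t 0 k *: C k = col_mx (\sum_k t 0 k *: c k) (\sum_k t 0 k *: c' k).
    apply/matrixP => i j; rewrite summxE; case: (splitP (i : 'I_(1 + 1))) => l el.
      have -> : i = lshift 1 l by apply: val_inj.
      rewrite [RHS](col_mxEu (\sum_k t 0 k *: c k) (\sum_k t 0 k *: c' k) l j) summxE.
      by apply: eq_bigr => k _; rewrite mxE [in LHS](col_mxEu (c k) (c' k) l j) mxE.
    have -> : i = rshift 1 l by apply: val_inj.
    rewrite [RHS](col_mxEd (\sum_k t 0 k *: c k) (\sum_k t 0 k *: c' k) l j) summxE.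
    by apply: eq_bigr => k _; rewrite mxE [in LHS](col_mxEd (c k) (c' k) l j) mxE.
  by rewrite (add_col_mx a a').
have dn : forall M, X M -> exists (D : M24) (h : {poly CC}), h != 0 /\
  forall u, h.[u] != 0 -> exists t : 'rV_d,
     ((M + u *: D)%R == (A + \sum_k t 0 k *: C k)%R)%MS.
  move=> M /dense[v [w [v' [w' [h [Mvw h0 Hh]]]]]].
  have Mvw' : (col_mx v w == M)%MS by rewrite andbC.
  have [g gU eM] := eqmx_unitP Mvw'.
  exists (g *m col_mx v' w'), h; split=> // u /Hh[t Ht]; exists t; rewrite phiE.
  apply: eqmx_sub2; first by have [[gr _] _] := zX; apply: gr.
  rewrite eM scalemxAr -mulmxDr (scale_col_mx u v' w') (add_col_mx v w).
  by rewrite (eqmxMfull (col_mx (v + u *: v') (w + u *: w'))) ?row_full_unit.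
have XP' (t : 'rV[CC]_d) : X (A + \sum_k t 0 k *: C k) by rewrite (phiE t).
by split; [apply: param_irreducible dn | apply: param_dim dn].
Qed.

Lemma polyXaddC_neq0 (a : CC) : 'X + a%:P != 0.
Proof. by rewrite monic_neq0 // monicXaddC. Qed.

Lemma irreducible_ext X Y : seteq X Y -> irreducible X -> irreducible Y.
Proof.
move=> XY [zX [[M XM] irr]]; split; first exact: zclosed_ext zX.
split=> [|Y1 Y2 z1 z2 sub]; first by exists M; apply/XY.
have [s|s] := irr Y1 Y2 z1 z2 (fun N XN => sub N ((XY N).1 XN)); [left|right];
  by move=> N /XY; apply: s.
Qed.

Lemma irrdim_ext X Y d : seteq X Y -> irrdim X d -> irrdim Y d.
Proof.
move=> XY [irr ch]; split; first exact: irreducible_ext irr.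
move=> [f [f1 f2]]; apply: ch; exists f; split=> // k lek.
by have [fi fY] := f1 k lek; split=> // N /fY/XY.
Qed.

(** * Standard families of lines relative to four independent points *)

Section IndependentPoints.
Variables e0 e1 e2 e3 : pt4.
Hypothesis ind : ind4 e0 e1 e2 e3.

Lemma ind_rank2 (v w : pt4) a b c d a' b' c' d' :
  v = a *: e0 + b *: e1 + c *: e2 + d *: e3 ->
  w = a' *: e0 + b' *: e1 + c' *: e2 + d' *: e3 ->
  (forall s t, s * a + t * a' = 0 -> s * b + t * b' = 0 ->
               s * c + t * c' = 0 -> s * d + t * d' = 0 -> s = 0 /\ t = 0) ->
  rank2 (col_mx v w).
Proof.
move=> -> -> H; apply/rank2_col => s t E.
have [|h1 h2 h3 h4] := ind4_eq0 (a := s * a + t * a') (b := s * b + t * b')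
   (c := s * c + t * c') (d := s * d + t * d') ind; last exact: H.
by rewrite -E; vring.
Qed.

Lemma ind_neq0 : e0 != 0.
Proof.
apply/eqP => E; have [|/eqP] := ind4_eq0 (a := 1) (b := 0) (c := 0) (d := 0) ind.
  by rewrite E; vring.
by rewrite oner_eq0.
Qed.

Lemma meets_row (x y p q : pt4) a b c d : (a, b) != (0, 0) ->
  a *: p + b *: q = c *: x + d *: y -> meets (col_mx x y) p q.
Proof. by move=> ab E; exists a, b; split=> //; apply/sub_col2P; exists c, d. Qed.

Lemma pair_neq0 (a b : CC) : a != 0 \/ b != 0 -> (a, b) != (0, 0).
Proof. by rewrite xpair_eqE negb_and => /orP. Qed.

Lemma irrdim_SL : irrdim (SL e0 e1) 3.
Proof.
apply: (@irrdim_param 3 _ e0 e3 (fun k => nth 0 [:: e1; 0; 0] k)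
   (fun k => nth 0 [:: 0; e1; e2] k) (zclosed_SL _ _)) => [t|M [rM]].
  split.
    apply: (@ind_rank2 _ _ 1 (t 0 0) 0 0 0 (t 0 1) (t 0 2%:R) 1).
    - rewrite !big_ord_recl big_ord0.
      have -> : lift ord0 ord0 = 1 :> 'I_3 by apply: val_inj.
      have -> : lift ord0 (lift ord0 ord0) = 2%:R :> 'I_3 by apply: val_inj.
      by vring.
    - rewrite !big_ord_recl big_ord0.
      have -> : lift ord0 ord0 = 1 :> 'I_3 by apply: val_inj.
      have -> : lift ord0 (lift ord0 ord0) = 2%:R :> 'I_3 by apply: val_inj.
      by vring.
    - by move=> s u; rewrite !(mulr1, mulr0, addr0, add0r).
  apply: (@meets_row _ _ _ _ 1 (t 0 0) 1 0); first by apply: pair_neq0; left; rewrite oner_eq0.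
  rewrite !big_ord_recl big_ord0. by vring.
move=> [a [b [ab vM]]].
have v0 : a *: e0 + b *: e1 != 0.
  apply: contraNneq ab => E; have [|-> -> //] := ind4_eq0 (a := a) (b := b) (c := 0) (d := 0) ind.
  by rewrite E; vring.
have [w [_ MW]] := rank2_other rM v0 vM.
have [c0 [c1 [c2 [c3 ew]]]] := ind4_span w ind.
(* In the chart the first point has e0-coordinate 1, and the second has e0-coordinate 0 and
   e3-coordinate 1. Moving the points along e0 and e3 makes the divisors u + a and u + c3 nonzero.
   The other families are perturbed likewise. *)
exists (a *: e0 + b *: e1), w, e0, e3, (('X + a%:P) * ('X + c3%:P)); split=> //.
  by rewrite mulf_neq0 ?polyXaddC_neq0.
move=> u; rewrite hornerM !hornerD !hornerX !hornerC mulf_eq0 negb_or => /andP[ua uc].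
exists (\row_k nth 0 [:: b / (u + a); (c1 - c0 * b / (u + a)) / (u + c3); c2 / (u + c3)] k).
apply: (@sub_col_mx _ _ _ _ ((u + a)^-1) 0 (- c0 / ((u + a) * (u + c3))) ((u + c3)^-1)).
  by rewrite !big_ord_recl big_ord0; vfield.
by rewrite !big_ord_recl big_ord0 ew; vfield.
Qed.

Lemma irrdim_LL : irrdim (inter (SL e0 e1) (SL e2 e3)) 2.
Proof.
apply: (@irrdim_param 2 _ e0 e2 (fun k => nth 0 [:: e1; 0] k) (fun k => nth 0 [:: 0; e3] k)).
- by apply: zclosed_inter; apply: zclosed_SL.
- move=> t.
  have r : rank2 (col_mx (e0 + \sum_(k < 2) t 0 k *: [:: e1; 0]`_k)
      (e2 + \sum_(k < 2) t 0 k *: [:: 0; e3]`_k)).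
    rewrite !big_ord_recl !big_ord0.
    apply: (@ind_rank2 _ _ 1 (t 0 ord0) 0 0 0 0 1 (t 0 (lift ord0 ord0))); [vring|vring|].
    by move=> s u; rewrite !(mulr1, mulr0, addr0, add0r).
  split; split=> //; rewrite !big_ord_recl !big_ord0.
    apply: (@meets_row _ _ _ _ 1 (t 0 ord0) 1 0); last vring.
    by apply: pair_neq0; left; rewrite oner_eq0.
  apply: (@meets_row _ _ _ _ 1 (t 0 (lift ord0 ord0)) 0 1); last vring.
  by apply: pair_neq0; left; rewrite oner_eq0.
move=> M [[rM [a [b [ab vM]]]] [_ [c [d [cd wM]]]]].
exists (a *: e0 + b *: e1), (c *: e2 + d *: e3), e0, e2, (('X + a%:P) * ('X + c%:P)); split.
- apply: line_of2 => //; apply: (@ind_rank2 _ _ a b 0 0 0 0 c d); [vring|vring|].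
  move=> s u; rewrite !(mulr0, addr0, add0r) => /eqP h1 /eqP h2 /eqP h3 /eqP h4.
  move: h1 h2 h3 h4; rewrite !mulf_eq0.
  case: (eqVneq s 0) => [->|] /=; last by move=> _ /eqP a0 /eqP b0; rewrite a0 b0 eqxx in ab.
  case: (eqVneq u 0) => [->|] //= _ _ _ /eqP c0 /eqP d0.
  by rewrite c0 d0 eqxx in cd.
- by rewrite mulf_neq0 ?polyXaddC_neq0.
move=> u; rewrite hornerM !hornerD !hornerX !hornerC mulf_eq0 negb_or => /andP[ua uc].
exists (\row_k nth 0 [:: b / (u + a); d / (u + c)] k).
apply: (@sub_col_mx _ _ _ _ ((u + a)^-1) 0 0 ((u + c)^-1)).
  by rewrite !big_ord_recl big_ord0; vfield.
by rewrite !big_ord_recl big_ord0; vfield.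
Qed.

Lemma irrdim_SV : irrdim (SV e0) 2.
Proof.
apply: (@irrdim_param 2 _ e0 e1 (fun k => nth 0 [:: 0; 0] k) (fun k => nth 0 [:: e2; e3] k)).
- exact/zclosed_SV/ind_neq0.
- move=> t; rewrite !big_ord_recl !big_ord0; split.
    apply: (@ind_rank2 _ _ 1 0 0 0 0 1 (t 0 ord0) (t 0 (lift ord0 ord0))); [vring|vring|].
    by move=> s u; rewrite !(mulr1, mulr0, addr0, add0r).
  by apply/sub_col2P; exists 1, 0; vring.
move=> M [rM vM].
have [w [_ MW]] := rank2_other rM ind_neq0 vM.
have [c0 [c1 [c2 [c3 ew]]]] := ind4_span w ind.
exists e0, w, 0, e1, ('X + c1%:P); split=> //; first exact: polyXaddC_neq0.
move=> u; rewrite !hornerD !hornerX !hornerC => uc.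
exists (\row_k nth 0 [:: c2 / (u + c1); c3 / (u + c1)] k).
apply: (@sub_col_mx _ _ _ _ 1 0 (- c0 / (u + c1)) ((u + c1)^-1)).
  by rewrite !big_ord_recl big_ord0; vring.
by rewrite !big_ord_recl big_ord0 ew; vfield.
Qed.

Lemma irrdim_SP : irrdim (SP e0 e1 e2) 2.
Proof.
apply: (@irrdim_param 2 _ e0 e1 (fun k => nth 0 [:: e2; 0] k) (fun k => nth 0 [:: 0; e2] k)).
- exact/zclosed_SP.
- move=> t; rewrite !big_ord_recl !big_ord0; split.
    apply: (@ind_rank2 _ _ 1 0 (t 0 ord0) 0 0 1 (t 0 (lift ord0 ord0)) 0); [vring|vring|].
    by move=> s u; rewrite !(mulr1, mulr0, addr0, add0r).
  by apply: (@sub_col_mx3 _ _ _ _ _ 1 0 (t 0 ord0) 0 1 (t 0 (lift ord0 ord0))); vring.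
move=> M [rM MP].
have rows i : exists a b c, row i M = a *: e0 + b *: e1 + c *: e2.
  exact/sub_col3P/(submx_trans (row_sub i M)).
have [a0 [a1 [a2 ea]]] := rows ord0; have [b0 [b1 [b2 eb]]] := rows ord_max.
(* h is the determinant of the e0 and e1 coordinates of the two perturbed rows; the coefficients
   below form the inverse of that block. *)
exists (row ord0 M), (row ord_max M), e0, e1,
  (('X + a0%:P) * ('X + b1%:P) - (a1 * b0)%:P); split.
- have M2 : M = col_mx (row ord0 M) (row ord_max M).
    apply/row_matrixP => i; case: (splitP (i : 'I_(1 + 1))) => k ek.
      rewrite (_ : i = lshift 1 k) ?(@rowKu _ 1 1); last exact: val_inj.
      by rewrite [RHS]row_id; congr (row _ M); apply: val_inj; rewrite ord1.
    rewrite (_ : i = rshift 1 k) ?(@rowKd _ 1 1); last exact: val_inj.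
    by rewrite [RHS]row_id; congr (row _ M); apply: val_inj; rewrite ord1.
  by rewrite -M2; apply/eqmxP.
- apply/eqP => /subr0_eq/(congr1 (fun p : {poly CC} => size p)).
  rewrite size_mul ?polyXaddC_neq0 // !size_XaddC /= => H.
  by have := size_polyC_leq1 (a1 * b0); rewrite -H.
move=> u; rewrite hornerD hornerN hornerM !hornerD !hornerX !hornerC => de.
exists (\row_k nth 0 [:: ((u + b1) * a2 - a1 * b2) / ((u + a0) * (u + b1) - a1 * b0);
   ((u + a0) * b2 - b0 * a2) / ((u + a0) * (u + b1) - a1 * b0)] k).
apply: (@sub_col_mx _ _ _ _ ((u + b1) / ((u + a0) * (u + b1) - a1 * b0))
   (- a1 / ((u + a0) * (u + b1) - a1 * b0))
   (- b0 / ((u + a0) * (u + b1) - a1 * b0))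
   ((u + a0) / ((u + a0) * (u + b1) - a1 * b0))); rewrite !big_ord_recl big_ord0 ea eb; by vfield.
Qed.

Lemma irrdim_pencil : irrdim (inter (SV e0) (SP e0 e1 e2)) 1.
Proof.
apply: (@irrdim_param 1 _ e0 e1 (fun k => 0) (fun k => e2)).
- by apply: zclosed_inter; [exact/zclosed_SV/ind_neq0 | exact: zclosed_SP].
- move=> t; rewrite !big_ord_recl !big_ord0.
  have r : rank2 (col_mx (e0 + (t 0 ord0 *: 0 + 0)) (e1 + (t 0 ord0 *: e2 + 0))).
    apply: (@ind_rank2 _ _ 1 0 0 0 0 1 (t 0 ord0) 0); [vring|vring|].
    by move=> s u; rewrite !(mulr1, mulr0, addr0, add0r).
  split; split=> //; first by apply/sub_col2P; exists 1, 0; vring.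
  by apply: (@sub_col_mx3 _ _ _ _ _ 1 0 0 0 1 (t 0 ord0)); vring.
move=> M [[rM vM] [_ MP]].
have [w [_ MW]] := rank2_other rM ind_neq0 vM.
have [c0 [c1 [c2 ew]]] : exists c0 c1 c2, w = c0 *: e0 + c1 *: e1 + c2 *: e2.
  apply/sub_col3P; apply: submx_trans MP.
  have /andP[_] := MW; rewrite (col_mx_sub e0 w M) => /andP[_].
  by [].
exists e0, w, 0, e1, ('X + c1%:P); split=> //; first exact: polyXaddC_neq0.
move=> u; rewrite !hornerD !hornerX !hornerC => uc.
exists (\row_k (c2 / (u + c1))).
apply: (@sub_col_mx _ _ _ _ 1 0 (- c0 / (u + c1)) ((u + c1)^-1)).
  by rewrite !big_ord_recl big_ord0; vring.
by rewrite !big_ord_recl big_ord0 ew; vfield.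
Qed.

(** The point of M on the third line is a combination of its points on the first two, and comparing
    coordinates gives all three the same ratio p : q. So M belongs to one ruling of the quadric
    through the three lines. *)
Lemma regulusP M : rank2 M ->
  meets M e0 e1 -> meets M e2 e3 -> meets M (e0 + e2) (e1 + e3) ->
  exists p q, (p, q) != (0, 0) /\ (M == col_mx (p *: e0 + q *: e1) (p *: e2 + q *: e3))%MS.
Proof.
move=> rM [a [b [ab vM]]] [c [d [cd wM]]] [p [q [pq xM]]].
exists p, q; split=> //.
have r x y x' y' : (x, y) != (0, 0) -> (x', y') != (0, 0) ->
    rank2 (col_mx (x *: e0 + y *: e1) (x' *: e2 + y' *: e3)).
  move=> xy xy'; apply: (@ind_rank2 _ _ x y 0 0 0 0 x' y'); [vring|vring|].
  move=> s u; rewrite !(mulr0, addr0, add0r) => /eqP h1 /eqP h2 /eqP h3 /eqP h4.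
  move: h1 h2 h3 h4; rewrite !mulf_eq0.
  case: (eqVneq s 0) => [->|] /=; last by move=> _ /eqP a0 /eqP b0; rewrite a0 b0 eqxx in xy.
  case: (eqVneq u 0) => [->|] //= _ _ _ /eqP c0 /eqP d0.
  by rewrite c0 d0 eqxx in xy'.
have /andP[Mvw _] := line_of2 (r _ _ _ _ ab cd) vM wM.
have /sub_col2P[al [be E]] := submx_trans xM Mvw.
have [|h0 h1 h2 h3] := ind4_eq0 (a := p - al * a) (b := q - al * b)
  (c := p - be * c) (d := q - be * d) ind.
  move/eqP: E; rewrite -subr_eq0 => /eqP <-; vring.
apply: line_of2; first exact: r.
  rewrite (subr0_eq h0) (subr0_eq h1) -!scalerA -scalerDr; exact: scalemx_sub.
rewrite (subr0_eq h2) (subr0_eq h3) -!scalerA -scalerDr; exact: scalemx_sub.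
Qed.

Lemma irrdim_regulus :
  irrdim (inter (SL e0 e1) (inter (SL e2 e3) (SL (e0 + e2) (e1 + e3)))) 1.
Proof.
apply: (@irrdim_param 1 _ e0 e2 (fun k => e1) (fun k => e3)).
- by do 2 (apply: zclosed_inter; first exact: zclosed_SL); apply: zclosed_SL.
- move=> t; rewrite !big_ord_recl !big_ord0.
  have r : rank2 (col_mx (e0 + (t 0 ord0 *: e1 + 0)) (e2 + (t 0 ord0 *: e3 + 0))).
    apply: (@ind_rank2 _ _ 1 (t 0 ord0) 0 0 0 0 1 (t 0 ord0)); [vring|vring|].
    by move=> s u; rewrite !(mulr1, mulr0, addr0, add0r).
  have n10 := @pair_neq0 1 (t 0 ord0) (or_introl (oner_neq0 _)).
  split; last split; split=> //.
  + by apply: (@meets_row _ _ _ _ 1 (t 0 ord0) 1 0) => //; vring.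
  + by apply: (@meets_row _ _ _ _ 1 (t 0 ord0) 0 1) => //; vring.
  + by apply: (@meets_row _ _ _ _ 1 (t 0 ord0) 1 1) => //; vring.
move=> M [[rM m1] [[_ m2] [_ m3]]].
have [p [q [pq MW]]] := regulusP rM m1 m2 m3.
exists (p *: e0 + q *: e1), (p *: e2 + q *: e3), e0, e2, ('X + p%:P); split=> //.
  exact: polyXaddC_neq0.
move=> u; rewrite !hornerD !hornerX !hornerC => uc.
exists (\row_k (q / (u + p))).
apply: (@sub_col_mx _ _ _ _ ((u + p)^-1) 0 0 ((u + p)^-1)); rewrite !big_ord_recl big_ord0; by vfield.
Qed.

End IndependentPoints.

Lemma irrdim_Spt (N : M24) : rank2 N -> irrdim (Spt N) 0.
Proof.
move=> rN.
have rN0 : rank2 N := rN.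
have [v [w Nvw]] : exists v w : pt4, N = col_mx v w.
  exists (usubmx (N : 'M_(1 + 1, 4))), (dsubmx (N : 'M_(1 + 1, 4))).
  by rewrite (vsubmxK (N : 'M_(1 + 1, 4))).
subst N; apply: (@irrdim_param 0 _ v w (fun k => 0) (fun k => 0)).
- exact: zclosed_Spt.
- by move=> t; rewrite !big_ord0 !addr0; split=> //; apply/eqmxP.
move=> M [rM MN]; exists v, w, 0, 0, 1; split=> //; first exact: oner_neq0.
by move=> u _; exists 0; rewrite !big_ord0 !scaler0 !addr0.
Qed.

(** * Positivity of brackets *)

Section Det4.
Variable F : comNzRingType.
Implicit Types p q r s : 'rV[F]_4.

Definition det4 p q r s := \det (col_mx (col_mx p q) (col_mx r s)).

Definition minor2 p q (i j : nat) := p 0 (inord i) * q 0 (inord j) - p 0 (inord j) * q 0 (inord i).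

(** Laplace expansion along the first two rows; it lets [ring] decide bracket identities. *)
Lemma det_fun4 (f : nat -> nat -> F) :
  let m a b i j := f a i * f b j - f a j * f b i in
  \det (\matrix_(i < 4, j < 4) f i j) =
  m 0 1 0 1 * m 2 3 2 3 - m 0 1 0 2 * m 2 3 1 3
  + m 0 1 0 3 * m 2 3 1 2 + m 0 1 1 2 * m 2 3 0 3
  - m 0 1 1 3 * m 2 3 0 2 + m 0 1 2 3 * m 2 3 0 1.
Proof.
move=> m; rewrite (expand_det_row _ ord0) !big_ord_recl big_ord0 /cofactor.
rewrite !(@expand_det_row F 3 _ ord0) !big_ord_recl !big_ord0 /cofactor.
rewrite !det2E !mxE /= /bump /= /m !(addn0, add0n, expr0, expr1, mul1r, addn1).
by rewrite /m; ring.
Qed.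

Lemma det4_nth p q r s : det4 p q r s = \det (\matrix_(i < 4, j < 4) [:: p; q; r; s]`_i 0 j).
Proof.
congr (\det _); apply/matrixP => i j; rewrite [RHS]mxE.
case: (splitP (i : 'I_(2 + 2))) => k ek; case: (splitP (k : 'I_(1 + 1))) => l el.
- have -> : i = lshift 2 (lshift 1 l) by apply: val_inj; rewrite /= ek el.
  by rewrite (col_mxEu (col_mx p q)) (col_mxEu p) !ord1.
- have -> : i = lshift 2 (rshift 1 l) by apply: val_inj; rewrite /= ek el.
  by rewrite (col_mxEu (col_mx p q)) (col_mxEd p) !ord1.
- have -> : i = rshift 2 (lshift 1 l) by apply: val_inj; rewrite /= ek el.
  by rewrite (col_mxEd (col_mx p q)) (col_mxEu r) !ord1.
have -> : i = rshift 2 (rshift 1 l) by apply: val_inj; rewrite /= ek el.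
by rewrite (col_mxEd (col_mx p q)) (col_mxEd r) !ord1.
Qed.

Lemma det4E p q r s : det4 p q r s =
  minor2 p q 0 1 * minor2 r s 2 3 - minor2 p q 0 2 * minor2 r s 1 3
  + minor2 p q 0 3 * minor2 r s 1 2 + minor2 p q 1 2 * minor2 r s 0 3
  - minor2 p q 1 3 * minor2 r s 0 2 + minor2 p q 2 3 * minor2 r s 0 1.
Proof.
rewrite det4_nth -(@det_fun4 (fun a j => [:: p; q; r; s]`_a 0 (inord j))).
by congr (\det _); apply/matrixP => i j; rewrite !mxE inord_val.
Qed.

Lemma plucker3 x y a b c d :
  det4 x y a b * det4 x y c d - det4 x y a c * det4 x y b d + det4 x y a d * det4 x y b c = 0.
Proof. by rewrite !det4E /minor2; ring. Qed.

Lemma det4_swap12 p q r s : det4 q p r s = - det4 p q r s.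
Proof. by rewrite !det4E /minor2; ring. Qed.

Lemma det4_swap23 p q r s : det4 p r q s = - det4 p q r s.
Proof. by rewrite !det4E /minor2; ring. Qed.

Lemma det4_swap34 p q r s : det4 p q s r = - det4 p q r s.
Proof. by rewrite !det4E /minor2; ring. Qed.

Lemma det4_rot p q r s : det4 s p q r = - det4 p q r s.
Proof. by rewrite det4_swap12 det4_swap23 det4_swap34 !opprK. Qed.

Lemma det4_lin1 a b p p' q r s :
  det4 (a *: p + b *: p') q r s = a * det4 p q r s + b * det4 p' q r s.
Proof. by rewrite !det4E /minor2 !mxE; ring. Qed.

(* Both sides are [x, 5 /\ 6, (3 4 /\ 7 8)] computed in the quotient by x. *)
Lemma plucker_lines x p3 p4 p5 p6 p7 p8 :
  det4 x p5 p7 p8 * det4 x p3 p4 p6 - det4 x p6 p7 p8 * det4 x p3 p4 p5 =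
  det4 x p5 p6 p8 * det4 x p3 p4 p7 - det4 x p5 p6 p7 * det4 x p3 p4 p8.
Proof. by rewrite !det4E /minor2; ring. Qed.

End Det4.

(** * Ratio inequalities for positive brackets with one point fixed *)

Section PositiveBrackets.
Variables (F : realFieldType) (g : nat -> nat -> nat -> F).
Hypothesis swap12 : forall a b c, g b a c = - g a b c.
Hypothesis swap23 : forall a b c, g a c b = - g a b c.
Hypothesis plucker : forall x a b c d,
  g x a b * g x c d - g x a c * g x b d + g x a d * g x b c = 0.
Hypothesis pos : forall a b c, (a < b)%N -> (b < c)%N -> (c < 6)%N -> 0 < g a b c.

(** Transitivity for fractions: e/f < c/d < a/b. *)
Lemma ratio_trans (a b c d e f : F) : 0 < b -> 0 < d -> 0 < f ->
  c * b < a * d -> e * d < c * f -> e * b < a * f.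
Proof.
move=> b0 d0 f0 h1 h2; rewrite -(ltr_pM2r d0).
have : c * b * f < a * d * f by rewrite ltr_pM2r.
have : e * d * b < c * f * b by rewrite ltr_pM2r.
lra.
Qed.

Lemma rot3 a b c : g c a b = g a b c.
Proof. by rewrite swap12 swap23 opprK. Qed.

(** With [abc] for [g a b c]: [234]/[134] < [023]/[013] < [025]/[015]. Each comparison is a
    three-term relation whose remaining product is positive. *)
Lemma bracket_ineq1 : g 2 3 4 * g 0 1 5 < g 1 3 4 * g 0 2 5.
Proof.
rewrite (mulrC (g 1 3 4)).
apply: (@ratio_trans _ _ (g 0 2 3) (g 0 1 3)); rewrite ?pos //.
  have := plucker 0 1 2 3 5.
  have := mulr_gt0 (@pos 0 1 2 isT isT isT) (@pos 0 3 5 isT isT isT); lra.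
have := plucker 3 0 1 2 4.
rewrite (rot3 0 1) (rot3 0 2) (rot3 1 2) (swap12 2 3) (swap12 1 3) (swap12 0 3).
have := mulr_gt0 (@pos 0 3 4 isT isT isT) (@pos 1 2 3 isT isT isT); lra.
Qed.

(** By [345]/[245] < [134]/[124] < [013]/[012]. *)
Lemma bracket_ineq2 : g 3 4 5 * g 0 1 2 < g 2 4 5 * g 0 1 3.
Proof.
rewrite (mulrC (g 2 4 5)).
apply: (@ratio_trans _ _ (g 1 3 4) (g 1 2 4)); rewrite ?pos //.
  have := plucker 1 0 2 3 4.
  rewrite (swap12 0 1 2) (swap12 0 1 3) (swap12 0 1 4).
  have := mulr_gt0 (@pos 0 1 4 isT isT isT) (@pos 1 2 3 isT isT isT); lra.
have := plucker 4 1 2 3 5.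
rewrite (rot3 1 2) (rot3 1 3) (rot3 2 3) (swap12 3 4) (swap12 2 4) (swap12 1 4).
have := mulr_gt0 (@pos 1 4 5 isT isT isT) (@pos 2 3 4 isT isT isT); lra.
Qed.

(** By [045]/[145] < [034]/[134] < [023]/[123]. *)
Lemma bracket_ineq3 : g 0 4 5 * g 1 2 3 < g 1 4 5 * g 0 2 3.
Proof.
rewrite mulrC (mulrC (g 1 4 5)).
suff : g 1 2 3 * g 0 4 5 < g 0 2 3 * g 1 4 5 by [].
have h1 : g 0 3 4 * g 1 2 3 < g 0 2 3 * g 1 3 4.
  have := plucker 3 0 1 2 4.
  rewrite (rot3 0 1) (rot3 0 2) (rot3 1 2) (swap12 2 3) (swap12 1 3) (swap12 0 3).
  have := mulr_gt0 (@pos 0 1 3 isT isT isT) (@pos 2 3 4 isT isT isT); lra.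
have h2 : g 0 4 5 * g 1 3 4 < g 0 3 4 * g 1 4 5.
  have := plucker 4 0 1 3 5.
  rewrite (rot3 0 1) (rot3 0 3) (rot3 1 3) (swap12 3 4) (swap12 1 4) (swap12 0 4).
  have := mulr_gt0 (@pos 0 1 4 isT isT isT) (@pos 3 4 5 isT isT isT); lra.
rewrite (mulrC (g 1 2 3)); apply: ratio_trans h1 h2; exact: pos.
Qed.

End PositiveBrackets.

Section PositivePoints.
Variable F : realFieldType.
Local Notation D := (@det4 F).

Lemma first_bracket_alt (x : 'rV[F]_4) (y : nat -> 'rV[F]_4) :
  let g a b c := D x (y a) (y b) (y c) in
  [/\ forall a b c, g b a c = - g a b c, forall a b c, g a c b = - g a b c &
   forall x a b c d, g x a b * g x c d - g x a c * g x b d + g x a d * g x b c = 0].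
Proof.
move=> g; split=> *; rewrite /g; [exact: det4_swap23|exact: det4_swap34|exact: plucker3].
Qed.

(** Moving the fixed point from the last place to the first changes every sign, which a quadratic
    relation does not see. *)
Lemma last_bracket_alt (x : 'rV[F]_4) (y : nat -> 'rV[F]_4) :
  let g a b c := D (y a) (y b) (y c) x in
  [/\ forall a b c, g b a c = - g a b c, forall a b c, g a c b = - g a b c &
   forall x a b c d, g x a b * g x c d - g x a c * g x b d + g x a d * g x b c = 0].
Proof.
move=> g; split=> *; rewrite /g; [exact: det4_swap12|exact: det4_swap23|].
have E p q r : D p q r x = - D x p q r by rewrite (det4_rot p q r x) opprK.
by rewrite !E !mulrNN plucker3.
Qed.

Variable z : nat -> 'rV[F]_4.

(* Geometrically: the line through x that meets z_1 z_2 and z_3 z_4 is not in the plane x z_0 z_5. *)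
Lemma concurrency_neq0 (x : 'rV[F]_4) :
  (forall a b c, (a < b)%N -> (b < c)%N -> (c < 6)%N -> 0 < D x (z a) (z b) (z c)) ->
  D x (z 1) (z 3) (z 4) * D x (z 0) (z 2) (z 5) - D x (z 2) (z 3) (z 4) * D x (z 0) (z 1) (z 5) != 0.
Proof.
move=> pos; have [s12 s23 pl] := first_bracket_alt x z.
by have := bracket_ineq1 s12 s23 pl pos; rewrite -subr_gt0 => /lt0r_neq0.
Qed.

(* q (a, b) = al a^2 + be a b + ga b^2 vanishes when some line through a z_0 + b z_1 meets
   the lines 23, 45 and 67; it is positive at z_0 and negative where 01 meets the plane 236. *)
Lemma four_lines_disc :
  (forall a b c d, (a < b)%N -> (b < c)%N -> (c < d)%N -> (d < 8)%N ->
     0 < D (z a) (z b) (z c) (z d)) ->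
  let al := D (z 0) (z 4) (z 6) (z 7) * D (z 0) (z 2) (z 3) (z 5)
          - D (z 0) (z 5) (z 6) (z 7) * D (z 0) (z 2) (z 3) (z 4) in
  let be := D (z 0) (z 4) (z 6) (z 7) * D (z 1) (z 2) (z 3) (z 5)
          + D (z 1) (z 4) (z 6) (z 7) * D (z 0) (z 2) (z 3) (z 5)
          - D (z 0) (z 5) (z 6) (z 7) * D (z 1) (z 2) (z 3) (z 4)
          - D (z 1) (z 5) (z 6) (z 7) * D (z 0) (z 2) (z 3) (z 4) in
  let ga := D (z 1) (z 4) (z 6) (z 7) * D (z 1) (z 2) (z 3) (z 5)
          - D (z 1) (z 5) (z 6) (z 7) * D (z 1) (z 2) (z 3) (z 4) in
  0 < al /\ 0 < be ^+ 2 - 4%:R * al * ga.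
Proof.
move=> pos al be ga.
have al0 : 0 < al.
  pose y k := z k.+2; have [s12 s23 pl] := first_bracket_alt (z 0) y.
  rewrite /al subr_gt0; apply: (bracket_ineq2 s12 s23 pl) => a b c ab bc c6.
  by apply: pos; rewrite ?ltnS.
split=> //.
pose s := D (z 1) (z 2) (z 3) (z 6); pose t := D (z 0) (z 2) (z 3) (z 6).
pose x0 := s *: z 0 + (- t) *: z 1.
have x0E p q r : D x0 p q r = s * D (z 0) p q r - t * D (z 1) p q r.
  by rewrite det4_lin1 mulNr.
have h1 : D x0 (z 2) (z 3) (z 6) = 0 by rewrite x0E /s /t; ring.
have h2 : D x0 (z 4) (z 5) (z 6) < 0.
  have [s12 s23 pl] := last_bracket_alt (z 6) z.
  have := bracket_ineq3 s12 s23 pl (fun a b c ab bc c6 => pos a b c 6 ab bc c6 isT).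
  by rewrite x0E /s /t; lra.
have h3 : D x0 (z 2) (z 3) (z 7) < 0.
  have := plucker3 (z 2) (z 3) (z 0) (z 1) (z 6) (z 7).
  have mv a b : D (z 2) (z 3) (z a) (z b) = D (z a) (z 2) (z 3) (z b).
    by rewrite -[RHS]opprK -det4_swap12 -det4_swap23.
  have := mulr_gt0 (pos 0 1 2 3 isT isT isT isT) (pos 2 3 6 7 isT isT isT isT).
  have e1 : D (z 2) (z 3) (z 0) (z 1) = D (z 0) (z 1) (z 2) (z 3).
    by rewrite mv det4_swap34 det4_swap23 opprK.
  rewrite x0E e1 !mv -/s -/t; lra.
(* The form at x0: after [plucker_lines] and h1 only minus the product of the two negative brackets
   of h2 and h3 remains. *)
have q0 : al * s ^+ 2 - be * s * t + ga * t ^+ 2 < 0.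
  have -> : al * s ^+ 2 - be * s * t + ga * t ^+ 2 =
      D x0 (z 4) (z 6) (z 7) * D x0 (z 2) (z 3) (z 5)
      - D x0 (z 5) (z 6) (z 7) * D x0 (z 2) (z 3) (z 4).
    by rewrite !x0E /al /be /ga; ring.
  by rewrite plucker_lines h1 mulr0 sub0r oppr_lt0 nmulr_rgt0.
rewrite ltNge; apply/negP => le0.
have := mulr_le0_ge0 le0 (sqr_ge0 t); have := sqr_ge0 (2%:R * al * s - be * t).
have : al * (al * s ^+ 2 - be * s * t + ga * t ^+ 2) < 0 by rewrite pmulr_rlt0.
(* Completing the square: as al > 0, a negative value of the form excludes a nonpositive
   discriminant. *)
have -> : (2%:R * al * s - be * t) ^+ 2 = 4%:R * (al * (al * s ^+ 2 - be * s * t + ga * t ^+ 2))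
   + (be ^+ 2 - 4%:R * al * ga) * t ^+ 2 by ring.
lra.
Qed.
End PositivePoints.

(** * Incidence of lines with points in general position *)

Lemma meets_scale M p q a b : a != 0 -> b != 0 -> meets M p q -> meets M (a *: p) (b *: q).
Proof.
move=> a0 b0 [x [y [xy H]]]; exists (x / a), (y / b); rewrite !scalerA !divfK //; split=> //.
apply: contraNneq xy => -[/eqP + /eqP]; rewrite !mulf_eq0 !invr_eq0 (negbTE a0) (negbTE b0) !orbF.
by move=> /eqP -> /eqP ->.
Qed.

Lemma meets_mem1 M p q : (p <= M)%MS -> meets M p q.
Proof.
by move=> pM; exists 1, 0; rewrite scale1r scale0r addr0; split=> //; rewrite pair_neq0 // oner_eq0; left.
Qed.

Lemma meets_mem2 M p q : (q <= M)%MS -> meets M p q.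
Proof.
by move=> pM; exists 0, 1; rewrite scale1r scale0r add0r; split=> //; rewrite pair_neq0 // oner_eq0; right.
Qed.

Lemma meets_sym M p q : meets M p q -> meets M q p.
Proof.
move=> [a [b [ab H]]]; exists b, a; rewrite addrC; split=> //.
by move: ab; rewrite !xpair_eqE andbC.
Qed.

Lemma ind4_swap12 p q r s : ind4 p q r s -> ind4 q p r s.
Proof. by rewrite /ind4 -!/(det4 _ _ _ _) det4_swap12 oppr_eq0. Qed.

Lemma ind4_swap23 p q r s : ind4 p q r s -> ind4 p r q s.
Proof. by rewrite /ind4 -!/(det4 _ _ _ _) det4_swap23 oppr_eq0. Qed.

Lemma ind4_swap34 p q r s : ind4 p q r s -> ind4 p q s r.
Proof. by rewrite /ind4 -!/(det4 _ _ _ _) det4_swap34 oppr_eq0. Qed.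

Lemma ind4P p q r s : ind4 p q r s <->
  (forall a b c d, a *: p + b *: q + c *: r + d *: s = 0 -> [/\ a = 0, b = 0, c = 0 & d = 0]).
Proof.
split=> [H a b c d|H]; first exact: ind4_eq0.
rewrite /ind4; apply/det0P => -[x x0]; rewrite mul_E addrA => /H[a0 b0 c0 d0].
move/eqP: x0; apply; rewrite -[x]hsubmxK -[lsubmx x]hsubmxK -[rsubmx x]hsubmxK.
rewrite [lsubmx (lsubmx x)]mx11_scalar [rsubmx (lsubmx x)]mx11_scalar.
rewrite [lsubmx (rsubmx x)]mx11_scalar [rsubmx (rsubmx x)]mx11_scalar a0 b0 c0 d0.
by rewrite !raddf0 !row_mx0.
Qed.

Lemma ind_rank2_12 p q r s : ind4 p q r s -> rank2 (col_mx p q).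
Proof.
move=> H; apply: (ind_rank2 (a := 1) (b := 0) (c := 0) (d := 0) (a' := 0) (b' := 1) (c' := 0) (d' := 0) H).
- by vring.
- by vring.
by move=> s' u; rewrite !(mulr1, mulr0, addr0, add0r).
Qed.

Lemma SVV p q r s M : ind4 p q r s -> rank2 M -> (p <= M)%MS -> (q <= M)%MS -> (M == col_mx p q)%MS.
Proof. by move=> H _; apply: line_of2; apply: ind_rank2_12 H. Qed.

(** If neither meeting point is q, they are two distinct points of M in the plane p q r. *)
Lemma meets_corner p q r s M : ind4 p q r s -> rank2 M -> meets M p q -> meets M q r ->
  (q <= M)%MS \/ (M <= col_mx p (col_mx q r))%MS.
Proof.
move=> H rM [a [b [ab vM]]] [c [d [cd wM]]].
have [a0|a0] := eqVneq a 0.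
  left; move: ab vM; rewrite a0 scale0r add0r xpair_eqE eqxx /= => b0.
  by rewrite eqmx_scale.
have [d0|d0] := eqVneq d 0.
  left; move: cd wM; rewrite d0 scale0r addr0 xpair_eqE eqxx andbT => c0.
  by rewrite eqmx_scale.
right.
have r2 : rank2 (col_mx (a *: p + b *: q) (c *: q + d *: r)).
  apply: (ind_rank2 (a := a) (b := b) (c := 0) (d := 0) (a' := 0) (b' := c) (c' := d) (d' := 0) H).
  - by vring.
  - by vring.
  move=> s' u; rewrite !(mulr1, mulr0, addr0, add0r) => /eqP + _ /eqP; rewrite !mulf_eq0.
  by rewrite (negbTE a0) (negbTE d0) !orbF => /eqP -> /eqP ->.
have /andP[sub _] := line_of2 r2 vM wM.
apply: submx_trans sub _; apply: (sub_col_mx3 (a := a) (b := b) (c := 0) (a' := 0) (b' := c) (c' := d)).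
  by vring.
by vring.
Qed.

Lemma plane_meets2 (p q r : pt4) M x y : rank2 M -> (M <= col_mx p (col_mx q r))%MS ->
  (x <= col_mx p (col_mx q r))%MS -> (y <= col_mx p (col_mx q r))%MS -> meets M x y.
Proof.
move=> rM MP xP yP; apply/meets_det => //; apply/eqP; rewrite -[_ == 0]negbK -unitfE -unitmxE.
rewrite -row_free_unit /row_free neq_ltn; apply/orP; left; rewrite ltnS.
have sub : (col_mx M (col_mx x y) <= col_mx p (col_mx q r))%MS.
  rewrite (col_mx_sub M (col_mx x y)) MP /= (col_mx_sub x y) xP.
  exact yP.
by apply: leq_trans (mxrankS sub) (rank_leq_row _).
Qed.

Lemma mem_plane (p q r : pt4) : [/\ (p <= col_mx p (col_mx q r))%MS,
  (q <= col_mx p (col_mx q r))%MS & (r <= col_mx p (col_mx q r))%MS].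
Proof. by split; apply/sub_col3P; [exists 1, 0, 0|exists 0, 1, 0|exists 0, 0, 1]; vring. Qed.

Lemma plane_meets p q r M : rank2 M -> (M <= col_mx p (col_mx q r))%MS ->
  [/\ meets M p q, meets M q r & meets M p r].
Proof.
move=> rM MP; have [h1 h2 h3] := mem_plane p q r.
by split; apply: plane_meets2 MP _ _.
Qed.

(** This is why V_i L_{(i-1)(i+1)} agrees with V_i P_i, and why V_i L_j is a pencil. *)
Lemma pencil_meets p q r s M : ind4 p q r s -> rank2 M -> (q <= M)%MS ->
  (meets M p r <-> (M <= col_mx p (col_mx q r))%MS).
Proof.
move=> H rM qM; split=> [[a [b [ab vM]]]|/(plane_meets rM)[] //].
have r2 : rank2 (col_mx q (a *: p + b *: r)).
  apply: (ind_rank2 (a := 0) (b := 1) (c := 0) (d := 0) (a' := a) (b' := 0) (c' := b) (d' := 0) H).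
  - by vring.
  - by vring.
  move=> s' u; rewrite !(mulr1, mulr0, addr0, add0r) => /eqP + -> /eqP; rewrite !mulf_eq0.
  have [-> //|_] /= := eqVneq u 0.
  by move=> /eqP a0 /eqP b0; rewrite a0 b0 eqxx in ab.
have /andP[sub _] := line_of2 r2 qM vM.
apply: submx_trans sub _; apply: (sub_col_mx3 (a := 0) (b := 1) (c := 0) (a' := a) (b' := 0) (c' := b)).
  by vring.
by vring.
Qed.

(** e is the point where the line s t meets the plane p q r. Neither s nor t lies in that plane, so
    both coefficients are nonzero. *)
Lemma plane_line p q r s t : ind4 p q r s -> ind4 p q r t ->
  exists e a b, [/\ a != 0 /\ b != 0, e = a *: s + b *: t, (e <= col_mx p (col_mx q r))%MS &
    forall M, rank2 M -> (M <= col_mx p (col_mx q r))%MS -> (meets M s t <-> (e <= M)%MS)].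
Proof.
move=> Hs Ht; have [x [y [z [w et]]]] := ind4_span t Hs.
have w0 : w != 0.
  apply/eqP => w0; move: et; rewrite w0 scale0r addr0 => et.
  have [|_ _ _ /eqP] := ind4_eq0 (a := - x) (b := - y) (c := - z) (d := 1) Ht.
    by rewrite et; vring.
  by rewrite oner_eq0.
have eE : - w *: s + 1 *: t = x *: p + y *: q + z *: r by rewrite et; vring.
exists (- w *: s + 1 *: t), (- w), 1; split=> //.
- by rewrite oppr_eq0 oner_eq0.
- by rewrite eE; apply/sub_col3P; exists x, y, z.
move=> M rM MP; split=> [[a [b [ab vM]]]|eM]; last first.
  by exists (- w), 1; split=> //; apply: pair_neq0; right; rewrite oner_eq0.
have /sub_col3P[x' [y' [z' E]]] := submx_trans vM MP.
have [|_ _ _ aw] := ind4_eq0 (a := b * x - x') (b := b * y - y') (c := b * z - z') (d := b * w + a) Hs.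
  by rewrite -(subrr (a *: s + b *: t)) {2}E et; vring.
have ea : a = - w * b by rewrite -[LHS]subr0 -aw; ring.
have b0 : b != 0 by apply: contraNneq ab => b0; rewrite ea b0 mulr0.
have -> : - w *: s + 1 *: t = b^-1 *: (a *: s + b *: t) by rewrite ea; vfield.
exact: scalemx_sub.
Qed.

Lemma det4_lin2 (F : comNzRingType) a b (p p' q r s : 'rV[F]_4) :
  det4 q (a *: p + b *: p') r s = a * det4 q p r s + b * det4 q p' r s.
Proof. by rewrite det4_swap12 det4_lin1 !(det4_swap12 q) mulrN mulrN opprD !opprK. Qed.

Lemma det4_lin3 (F : comNzRingType) a b (p p' q r s : 'rV[F]_4) :
  det4 q r (a *: p + b *: p') s = a * det4 q r p s + b * det4 q r p' s.
Proof. by rewrite det4_swap23 det4_lin2 !(det4_swap23 _ r) mulrN mulrN opprD !opprK. Qed.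

Lemma det4_lin4 (F : comNzRingType) a b (p p' q r s : 'rV[F]_4) :
  det4 q r s (a *: p + b *: p') = a * det4 q r s p + b * det4 q r s p'.
Proof. by rewrite det4_swap34 det4_lin3 !(det4_swap34 _ _ s) mulrN mulrN opprD !opprK. Qed.

Lemma det4_sub3 (p q r s : pt4) : (s <= col_mx p (col_mx q r))%MS -> det4 p q r s = 0.
Proof. by case/sub_col3P=> a [b [c ->]]; rewrite !det4E /minor2 !mxE; ring. Qed.

Lemma meets_det4 (x y p q : pt4) M : rank2 M -> (M == col_mx x y)%MS ->
  (meets M p q <-> det4 x y p q = 0).
Proof.
move=> rM MN; have rN := eqmx_rank2 MN rM.
split=> [H|H]; first exact/(meets_det p q rN)/(meets_eqmx MN).
by apply: meets_eqmx ((meets_det p q rN).1 H); rewrite andbC.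
Qed.

Lemma eqmx_mem1 (M : M24) (x y : pt4) : (M == col_mx x y)%MS -> (x <= M)%MS.
Proof. by case/andP=> _; rewrite (col_mx_sub x y) => /andP[]. Qed.

Lemma eqmx_mem2 (M : M24) (x y : pt4) : (M == col_mx x y)%MS -> (y <= M)%MS.
Proof. by case/andP=> _; rewrite (col_mx_sub x y) => /andP[]. Qed.

Lemma meets_eqP (M N : M24) p q : (M == N)%MS -> (meets M p q <-> meets N p q).
Proof. by move=> MN; split; apply: meets_eqmx => //; rewrite andbC. Qed.

Lemma eqmx_subP (M N : M24) m (A : 'M_(m, 4)) : (M == N)%MS -> (M <= A)%MS = (N <= A)%MS.
Proof. by move/eqmxP=> MN; rewrite MN. Qed.

Lemma eqmx_mem (M N : M24) m (A : 'M_(m, 4)) : (M == N)%MS -> (A <= M)%MS = (A <= N)%MS.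
Proof. by move/eqmxP=> MN; rewrite MN. Qed.

(** The line is the join of q with the point where s t meets the plane p q r. *)
Lemma star_point p q r s t : ind4 p q r s -> ind4 p q r t -> ind4 p q s t ->
  exists N : M24, rank2 N /\ forall M, rank2 M ->
   ([/\ (q <= M)%MS, (M <= col_mx p (col_mx q r))%MS & meets M s t] <-> (M == N)%MS).
Proof.
move=> Hs Ht Hst; have [e [a [b [[a0 b0] ee eP He]]]] := plane_line Hs Ht.
have r2 : rank2 (col_mx q e).
  apply: (ind_rank2 (a := 0) (b := 1) (c := 0) (d := 0) (a' := 0) (b' := 0) (c' := a) (d' := b) Hst).
  - by vring.
  - by rewrite ee; vring.
  move=> s' u; rewrite !(mulr1, mulr0, addr0, add0r) => _ -> /eqP.
  by rewrite mulf_eq0 (negbTE a0) orbF => /eqP ->.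
exists (col_mx q e); split=> // M rM; split=> [[qM MP] /(He M rM MP) eM|MN].
  exact: line_of2.
have MP : (M <= col_mx p (col_mx q r))%MS.
  rewrite (eqmx_subP _ MN) (col_mx_sub q e) eP andbT.
  by apply/sub_col3P; exists 0, 1, 0; vring.
by split=> //; [exact: eqmx_mem1 MN | apply/(He M rM MP); exact: eqmx_mem2 MN].
Qed.

(** The line joins the points where s t and s' t' meet the plane; the last hypothesis makes these
    two points distinct. *)
Lemma plane_two_lines p q r s t s' t' :
  ind4 p q r s -> ind4 p q r t -> ind4 p q r s' -> ind4 p q r t' ->
  (forall a b c d, a != 0 -> b != 0 -> c != 0 -> d != 0 ->
     rank2 (col_mx (a *: s + b *: t) (c *: s' + d *: t'))) ->
  exists N : M24, rank2 N /\ forall M, rank2 M ->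
   ([/\ (M <= col_mx p (col_mx q r))%MS, meets M s t & meets M s' t'] <-> (M == N)%MS).
Proof.
move=> Hs Ht Hs' Ht' H; have [e [a [b [[a0 b0] ee eP He]]]] := plane_line Hs Ht.
have [e' [c [d [[c0 d0] ee' eP' He']]]] := plane_line Hs' Ht'.
have r2 : rank2 (col_mx e e') by rewrite ee ee'; apply: H.
exists (col_mx e e'); split=> // M rM; split=> [[MP /(He M rM MP) eM /(He' M rM MP) eM']|MN].
  exact: line_of2.
have MP : (M <= col_mx p (col_mx q r))%MS.
  by rewrite (eqmx_subP _ MN) (col_mx_sub e e') eP.
by split=> //; [apply/(He M rM MP); exact: eqmx_mem1 MN | apply/(He' M rM MP); exact: eqmx_mem2 MN].
Qed.

Lemma meets_span p q p' q' a b c d M : p' = a *: p + b *: q -> q' = c *: p + d *: q ->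
  a * d - b * c != 0 -> meets M p q <-> meets M p' q'.
Proof.
move=> ep eq; set D := a * d - b * c => D0; split=> -[x [y [xy H]]].
  exists ((x * d - y * c) / D), ((y * a - x * b) / D); split.
    apply: contraNneq xy => -[/eqP + /eqP]; rewrite !mulf_eq0 !invr_eq0 (negbTE D0) !orbF.
    move=> /eqP h1 /eqP h2.
    have : x * D = 0 by rewrite -[RHS](_ : (x * d - y * c) * a + (y * a - x * b) * c = 0); [rewrite /D; ring | rewrite h1 h2; ring].
    have : y * D = 0 by rewrite -[RHS](_ : (x * d - y * c) * b + (y * a - x * b) * d = 0); [rewrite /D; ring | rewrite h1 h2; ring].
    by move=> /eqP + /eqP; rewrite !mulf_eq0 (negbTE D0) !orbF => /eqP -> /eqP ->.
  have -> : ((x * d - y * c) / D) *: p' + ((y * a - x * b) / D) *: q' = x *: p + y *: q.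
    by rewrite ep eq /D; vfield.
  by [].
exists (x * a + y * c), (x * b + y * d); split; last first.
  have -> : (x * a + y * c) *: p + (x * b + y * d) *: q = x *: p' + y *: q'.
    by rewrite ep eq; vring.
  by [].
apply: contraNneq xy => -[h1 h2].
have : x * D = 0 by rewrite -[RHS](_ : (x * a + y * c) * d - (x * b + y * d) * c = 0); [rewrite /D; ring | rewrite h1 h2; ring].
have : y * D = 0 by rewrite -[RHS](_ : (x * b + y * d) * a - (x * a + y * c) * b = 0); [rewrite /D; ring | rewrite h1 h2; ring].
by move=> /eqP + /eqP; rewrite !mulf_eq0 (negbTE D0) !orbF => /eqP -> /eqP ->.
Qed.

Lemma plane_span (p q r e : pt4) a b c (M : M24) : e = a *: p + b *: q + c *: r -> a != 0 ->
  (M <= col_mx p (col_mx q r))%MS = (M <= col_mx e (col_mx q r))%MS.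
Proof.
move=> ee a0; apply/idP/idP => MP; apply: submx_trans MP _.
  rewrite (col_mx_sub p (col_mx q r)); apply/andP; split; first by apply/sub_col3P; exists a^-1, (- b / a), (- c / a); rewrite ee; vfield.
  by rewrite (col_mx_sub q r); apply/andP; split; apply/sub_col3P; [exists 0, 1, 0|exists 0, 0, 1]; vring.
rewrite (col_mx_sub e (col_mx q r)).
apply/andP; split; first by apply/sub_col3P; exists a, b, c.
by rewrite (col_mx_sub q r); apply/andP; split; apply/sub_col3P; [exists 0, 1, 0|exists 0, 0, 1]; vring.
Qed.

(** Writing u = e0 + e2 and v = e1 + e3 with e0, e1 on p q and e2, e3 on r s reduces to
    [irrdim_regulus]. The determinants D1 and D2 are nonzero because u v is skew to r s and to p q
    respectively. *)
Lemma irrdim_skew_lines p q r s u v : ind4 p q r s -> ind4 p q u v -> ind4 r s u v ->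
  irrdim (inter (SL p q) (inter (SL r s) (SL u v))) 1.
Proof.
move=> H Hpq Hrs.
have [x0 [x1 [x2 [x3 eu]]]] := ind4_span u H.
have [y0 [y1 [y2 [y3 ev]]]] := ind4_span v H.
have D1 : x0 * y1 - x1 * y0 != 0.
  apply/eqP => D0.
  have K a b : a * x0 + b * y0 = 0 -> a * x1 + b * y1 = 0 -> a = 0 /\ b = 0.
    move=> h1 h2.
    have [|_ _ -> ->//] := ind4_eq0 (a := - (a * x2 + b * y2)) (b := - (a * x3 + b * y3)) (c := a) (d := b) Hrs.
    have -> : - (a * x2 + b * y2) *: r + - (a * x3 + b * y3) *: s + a *: u + b *: v =
       (a * x0 + b * y0) *: p + (a * x1 + b * y1) *: q by rewrite eu ev; vring.
    by rewrite h1 h2 !scale0r addr0.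
  have [||y00 x00] := K y0 (- x0); [by ring | by rewrite -[RHS]oppr0 -D0; ring|].
  have [||y10 x10] := K y1 (- x1); [by rewrite -D0; ring | by ring|].
  have [||/eqP] := K 1 0; rewrite ?oner_eq0 //.
    by move/eqP: x00; rewrite oppr_eq0 => /eqP ->; ring.
  by move/eqP: x10; rewrite oppr_eq0 => /eqP ->; ring.
have D2 : x2 * y3 - x3 * y2 != 0.
  apply/eqP => D0.
  have K a b : a * x2 + b * y2 = 0 -> a * x3 + b * y3 = 0 -> a = 0 /\ b = 0.
    move=> h1 h2.
    have [|_ _ -> ->//] := ind4_eq0 (a := - (a * x0 + b * y0)) (b := - (a * x1 + b * y1)) (c := a) (d := b) Hpq.
    have -> : - (a * x0 + b * y0) *: p + - (a * x1 + b * y1) *: q + a *: u + b *: v =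
       (a * x2 + b * y2) *: r + (a * x3 + b * y3) *: s by rewrite eu ev; vring.
    by rewrite h1 h2 !scale0r addr0.
  have [||y00 x00] := K y2 (- x2); [by ring | by rewrite -[RHS]oppr0 -D0; ring|].
  have [||y10 x10] := K y3 (- x3); [by rewrite -D0; ring | by ring|].
  have [||/eqP] := K 1 0; rewrite ?oner_eq0 //.
    by move/eqP: x00; rewrite oppr_eq0 => /eqP ->; ring.
  by move/eqP: x10; rewrite oppr_eq0 => /eqP ->; ring.
pose e0 := x0 *: p + x1 *: q; pose e1 := y0 *: p + y1 *: q.
pose e2 := x2 *: r + x3 *: s; pose e3 := y2 *: r + y3 *: s.
have eu' : e0 + e2 = u by rewrite eu /e0 /e2 addrA.
have ev' : e1 + e3 = v by rewrite ev /e1 /e3 addrA.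
have ie : ind4 e0 e1 e2 e3.
  apply/ind4P => a b c d E.
  have [|h0 h1 h2 h3] := ind4_eq0 (a := a * x0 + b * y0) (b := a * x1 + b * y1)
    (c := c * x2 + d * y2) (d := c * x3 + d * y3) H.
    by rewrite -E /e0 /e1 /e2 /e3; vring.
  have solve (x y z w f g : CC) : x * w - y * z != 0 -> f * x + g * z = 0 -> f * y + g * w = 0 ->
      f = 0 /\ g = 0.
    move=> D0 k1 k2.
    have /eqP : f * (x * w - y * z) = 0.
      by rewrite -[RHS](_ : (f * x + g * z) * w - (f * y + g * w) * z = 0); [ring | rewrite k1 k2; ring].
    have /eqP : g * (x * w - y * z) = 0.
      by rewrite -[RHS](_ : (f * y + g * w) * x - (f * x + g * z) * y = 0); [ring | rewrite k1 k2; ring].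
    by rewrite !mulf_eq0 (negbTE D0) !orbF => /eqP -> /eqP ->.
  by have [-> ->] := solve _ _ _ _ _ _ D1 h0 h1; have [-> ->] := solve _ _ _ _ _ _ D2 h2 h3.
apply: irrdim_ext (irrdim_regulus ie) => M.
have m1 := meets_span M (erefl e0) (erefl e1) D1.
have m2 := meets_span M (erefl e2) (erefl e3) D2.
rewrite eu' ev'; rewrite /inter /SL; tauto.
Qed.

(** The meeting point c y_1 + d y_2 satisfies two linear equations, one from the line y_3 y_4 and
    one from the plane. Up to sign, their determinant is the expression assumed to be nonzero. *)
Lemma no_concurrency x (y : nat -> pt4) M : rank2 M ->
  det4 x (y 1) (y 3) (y 4) * det4 x (y 0) (y 2) (y 5)
   - det4 x (y 2) (y 3) (y 4) * det4 x (y 0) (y 1) (y 5) != 0 ->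
  ind4 x (y 1) (y 2) (y 3) ->
  (x <= M)%MS -> (M <= col_mx (y 5) (col_mx x (y 0)))%MS ->
  meets M (y 1) (y 2) -> meets M (y 3) (y 4) -> False.
Proof.
move=> rM D0 H xM MP [c [d [cd wM]]] m2.
have r2 : rank2 (col_mx x (c *: y 1 + d *: y 2)).
  apply: (ind_rank2 (a := 1) (b := 0) (c := 0) (d := 0) (a' := 0) (b' := c) (c' := d) (d' := 0) H).
  - by vring.
  - by vring.
  move=> s' u; rewrite !(mulr1, mulr0, addr0, add0r) => -> /eqP + /eqP; rewrite !mulf_eq0.
  have [-> //|_] /= := eqVneq u 0.
  by move=> /eqP a0 /eqP b0; rewrite a0 b0 eqxx in cd.
have MN := line_of2 r2 xM wM.
have := (meets_det4 (y 3) (y 4) rM MN).1 m2; rewrite det4_lin2 => h1.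
have := det4_sub3 (submx_trans wM MP); rewrite det4_lin4.
have mv w : det4 (y 5) x (y 0) w = det4 x (y 0) w (y 5) * -1.
  by rewrite det4_swap12 det4_swap23 det4_swap34 opprK mulrN1.
rewrite !mv => h2.
set A := det4 x (y 1) (y 3) (y 4) in h1 D0; set B := det4 x (y 2) (y 3) (y 4) in h1 D0.
set C := det4 x (y 0) (y 1) (y 5) in h2 D0; set E := det4 x (y 0) (y 2) (y 5) in h2 D0.
clearbody A B C E.
have /eqP : c * (A * E - B * C) = 0.
  by rewrite -[RHS](_ : (c * A + d * B) * E + B * (c * (C * -1) + d * (E * -1)) = 0); [ring | rewrite h1 h2; ring].
have /eqP : d * (A * E - B * C) = 0.
  by rewrite -[RHS](_ : (c * A + d * B) * (- C) - A * (c * (C * -1) + d * (E * -1)) = 0); [ring | rewrite h1 h2; ring].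
rewrite !mulf_eq0 (negbTE D0) !orbF => /eqP d0 /eqP c0.
by rewrite c0 d0 eqxx in cd.
Qed.

(** * Common transversals of four lines *)

Section FourLines.
Variables z0 z1 z2 z3 z4 z5 z6 z7 : pt4.
Hypotheses (H03 : ind4 z0 z1 z2 z3) (H25 : ind4 z2 z3 z4 z5) (H05 : ind4 z0 z1 z4 z5).

Let x a b := a *: z0 + b *: z1.
Let c4 a b := det4 (x a b) z2 z3 z4.
Let c5 a b := det4 (x a b) z2 z3 z5.
(** The point where z_4 z_5 meets the plane of x, z_2 and z_3. So x y is the transversal through x
    of z_2 z_3 and z_4 z_5. *)
Let y a b := c5 a b *: z4 + (- c4 a b) *: z5.
Let al := det4 z0 z4 z6 z7 * det4 z0 z2 z3 z5 - det4 z0 z5 z6 z7 * det4 z0 z2 z3 z4.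
Let be := det4 z0 z4 z6 z7 * det4 z1 z2 z3 z5 + det4 z1 z4 z6 z7 * det4 z0 z2 z3 z5
        - det4 z0 z5 z6 z7 * det4 z1 z2 z3 z4 - det4 z1 z5 z6 z7 * det4 z0 z2 z3 z4.
Let ga := det4 z1 z4 z6 z7 * det4 z1 z2 z3 z5 - det4 z1 z5 z6 z7 * det4 z1 z2 z3 z4.
Hypotheses (al0 : al != 0) (disc0 : be ^+ 2 - 4%:R * al * ga != 0).

Lemma transversal_det a b :
  det4 (x a b) (y a b) z6 z7 = al * a ^+ 2 + be * a * b + ga * b ^+ 2.
Proof.
rewrite det4_lin2 /c4 /c5 !det4_lin1 /al /be /ga.
by repeat match goal with |- context [det4 ?p ?q ?r ?s] => move: (det4 p q r s) => ? end; ring.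
Qed.

(** Both coefficients vanish only if x is on z_2 z_3, which is skew to z_0 z_1. *)
Lemma transversal_coef a b : (a, b) != (0, 0) -> (c5 a b, - c4 a b) != (0, 0).
Proof.
move=> ab; apply/negP => /eqP[h5 /eqP]; rewrite oppr_eq0 => /eqP h4.
have [t2 [t3 [t4 [t5 ex]]]] := ind4_span (x a b) H25.
have D0 : det4 z2 z3 z4 z5 != 0 := H25.
have /eqP : t5 * det4 z2 z3 z4 z5 = 0.
  by rewrite -[RHS]oppr0 -h4 /c4 ex !det4E /minor2 !mxE; ring.
have /eqP : t4 * det4 z2 z3 z4 z5 = 0.
  by rewrite -h5 /c5 ex !det4E /minor2 !mxE; ring.
rewrite !mulf_eq0 (negbTE D0) !orbF => /eqP t40 /eqP t50.
have [|a0 b0 _ _] := ind4_eq0 (a := a) (b := b) (c := - t2) (d := - t3) H03.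
  by move: ex; rewrite t40 t50 /x => ex; rewrite ex; vring.
by rewrite a0 b0 eqxx in ab.
Qed.

Lemma rank2_01_45 a b c d : (a, b) != (0, 0) -> (c, d) != (0, 0) ->
  rank2 (col_mx (x a b) (c *: z4 + d *: z5)).
Proof.
move=> ab cd; apply: (ind_rank2 (a := a) (b := b) (c := 0) (d := 0) (a' := 0) (b' := 0) (c' := c) (d' := d) H05).
- by rewrite /x; vring.
- by vring.
move=> s' u; rewrite !(mulr1, mulr0, addr0, add0r) => /eqP + /eqP + /eqP + /eqP; rewrite !mulf_eq0.
have [->|_] /= := eqVneq s' 0; last first.
  by move=> /eqP a0 /eqP b0; rewrite a0 b0 eqxx in ab.
have [->|_] //= := eqVneq u 0.
by move=> _ _ /eqP c0 /eqP d0; rewrite c0 d0 eqxx in cd.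
Qed.

Lemma transversal_through M a b : rank2 M -> (a, b) != (0, 0) -> (x a b <= M)%MS ->
  meets M z2 z3 -> meets M z4 z5 -> meets M z6 z7 ->
  (M == col_mx (x a b) (y a b))%MS /\ al * a ^+ 2 + be * a * b + ga * b ^+ 2 = 0.
Proof.
move=> rM ab xM m23 [c [d [cd wM]]] m67.
(* M passes through x and meets z_2 z_3. The fourth independent point required by [pencil_meets] is
   z_0 when x is a multiple of z_1, and z_1 otherwise. *)
have MP : (M <= col_mx z2 (col_mx (x a b) z3))%MS.
  have [a0|a0] := eqVneq a 0.
    have b0 : b != 0 by apply: contraNneq ab => ->; rewrite a0.
    suff I : ind4 z2 (x a b) z3 z0 by apply/(pencil_meets I rM).
    apply/ind4P => s t u v E.
    have [|k1 k2 k3 k4] := ind4_eq0 (a := v + t * a) (b := t * b) (c := s) (d := u) H03.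
      by rewrite -E /x; vring.
    have t0 : t = 0 by apply/eqP; move/eqP: k2; rewrite mulf_eq0 (negbTE b0) orbF.
    by split=> //; rewrite -k1 t0; ring.
  suff I : ind4 z2 (x a b) z3 z1 by apply/(pencil_meets I rM).
  apply/ind4P => s t u v E.
  have [|k1 k2 k3 k4] := ind4_eq0 (a := t * a) (b := v + t * b) (c := s) (d := u) H03.
    by rewrite -E /x; vring.
  have t0 : t = 0 by apply/eqP; move/eqP: k1; rewrite mulf_eq0 (negbTE a0) orbF.
  by split=> //; rewrite -k2 t0; ring.
have /eqP := det4_sub3 (submx_trans wM MP).
rewrite (det4_swap12 (x a b) z2) oppr_eq0 det4_lin4 -/(c4 a b) -/(c5 a b) => /eqP e.
have yM : (y a b <= M)%MS.
  have [c0|c0] := eqVneq c 0.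
    have d0 : d != 0 by apply: contraNneq cd => ->; rewrite c0.
    have -> : y a b = (- c4 a b / d) *: (c *: z4 + d *: z5).
      rewrite /y c0; have -> : c5 a b = 0.
        by apply/eqP; move/eqP: e; rewrite c0 mul0r add0r mulf_eq0 (negbTE d0).
      by vfield.
    exact: scalemx_sub.
  have -> : y a b = (c5 a b / c) *: (c *: z4 + d *: z5).
    have -> : y a b = c5 a b *: z4 + ((c5 a b * d) / c) *: z5.
      rewrite /y; congr (_ + _ *: _); apply: (mulIf c0); rewrite mulfVK //.
      by rewrite -[LHS]addr0 -e; ring.
    by vfield.
  exact: scalemx_sub.
have MN := line_of2 (rank2_01_45 ab (transversal_coef ab)) xM yM.
split=> //; rewrite -transversal_det.
exact/(meets_det4 z6 z7 rM MN).
Qed.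

Lemma transversal_root a b : (a, b) != (0, 0) -> al * a ^+ 2 + be * a * b + ga * b ^+ 2 = 0 ->
  let N := col_mx (x a b) (y a b) in
  [/\ rank2 N, meets N z0 z1, meets N z2 z3, meets N z4 z5 & meets N z6 z7].
Proof.
move=> ab q0 N; have rN : rank2 N := rank2_01_45 ab (transversal_coef ab).
have NN : (N == col_mx (x a b) (y a b))%MS by apply/eqmxP.
split=> //.
- by exists a, b; split=> //; exact: eqmx_mem1 NN.
- apply/(meets_det4 z2 z3 rN NN); rewrite det4_lin2.
  have mv w : det4 (x a b) w z2 z3 = det4 (x a b) z2 z3 w.
    by rewrite -[RHS]opprK -det4_swap34 -det4_swap23.
  by rewrite !mv -/(c4 a b) -/(c5 a b); ring.
- by exists (c5 a b), (- c4 a b); split; [exact: transversal_coef | exact: eqmx_mem2 NN].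
by apply/(meets_det4 z6 z7 rN NN); rewrite transversal_det.
Qed.

(** Roots of the binary form may be sought with b = 1, as a nonzero al excludes b = 0. Distinct
    roots give distinct lines: a line with two points on z_0 z_1 is z_0 z_1 itself, which does not
    meet z_2 z_3. *)
Lemma four_lines_two_points : exists M1 M2 : M24, [/\ rank2 M1, rank2 M2, ~~ (M1 == M2)%MS &
  forall M, rank2 M -> (([/\ meets M z0 z1, meets M z2 z3, meets M z4 z5 & meets M z6 z7]) <->
     (M == M1)%MS \/ (M == M2)%MS)].
Proof.
pose s := sqrtC (be ^+ 2 - 4%:R * al * ga).
have ss : s ^+ 2 = be ^+ 2 - 4%:R * al * ga by rewrite sqrtCK.
have s0 : s != 0 by rewrite sqrtC_eq0.
have two0 : (2%:R : CC) != 0 by rewrite pnatr_eq0.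
pose r1 := (- be + s) / (2%:R * al); pose r2 := (- be - s) / (2%:R * al).
have root_r e : e ^+ 2 = be ^+ 2 - 4%:R * al * ga ->
    al * ((- be + e) / (2%:R * al)) ^+ 2 + be * ((- be + e) / (2%:R * al)) * 1 + ga * 1 ^+ 2 = 0.
  move=> ee; have -> : ga = (be ^+ 2 - e ^+ 2) / (4%:R * al).
    by rewrite ee; field; rewrite ?al0.
  by field; rewrite ?al0.
have q1 : al * r1 ^+ 2 + be * r1 * 1 + ga * 1 ^+ 2 = 0 := root_r s ss.
have q2 : al * r2 ^+ 2 + be * r2 * 1 + ga * 1 ^+ 2 = 0.
  by apply: root_r; rewrite sqrrN.
have n1 r : (r, 1) != (0, 0) :> CC * CC by rewrite xpair_eqE oner_eq0 andbF.
have [rk1 a1 b1 c1 d1] := transversal_root (n1 r1) q1.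
have [rk2 a2 b2 c2 d2] := transversal_root (n1 r2) q2.
have r12 : r1 - r2 != 0.
  have -> : r1 - r2 = s / al by rewrite /r1 /r2; field; rewrite ?al0.
  by rewrite mulf_neq0 ?invr_eq0.
exists (col_mx (x r1 1) (y r1 1)), (col_mx (x r2 1) (y r2 1)); split=> //.
  apply/negP => E.
  set N : M24 := col_mx (x r1 1) (y r1 1) in rk1 a1 b1 c1 d1 E.
  have NN : (N == col_mx (x r1 1) (y r1 1))%MS by apply/eqmxP.
  have x1N := eqmx_mem1 NN; have x2N := eqmx_mem1 E.
  have z0N : (z0 <= N)%MS.
    have -> : z0 = (r1 - r2)^-1 *: (x r1 1 - x r2 1) by rewrite /x; vfield.
    by rewrite scalemx_sub // addmx_sub // eqmx_opp.
  have z1N : (z1 <= N)%MS.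
    have -> : z1 = x r1 1 - r1 *: z0 by rewrite /x; vring.
    by rewrite addmx_sub // eqmx_opp scalemx_sub.
  have NE := SVV H03 rk1 z0N z1N.
  by have /eqP := (meets_det4 z2 z3 rk1 NE).1 b1; rewrite (negbTE (H03 : det4 z0 z1 z2 z3 != 0)).
move=> M rM; split=> [[[a [b [ab xM]]] m23 m45 m67]|H]; last first.
  case: H => MN; split; apply/(meets_eqP _ _ MN) => //.
have [_ q] := transversal_through rM ab xM m23 m45 m67.
have b0 : b != 0.
  have E (u v w t : CC) : u * t ^+ 2 + v * t * 0 + w * 0 ^+ 2 = u * t ^+ 2 by ring.
  apply/eqP => b0; move: ab q; rewrite b0 E xpair_eqE eqxx andbT => a0 /eqP.
  by rewrite mulf_eq0 (negbTE al0) expf_eq0 (negbTE a0).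
have x'M : (x (a / b) 1 <= M)%MS.
  have -> : x (a / b) 1 = b^-1 *: (a *: z0 + b *: z1) by rewrite /x; vfield.
  exact: scalemx_sub.
have [MN {}q] := transversal_through rM (n1 (a / b)) x'M m23 m45 m67.
have /eqP : al * (a / b - r1) * (a / b - r2) = 0.
  have gaE : ga = (be ^+ 2 - s ^+ 2) / (4%:R * al) by rewrite ss; field; rewrite ?al0.
  by rewrite -[RHS]q gaE /r1 /r2; field; rewrite ?al0 ?b0.
rewrite !mulf_eq0 (negbTE al0) /= !subr_eq0 => /orP[] /eqP E; rewrite E in MN; [by left|by right].
Qed.
End FourLines.

(** * The points of a totally positive matrix *)

Lemma det4_map (p q r s : 'rV[RR]_4) :
  det4 (map_mx (fun x : RR => (x%:C)%C) p) (map_mx (fun x : RR => (x%:C)%C) q)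
       (map_mx (fun x : RR => (x%:C)%C) r) (map_mx (fun x : RR => (x%:C)%C) s) = (((det4 p q r s))%:C)%C.
Proof. by rewrite /det4 -!map_col_mx det_map_mx. Qed.

Section Configuration.
Variables (n : nat) (Z : 'M[RR]_(n, 4)).
Hypotheses (n4 : (4 <= n)%N) (tp : totally_positive Z).

Local Notation z := (zpt Z).
Local Notation succ := (@Defs.succ n).
Local Notation pred := (@Defs.pred n).

Lemma n_gt0 : (0 < n)%N. Proof. exact: leq_trans n4. Qed.

Definition cyc t : 'I_n := Ordinal (ltn_pmod t n_gt0).

Lemma cycE t : (t < n)%N -> cyc t = t :> nat.
Proof. by move=> /modn_small. Qed.

Lemma cyc_val (i : 'I_n) : cyc i = i.
Proof. by apply: val_inj; rewrite /= modn_small. Qed.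

Lemma cycS t : succ (cyc t) = cyc t.+1.
Proof. by apply: val_inj; rewrite /= -addn1 modnDml addn1. Qed.

Lemma cyc_addn t : cyc (t + n) = cyc t.
Proof. by apply: val_inj; rewrite /= modnDr. Qed.

Lemma pred_cyc (i : 'I_n) : pred i = cyc (i + n).-1.
Proof. by apply: val_inj. Qed.

Lemma succK : cancel succ pred. Proof. exact: ordSK. Qed.
Lemma predK : cancel pred succ. Proof. exact: ord_predK. Qed.
Lemma pred_inj : injective pred. Proof. exact: can_inj predK. Qed.

(* The twisted cyclic order: going once around changes the sign of a point, which makes
   the brackets of points in increasing position positive across the wrap-around. *)
Definition ztw t : 'rV[RR]_4 := (-1) ^+ (t %/ n) *: row (cyc t) Z.

Lemma row_pos (a b c d : 'I_n) : (a < b)%N -> (b < c)%N -> (c < d)%N ->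
  0 < det4 (row a Z) (row b Z) (row c Z) (row d Z).
Proof.
move=> ab bc cd; pose s (i : 'I_4) : 'I_n := nth a [:: a; b; c; d] i.
have := tp (s := s); rewrite det4_nth.
have -> : \matrix_(i < 4, j < 4) [:: row a Z; row b Z; row c Z; row d Z]`_i 0 j = rowsub s Z.
  by apply/matrixP => -[[|[|[|[|?]]]] Hi] j //; rewrite !mxE /=.
apply; move=> [[|[|[|[|?]]]] Hi] [[|[|[|[|?]]]] Hj] //= _; rewrite /s /=; lia.
Qed.

Lemma ztw_small t : (t < n)%N -> ztw t = row (cyc t) Z.
Proof. by move=> tn; rewrite /ztw divn_small // expr0 scale1r. Qed.

Lemma ztw_wrap t : (n <= t)%N -> (t < n + n)%N -> ztw t = - row (cyc (t - n)) Z.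
Proof.
move=> nt tn; rewrite /ztw; have -> : (t %/ n = 1)%N.
  by rewrite -(subnK nt) divnDr // divnn n_gt0 divn_small //; lia.
rewrite expr1 scaleN1r; congr (- row _ _); apply: val_inj => /=.
by rewrite -{1}(subnK nt) modnDr.
Qed.

Lemma det4_opp4 (F : comNzRingType) (p q r s : 'rV[F]_4) : det4 p q r (- s) = - det4 p q r s.
Proof. by rewrite !det4E /minor2 !mxE; ring. Qed.

(** An index past n changes the sign of its point, and moving that point from the last place to the
    first changes the sign of the determinant. Repeating this sorts the indices. *)
Lemma ztw_pos a b c d : (a < b)%N -> (b < c)%N -> (c < d)%N -> (d < a + n)%N -> (a < n)%N ->
  0 < det4 (ztw a) (ztw b) (ztw c) (ztw d).
Proof.
move=> ab bc cd da an.
have pos (a' b' c' d' : nat) : (a' < b')%N -> (b' < c')%N -> (c' < d')%N -> (d' < n)%N ->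
   0 < det4 (row (cyc a') Z) (row (cyc b') Z) (row (cyc c') Z) (row (cyc d') Z).
  by move=> h1 h2 h3 h4; apply: row_pos; rewrite !cycE //; lia.
have [dn|nd] := ltnP d n.
  by rewrite !ztw_small ?pos //; lia.
rewrite (ztw_wrap nd) ?det4_opp4 -?det4_rot; last by lia.
have [cn|nc] := ltnP c n.
  by rewrite !ztw_small ?pos //; lia.
rewrite (ztw_wrap nc) ?det4_opp4 -?det4_rot; last by lia.
have [bn|nb] := ltnP b n.
  by rewrite !ztw_small ?pos //; lia.
rewrite (ztw_wrap nb) ?det4_opp4 -?det4_rot; last by lia.
by rewrite !ztw_small ?pos //; lia.
Qed.

Definition zc t : pt4 := map_mx (fun x : RR => (x%:C)%C) (ztw t).

Lemma zcE t : zc t = (-1) ^+ (t %/ n) *: z (cyc t).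
Proof.
by apply/rowP => j; rewrite !mxE rmorphM rmorphXn rmorphN1.
Qed.

Lemma zc_det a b c d : det4 (zc a) (zc b) (zc c) (zc d) = ((det4 (ztw a) (ztw b) (ztw c) (ztw d))%:C)%C.
Proof. exact: det4_map. Qed.

Lemma sgn_neq0 k : (-1) ^+ k != 0 :> CC.
Proof. by rewrite signr_eq0. Qed.

Lemma meets_zc M s t : meets M (zc s) (zc t) <-> meets M (z (cyc s)) (z (cyc t)).
Proof.
rewrite !zcE; split=> [|]; last by apply: meets_scale; apply: sgn_neq0.
move/(meets_scale (sgn_neq0 (s %/ n)) (sgn_neq0 (t %/ n))).
by rewrite !scalerA -!exprD !addnn -!mul2n !exprM !sqrrN !expr1n !scale1r.
Qed.

Lemma mem_zc (M : M24) t : (zc t <= M)%MS = (z (cyc t) <= M)%MS.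
Proof. by rewrite zcE eqmx_scale ?sgn_neq0. Qed.

Lemma zpt_ind_sorted (a b c d : 'I_n) : (a < b)%N -> (b < c)%N -> (c < d)%N ->
  ind4 (z a) (z b) (z c) (z d).
Proof.
move=> ab bc cd; have := row_pos ab bc cd.
rewrite lt0r => /andP[+ _]; apply: contraNneq.
rewrite -/(det4 _ _ _ _) /zpt /Zc -!map_row det4_map => -[/eqP].
by [].
Qed.

(** Only nonvanishing is claimed, so the indices can be sorted by transpositions without tracking
    signs. *)
Lemma zpt_ind (a b c d : 'I_n) : uniq [:: a; b; c; d] -> ind4 (z a) (z b) (z c) (z d).
Proof.
have lt (x y : 'I_n) : x != y -> (y <= x)%N -> (y < x)%N.
  by move=> xy yx; rewrite ltn_neqAle yx andbT eq_sym.
have A (w x y t : 'I_n) : (x < y)%N -> (y < t)%N -> uniq [:: w; x; y; t] -> ind4 (z w) (z x) (z y) (z t).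
  move=> xy yt; rewrite /= !inE !negb_or -!andbA => /and5P[wx wy wt _ _].
  have [h|/(lt _ _ wx) h] := ltnP w x; first exact: zpt_ind_sorted.
  have [h'|/(lt _ _ wy) h'] := ltnP w y; first by apply/ind4_swap12/zpt_ind_sorted.
  have [h''|/(lt _ _ wt) h''] := ltnP w t.
    by apply/ind4_swap12/ind4_swap23/zpt_ind_sorted.
  by apply/ind4_swap12/ind4_swap23/ind4_swap34/zpt_ind_sorted.
have B (w x y t : 'I_n) : (y < t)%N -> uniq [:: w; x; y; t] -> ind4 (z w) (z x) (z y) (z t).
  move=> yt u; have := u; rewrite /= !inE !negb_or -!andbA => /and5P[wx wy wt xy].
  case/andP=> xt _.
  have [h|/(lt _ _ xy) h] := ltnP x y; first exact: A.
  have [h'|/(lt _ _ xt) h'] := ltnP x t.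
    by apply/ind4_swap23/A => //; rewrite (perm_uniq (s2 := [:: w; x; y; t])) // perm_cons (perm_catCA [:: y] [:: x]).
  apply/ind4_swap23/ind4_swap34/A => //; rewrite (perm_uniq (s2 := [:: w; x; y; t])) // perm_cons.
  by rewrite (perm_catC [:: y; t] [:: x]).
move=> u; have := u; rewrite /= !inE !negb_or -!andbA => /and5P[ab ac ad bc].
case/and3P=> bd cd _.
have [h|/(lt _ _ cd) h] := ltnP c d; first exact: B.
apply/ind4_swap34/B => //; rewrite (perm_uniq (s2 := [:: a; b; c; d])) // !perm_cons.
by rewrite (perm_catC [:: d] [:: c]).
Qed.

End Configuration.

(** * Arithmetic of cyclic indices *)

Section CyclicIndices.
Variable n : nat.
Local Notation succ := (@Defs.succ n).
Local Notation pred := (@Defs.pred n).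

Lemma succE (i : 'I_n) : succ i = (if i.+1 == n then 0 else i.+1) :> nat.
Proof.
rewrite /=; case: eqP => [->|/eqP ne]; first exact: modnn.
by rewrite modn_small // ltn_neqAle ne ltn_ord.
Qed.

Lemma predE (i : 'I_n) : pred i = (if i == 0 :> nat then n.-1 else i.-1) :> nat.
Proof.
rewrite /=; have := ltn_ord i; case: eqP => [->|i0] lt.
  by rewrite modn_small //; lia.
rewrite (_ : (i + n).-1 = i.-1 + n)%N; last by lia.
by rewrite modnDr modn_small //; lia.
Qed.

Lemma eq_ordE (i j : 'I_n) : (i == j) = (i == j :> nat).
Proof. by []. Qed.

Lemma disjoint_pr (i : 'I_n) (A : {set 'I_n}) :
  [disjoint pr i & A] = (i \notin A) && (succ i \notin A).
Proof.
apply/pred0P/andP => [H|[H1 H2] x].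
  by split; [have := H i|have := H (succ i)]; rewrite !inE eqxx ?orbT //= => ->.
by rewrite !inE; case: eqP => [->|_]; [rewrite (negbTE H1)|case: eqP => [->|] //=; rewrite (negbTE H2)].
Qed.

Lemma disjoint_tr (i : 'I_n) (A : {set 'I_n}) :
  [disjoint tr i & A] = [&& pred i \notin A, i \notin A & succ i \notin A].
Proof.
apply/pred0P/and3P => [H|[H1 H2 H3] x].
  by split; [have := H (pred i)|have := H i|have := H (succ i)]; rewrite !inE eqxx ?orbT //= => ->.
rewrite !inE; case: eqP => [->|_]; first by rewrite (negbTE H1).
case: eqP => [->|_]; first by rewrite (negbTE H2).
by case: eqP => [->|] //=; rewrite (negbTE H3).
Qed.

Lemma succ_spec (i : 'I_n) : (i.+1 = n /\ succ i = 0%N :> nat) \/ (i.+1 < n /\ succ i = i.+1 :> nat)%N.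
Proof. by rewrite succE; have := ltn_ord i; case: eqP; lia. Qed.

Lemma pred_spec (i : 'I_n) : (i = 0%N :> nat /\ pred i = n.-1 :> nat) \/ (0 < i /\ pred i = i.-1 :> nat)%N.
Proof. by rewrite predE; have := ltn_ord i; case: eqP; lia. Qed.

End CyclicIndices.

(** Turns statements about cyclic indices into linear arithmetic: each [succ] and [pred] becomes a
    number with its wrap-around alternatives. Only the bound 4 <= n is kept from the context, so
    other facts must be moved to the goal beforehand. *)
Ltac ords := rewrite ?disjoint_tr ?disjoint_pr; rewrite /pr /tr;
  rewrite ?cons_uniq ?inE ?in_nil; change (uniq [::]) with true; rewrite ?eq_ordE;
  repeat match goal with
  | |- context [nat_of_ord (Defs.succ ?i)] =>
     generalize (succ_spec i); generalize (nat_of_ord (Defs.succ i))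
  | |- context [nat_of_ord (Defs.pred ?i)] =>
     generalize (pred_spec i); generalize (nat_of_ord (Defs.pred i))
  | |- context [nat_of_ord ?i] => generalize (ltn_ord i); generalize (nat_of_ord i)
  end; match goal with H : is_true (leq 4 _) |- _ => move: H end; clear; lia.

(** * Implications between the conditions V, P and L *)

Section Incidence.
Variables (n : nat) (Z : 'M[RR]_(n, 4)).
Hypotheses (n4 : (4 <= n)%N) (tp : totally_positive Z).

Local Notation z := (zpt Z).
Local Notation succ := (@Defs.succ n).
Local Notation pred := (@Defs.pred n).
Local Notation plane i := (col_mx (z (pred i)) (col_mx (z i) (z (succ i)))).

Definition Vb i (M : M24) := (z i <= M)%MS.
Definition Pb i (M : M24) := (M <= plane i)%MS.
Definition Lb i (M : M24) := bracket Z M i (succ i) == 0.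

Lemma LbP i M : rank2 M -> (Lb i M <-> meets M (z i) (z (succ i))).
Proof.
move=> rM; rewrite -(meets_det _ _ rM) /Lb /bracket; split=> [/eqP //|->]; exact: eqxx.
Qed.

(** Supplies the missing members of independent quadruples. *)
Lemma ex4 (a b c : 'I_n) : exists d, d \notin [:: a; b; c].
Proof.
apply: boolp.contrapT => nex.
suff: (n <= 3)%N by lia.
rewrite -{1}(size_enum_ord n) -/(size [:: a; b; c]); apply: uniq_leq_size (enum_uniq _) _ => d _.
by apply: contraT => Hd; case: nex; exists d.
Qed.

Section Line.
Variable M : M24.
Hypothesis rM : rank2 M.

Lemma Vb_Lb i : Vb i M -> Lb i M.
Proof. by move=> V; apply/(LbP _ rM)/meets_mem1. Qed.

Lemma Vb_Lbp i : Vb i M -> Lb (pred i) M.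
Proof. by move=> V; apply/(LbP _ rM); rewrite predK //; apply: meets_mem2. Qed.

Lemma Pb_Lb i : Pb i M -> Lb i M.
Proof. by move=> /(plane_meets rM)[_ h _]; apply/(LbP _ rM). Qed.

Lemma Pb_Lbp i : Pb i M -> Lb (pred i) M.
Proof. by move=> /(plane_meets rM)[h _ _]; apply/(LbP _ rM); rewrite predK. Qed.

Lemma Lb_corner i : Lb (pred i) M -> Lb i M -> Vb i M \/ Pb i M.
Proof.
have [d Hd] := ex4 (pred i) i (succ i).
have ind : ind4 (z (pred i)) (z i) (z (succ i)) (z d).
  by apply: zpt_ind => //; move: Hd; ords.
move=> /(LbP _ rM) + /(LbP _ rM); rewrite predK // => h1 h2.
exact: meets_corner ind rM h1 h2.
Qed.

Lemma VPb_tr i j : Vb i M -> Pb j M -> i \in tr j.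
Proof.
move=> Vi Pj; apply: contraT => nij.
have ind : ind4 (z (pred j)) (z j) (z (succ j)) (z i).
  by apply: zpt_ind => //; move: nij; ords.
have := det4_sub3 (submx_trans Vi Pj); move/eqP.
by rewrite (negbTE (ind : det4 _ _ _ _ != 0)).
Qed.

Lemma VVb_line i j : i != j -> Vb i M -> Vb j M -> (M == col_mx (z i) (z j))%MS.
Proof.
move=> ij Vi Vj; have [c Hc] := ex4 i j j; have [d Hd] := ex4 i j c.
apply: (@SVV _ _ (z c) (z d)) => //; apply: zpt_ind => //.
by move: ij Hc Hd; ords.
Qed.

Lemma VVLb i j k : i != j -> Vb i M -> Vb j M -> Lb k M -> i \in pr k \/ j \in pr k.
Proof.
move=> ij Vi Vj Lk; have MN := VVb_line ij Vi Vj.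
have [|ni] := boolP (i \in pr k); first by left.
have [|nj] := boolP (j \in pr k); first by right.
have ind : ind4 (z i) (z j) (z k) (z (succ k)).
  by apply: zpt_ind => //; move: ij ni nj; ords.
have /eqP := (meets_det4 (z k) (z (succ k)) rM MN).1 ((LbP _ rM).1 Lk).
by rewrite (negbTE (ind : det4 _ _ _ _ != 0)).
Qed.

Lemma VVVb i j k : uniq [:: i; j; k] -> Vb i M -> Vb j M -> Vb k M -> False.
Proof.
move=> u Vi Vj Vk; have [d Hd] := ex4 i j k.
have ind : ind4 (z i) (z j) (z k) (z d).
  by apply: zpt_ind => //; move: u Hd; ords.
have ij : i != j by move: u; ords.
have MN := VVb_line ij Vi Vj.
have /eqP := (meets_det4 (z k) (z d) rM MN).1 (meets_mem1 _ Vk).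
by rewrite (negbTE (ind : det4 _ _ _ _ != 0)).
Qed.

(** Since Z_t is outside the plane, the line Z_s Z_t meets the plane only in Z_s. *)
Lemma plane_corner (p q r s t : 'I_n) : uniq [:: p; q; r; t] -> s \in [:: p; q; r] ->
  (M <= col_mx (z p) (col_mx (z q) (z r)))%MS -> meets M (z s) (z t) -> Vb s M.
Proof.
move=> u sP MP [a [b [ab vM]]].
have ind : ind4 (z p) (z q) (z r) (z t) by apply: zpt_ind.
have := det4_sub3 (submx_trans vM MP); rewrite det4_lin4.
have -> : det4 (z p) (z q) (z r) (z s) = 0.
  apply: det4_sub3; move: sP; rewrite !inE.
  by case/or3P => /eqP ->; apply/sub_col3P; [exists 1, 0, 0|exists 0, 1, 0|exists 0, 0, 1]; vring.
move/eqP; rewrite mulr0 add0r mulf_eq0 (negbTE (ind : det4 _ _ _ _ != 0)) orbF => /eqP b0.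
move: vM ab; rewrite b0 scale0r addr0 => vM a0; move: vM; rewrite eqmx_scale //.
by apply: contraNneq a0 => ->.
Qed.

(** The pair of j shares just one index with [tr i], as j = i + 1 or j + 1 = i - 1, and
    [plane_corner] applies there. *)
Lemma PLb_corner i j : Pb i M -> Lb j M -> j != i -> j != pred i -> ~~ [disjoint tr i & pr j] ->
  Vb j M \/ Vb (succ j) M.
Proof.
move=> Pi Lj ji jpi nd.
have mj := (LbP _ rM).1 Lj.
have [e|ne] := eqVneq j (succ i).
  left; apply: (@plane_corner (pred i) i (succ i) j (succ j)) => //.
    by rewrite e; ords.
  by rewrite e !inE eqxx !orbT.
have e : succ j = pred i by apply/eqP; move: nd ji jpi ne; ords.
right; apply: (@plane_corner (pred i) i (succ i) (succ j) j) => //.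
- by move: e => /(congr1 pred); rewrite succK => ->; ords.
- by rewrite e inE eqxx.
exact: meets_sym.
Qed.

Lemma VLb_plane i j : i \notin pr j -> Vb i M ->
  (Lb j M <-> (M <= col_mx (z j) (col_mx (z i) (z (succ j))))%MS).
Proof.
move=> nij Vi; have [d Hd] := ex4 i j (succ j).
have ind : ind4 (z j) (z i) (z (succ j)) (z d).
  by apply: zpt_ind => //; move: nij Hd; ords.
rewrite LbP //; exact: pencil_meets ind rM Vi.
Qed.

(** With [VLb_Pbp], this is why a normal form with V_i need not list P_{i+1} or P_{i-1}. *)
Lemma VLb_Pbs i : Vb i M -> Lb (succ i) M -> Pb (succ i) M.
Proof.
move=> Vi Ls; have nij : i \notin pr (succ i) by ords.
have := (VLb_plane nij Vi).1 Ls; rewrite /Pb succK => /submx_trans; apply.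
have [h1 h2 h3] := mem_plane (z i) (z (succ i)) (z (succ (succ i))).
by rewrite (col_mx_sub (z (succ i))) h2 (col_mx_sub (z i)) h1 h3.
Qed.

Lemma VLb_Pbp i : Vb i M -> Lb (pred (pred i)) M -> Pb (pred i) M.
Proof.
move=> Vi Ls; have nij : i \notin pr (pred (pred i)) by rewrite /pr predK; ords.
have := (VLb_plane nij Vi).1 Ls; rewrite /Pb !predK => /submx_trans; apply.
have [h1 h2 h3] := mem_plane (z (pred (pred i))) (z (pred i)) (z i).
by rewrite (col_mx_sub (z (pred (pred i)))) h1 (col_mx_sub (z i)) h3 h2.
Qed.

Lemma mem_tr i m : m \in tr i -> (z m <= plane i)%MS.
Proof.
by rewrite !inE => /orP[/orP[]|] /eqP ->; have [] := mem_plane (z (pred i)) (z i) (z (succ i)).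
Qed.

(** Take Z_o in the second plane but not in the first. M meets the line Z_m Z_o of the second plane,
    and this line meets the first plane only in Z_m. *)
Lemma PPb_common i j m : i != j -> m \in tr i -> m \in tr j -> Pb i M -> Pb j M -> Vb m M.
Proof.
move=> ij mi mj Pi Pj.
have [o oj oi] : exists2 o, o \in tr j & o \notin tr i.
  have [h1|h1] := boolP (pred j \in tr i); last by exists (pred j); rewrite // !inE eqxx.
  have [h2|h2] := boolP (j \in tr i); last by exists j; rewrite // !inE eqxx orbT.
  exists (succ j); first by rewrite !inE eqxx orbT.
  by move: ij h1 h2; ords.
apply: (@plane_corner (pred i) i (succ i) m o) => //.
- by move: oi; ords.
- by move: mi; rewrite !inE orbA.
exact: plane_meets2 Pj (mem_tr mj) (mem_tr oj).
Qed.

End Line.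
End Incidence.

(** * Incompatibility of V_i, P_i, L_j and L_k with disjoint indices *)

Section NoConcurrency.
Variables (n : nat) (Z : 'M[RR]_(n, 4)).
Hypotheses (n4 : (4 <= n)%N) (tp : totally_positive Z).

Local Notation z := (zpt Z).
Local Notation succ := (@Defs.succ n).
Local Notation pred := (@Defs.pred n).
Local Notation plane i := (col_mx (z (pred i)) (col_mx (z i) (z (succ i)))).
Local Notation Vb := (Vb Z).
Local Notation Pb := (Pb Z).
Local Notation Lb := (Lb Z).
Local Notation ztw := (ztw Z n4).
Local Notation zc := (zc Z n4).
Local Notation cyc := (cyc n4).

Lemma cyc_predn (i : 'I_n) : cyc (i + n).-1 = pred i.
Proof. by rewrite pred_cyc. Qed.

Lemma cyc_lift (i j : 'I_n) : cyc (if (i < j)%N then j : nat else j + n)%N = j.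
Proof. by case: ifP => _; rewrite ?cyc_addn cyc_val. Qed.

Lemma nth_mono (s : seq nat) a b : sorted ltn s -> (a < b)%N -> (b < size s)%N ->
  (nth 0%N s a < nth 0%N s b)%N.
Proof.
by move=> ss ab bs; apply: (sorted_ltn_nth ltn_trans 0 ss) => //; rewrite inE (ltn_trans ab).
Qed.

Lemma zc_ind a b c d : (a < b)%N -> (b < c)%N -> (c < d)%N -> (d < a + n)%N -> (a < n)%N ->
  ind4 (zc a) (zc b) (zc c) (zc d).
Proof.
move=> ab bc cd da an; have := ztw_pos n4 tp ab bc cd da an.
rewrite lt0r => /andP[+ _]; apply: contraNneq.
by rewrite -/(det4 _ _ _ _) zc_det => -[/eqP].
Qed.

Lemma plane_zc (i : 'I_n) M : Pb i M -> (M <= col_mx (zc (i + n).-1) (col_mx (zc i) (zc i.+1)))%MS.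
Proof.
have [h1 h2 h3] := mem_plane (zc (i + n).-1) (zc i) (zc i.+1).
rewrite !zcE !eqmx_scale ?sgn_neq0 // -!zcE cyc_predn cyc_val -cycS cyc_val in h1 h2 h3.
move/submx_trans; apply.
by rewrite (col_mx_sub (z (pred i))) h1 (col_mx_sub (z i)) h2 h3.
Qed.

Lemma VPLLb_false M i j k : rank2 M -> [disjoint tr i & pr j] -> [disjoint tr i & pr k] ->
  [disjoint pr j & pr k] -> Vb i M -> Pb i M -> Lb j M -> Lb k M -> False.
Proof.
(* [lft j] represents j among i + 1, ..., i + n: the cycle is cut open at i. *)
move=> rM; set lft := fun j : 'I_n => (if (i < j)%N then j : nat else j + n)%N.
wlog jk : j k / (lft j < lft k)%N.
  move=> H dj dk djk Vi Pi Lj Lk; have [lt|lt|eq] := ltngtP (lft j) (lft k).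
  - exact: (H j k).
  - by apply: (H k j) => //; rewrite disjoint_sym.
  have := congr1 cyc eq. rewrite !cyc_lift => E. move: djk. rewrite E. ords.
move=> dj dk djk Vi Pi Lj Lk.
(* The points are Z_{i+1}, the pair of j, the pair of k, and Z_{i-1} reached after almost a full
   turn: the order in which [concurrency_neq0] is used with x = Z_i. *)
pose t := [:: i.+1; lft j; (lft j).+1; lft k; (lft k).+1; (i + n).-1].
have bnd : [&& (i.+1 < lft j)%N, ((lft j).+1 < lft k)%N, ((lft k).+1 < (i + n).-1)%N & (i < n)%N].
  apply/and4P; split=> //.
  - have h1 : j != i by move: dj; ords.
    have h2 : j != succ i by move: dj; ords.
    by rewrite /lft; case: ifP; move: h1 h2; ords.
  - have h1 : k != succ j by move: djk; ords.
    by move: jk; rewrite /lft; case: ifP; case: ifP; move: h1; ords.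
  - have h1 : k != i by move: dk; ords.
    have h2 : k != pred i by move: dk; ords.
    have h3 : succ k != pred i by move: dk; ords.
    by rewrite /lft; case: ifP; move: h1 h2 h3; ords.
have /and4P[b1 b2 b3 b4] := bnd.
have st : sorted ltn t by rewrite /= !ltnS b1 leqnn b2 leqnn /=; rewrite b3.
pose y a := zc (nth 0%N t a).
have pos a b c : (a < b)%N -> (b < c)%N -> (c < 6)%N ->
    0 < det4 (ztw i) (ztw (nth 0%N t a)) (ztw (nth 0%N t b)) (ztw (nth 0%N t c)).
  move=> ab bc c6.
  have h1 := nth_mono st ab (ltn_trans bc c6).
  have h2 := nth_mono st bc c6.
  have h3 : (i < nth 0%N t a)%N.
    have := @nth_mono t 0 a st; case: (a) (ltn_trans ab (ltn_trans bc c6)) => [|a'] //= a6.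
    by move=> /(_ isT a6); apply: ltn_trans.
  apply: ztw_pos => //.
  have := @nth_mono t c 5 st; move: c6; rewrite ltnS leq_eqVlt => /predU1P[-> _|c5 /(_ c5 isT)] /=.
    by rewrite prednK // addn_gt0 (leq_trans _ n4) ?orbT.
  by move/ltn_trans; apply; rewrite prednK // addn_gt0 (leq_trans _ n4) ?orbT.
apply: (@no_concurrency (zc i) y M rM).
- rewrite /y !zc_det -!rmorphM -rmorphB fmorph_eq0.
  exact: (@concurrency_neq0 _ (fun a => ztw (nth 0%N t a))) pos.
- apply: zc_ind => /=; lia.
- by rewrite mem_zc cyc_val.
- exact: plane_zc.
- by apply/meets_zc; rewrite -cycS cyc_lift; apply/LbP.
by apply/meets_zc; rewrite -cycS cyc_lift; apply/LbP.
Qed.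

End NoConcurrency.

(** * Irreducibility of the candidate strata *)

Section Irreducibility.
Variables (n : nat) (Z : 'M[RR]_(n, 4)).
Hypotheses (n4 : (4 <= n)%N) (tp : totally_positive Z).

Local Notation z := (zpt Z).
Local Notation succ := (@Defs.succ n).
Local Notation pred := (@Defs.pred n).
Local Notation plane i := (col_mx (z (pred i)) (col_mx (z i) (z (succ i)))).
Local Notation Vb := (Vb Z).
Local Notation Pb := (Pb Z).
Local Notation Lb := (Lb Z).
Local Notation ztw := (ztw Z n4).
Local Notation zc := (zc Z n4).
Local Notation cyc := (cyc n4).

Lemma two_points_sorted (i j k l : 'I_n) : (i.+1 < j)%N -> (j.+1 < k)%N -> (k.+1 < l)%N ->
  (l.+1 < i + n)%N ->
  exists M1 M2 : M24, [/\ rank2 M1, rank2 M2, ~~ (M1 == M2)%MS &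
  forall M, rank2 M -> ([/\ Lb i M, Lb j M, Lb k M & Lb l M] <-> (M == M1)%MS \/ (M == M2)%MS)].
Proof.
move=> ij jk kl li.
(* The last index l + 1 may equal n; then [ztw] gives the first point with its sign changed. *)
pose t : seq nat := [:: i : nat; i.+1; j : nat; j.+1; k : nat; k.+1; l : nat; l.+1].
have st : sorted ltn t by rewrite /= ltnSn ij ltnSn jk ltnSn kl ltnSn.
have lt a b : (a < b)%N -> (b < 8)%N -> (nth 0%N t a < nth 0%N t b)%N by move=> ab b8; apply: (@nth_mono t a b st ab b8).
have le a b : (a <= b)%N -> (b < 8)%N -> (nth 0%N t a <= nth 0%N t b)%N.
  by rewrite leq_eqVlt => /predU1P[-> //|ab b8]; apply: ltnW; apply: lt.
have pos a b c d : (a < b)%N -> (b < c)%N -> (c < d)%N -> (d < 8)%N ->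
    0 < det4 (ztw (nth 0%N t a)) (ztw (nth 0%N t b)) (ztw (nth 0%N t c)) (ztw (nth 0%N t d)).
  move=> ab bc cd d8; have c8 := ltn_trans cd d8; have b8 := ltn_trans bc c8.
  have hd : (nth 0%N t d <= l.+1)%N := le d 7%N d8 isT.
  have ha : (i <= nth 0%N t a)%N := le 0%N a (leq0n a) (ltn_trans ab b8).
  have hk : (nth 0%N t a <= k)%N by apply: (le a 4%N) => //; lia.
  have kn := ltn_ord k.
  by apply: ztw_pos => //; [exact: lt|exact: lt|exact: lt|lia|lia].
have [al0 disc] := @four_lines_disc _ (fun a => ztw (nth 0%N t a)) pos.
have ind a b c d : (a < b)%N -> (b < c)%N -> (c < d)%N -> (d < 8)%N ->
    ind4 (zc (nth 0%N t a)) (zc (nth 0%N t b)) (zc (nth 0%N t c)) (zc (nth 0%N t d)).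
  move=> ab bc cd d8; have := pos a b c d ab bc cd d8.
  rewrite lt0r => /andP[+ _]; apply: contraNneq.
  by rewrite -/(det4 _ _ _ _) zc_det => -[/eqP].
have [] := @four_lines_two_points (zc i) (zc i.+1) (zc j) (zc j.+1) (zc k) (zc k.+1) (zc l) (zc l.+1)
  (ind 0 1 2 3 isT isT isT isT)%N (ind 2 3 4 5 isT isT isT isT)%N (ind 0 1 4 5 isT isT isT isT)%N.
- by rewrite !zc_det -!rmorphM -rmorphB fmorph_eq0; apply: lt0r_neq0 al0.
- move/lt0r_neq0: disc; rewrite -(fmorph_eq0 (real_complex RR)) /= => disc.
  rewrite !zc_det; move: disc; apply: contraNN.
  by rewrite !(rmorphB, rmorphD, rmorphM, rmorphXn, rmorph_nat).
move=> M1 [M2 [r1 r2 n12 H]]; exists M1, M2; split=> // M rM.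
rewrite -(H M rM).
have mz (a : 'I_n) : Lb a M <-> meets M (zc a) (zc a.+1).
  rewrite (LbP Z a rM) (_ : meets M (zc a) (zc a.+1) <-> _); last exact: meets_zc.
  by rewrite -cycS cyc_val.
by split=> -[/mz ? /mz ? /mz ? /mz ?].
Qed.

Lemma Lset_SL (i j : 'I_n) : i != j -> seteq (Lset Z i j) (SL (z i) (z j)).
Proof.
move=> ij M; have [c Hc] := ex4 n4 i j j; have [d Hd] := ex4 n4 i j c.
have ind : ind4 (z i) (z j) (z c) (z d) by apply: zpt_ind => //; move: ij Hc Hd; ords.
split=> -[rM].
  rewrite lt0n mxrank_eq0 => /rowV0Pn[v]; rewrite sub_capmx => /andP[vM /sub_col2P[a [b ev]]] v0; split=> //.
  exists a, b; rewrite -ev; split=> //; apply: contraNneq v0 => -[a0 b0].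
  by rewrite ev a0 b0 !scale0r addr0.
move=> [a [b [ab vM]]]; split=> //; rewrite lt0n mxrank_eq0; apply/rowV0Pn.
exists (a *: z i + b *: z j).
  by rewrite sub_capmx vM; apply/sub_col2P; exists a, b.
apply: contraNneq ab => E.
have [|-> -> //] := ind4_eq0 (a := a) (b := b) (c := 0) (d := 0) ind.
by rewrite E; vring.
Qed.

Lemma succ_neq (i : 'I_n) : i != succ i. Proof. by ords. Qed.

Lemma LnextP i M : Lnext Z i M <-> rank2 M /\ Lb i M.
Proof.
split=> [/(Lset_SL (succ_neq i) M)[rM m]|[rM m]].
  by split=> //; apply/LbP.
by apply/(Lset_SL (succ_neq i) M); split=> //; apply/(LbP Z i rM).
Qed.

Section Shape.
Variable X : gset.

Lemma irr3I i : (forall M, X M <-> rank2 M /\ Lb i M) -> irrdim X 3.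
Proof.
move=> H; have [c Hc] := ex4 n4 i (succ i) i; have [d Hd] := ex4 n4 i (succ i) c.
have ind : ind4 (z i) (z (succ i)) (z c) (z d) by apply: zpt_ind => //; move: Hc Hd; ords.
apply: irrdim_ext (irrdim_SL ind) => M; rewrite H.
by split=> -[rM m]; split=> //; apply/(LbP Z i rM).
Qed.

Lemma irr2I i : (forall M, X M <-> rank2 M /\ Vb i M) -> irrdim X 2.
Proof.
move=> H; have [c Hc] := ex4 n4 i (succ i) i; have [d Hd] := ex4 n4 i (succ i) c.
have ind : ind4 (z i) (z (succ i)) (z c) (z d) by apply: zpt_ind => //; move: Hc Hd; ords.
by apply: irrdim_ext (irrdim_SV ind) => M; rewrite H.
Qed.

Lemma irr2II i : (forall M, X M <-> rank2 M /\ Pb i M) -> irrdim X 2.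
Proof.
move=> H; have [d Hd] := ex4 n4 (pred i) i (succ i).
have ind : ind4 (z (pred i)) (z i) (z (succ i)) (z d) by apply: zpt_ind => //; move: Hd; ords.
by apply: irrdim_ext (irrdim_SP ind) => M; rewrite H.
Qed.

Lemma irr2III i j : [disjoint pr i & pr j] ->
  (forall M, X M <-> rank2 M /\ Lb i M /\ Lb j M) -> irrdim X 2.
Proof.
move=> dij H.
have ind : ind4 (z i) (z (succ i)) (z j) (z (succ j)) by apply: zpt_ind => //; move: dij; ords.
apply: irrdim_ext (irrdim_LL ind) => M; rewrite H; split.
  by move=> [[rM m1] [_ m2]]; split=> //; split; apply/LbP.
by move=> [rM [/(LbP Z i rM) m1 /(LbP Z j rM) m2]]; split; split.
Qed.

Lemma irr1I i : (forall M, X M <-> rank2 M /\ Vb i M /\ Pb i M) -> irrdim X 1.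
Proof.
move=> H; have [d Hd] := ex4 n4 (pred i) i (succ i).
have ind : ind4 (z i) (z (pred i)) (z (succ i)) (z d) by apply: zpt_ind => //; move: Hd; ords.
apply: irrdim_ext (irrdim_pencil ind) => M; rewrite H /Defs.inter /SV /SP.
have [h1 h2 h3] := mem_plane (z (pred i)) (z i) (z (succ i)).
have [k1 k2 k3] := mem_plane (z i) (z (pred i)) (z (succ i)).
split=> [[[rM V] [_ P]]|[rM [V P]]]; split=> //; split=> //.
  by apply: submx_trans P _; rewrite (col_mx_sub (z i)) h2 (col_mx_sub (z (pred i))) h1 h3.
by apply: submx_trans P _; rewrite (col_mx_sub (z (pred i))) k2 (col_mx_sub (z i)) k1 k3.
Qed.

(** The pencil at Z_i in the plane of Z_i, Z_j and Z_{j+1}. *)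
Lemma irr1II i j : i \notin pr j -> (forall M, X M <-> rank2 M /\ Vb i M /\ Lb j M) -> irrdim X 1.
Proof.
move=> nij H; have [d Hd] := ex4 n4 i j (succ j).
have ind : ind4 (z i) (z j) (z (succ j)) (z d) by apply: zpt_ind => //; move: nij Hd; ords.
apply: irrdim_ext (irrdim_pencil ind) => M; rewrite H /Defs.inter /SV /SP.
have [h1 h2 h3] := mem_plane (z j) (z i) (z (succ j)).
have [k1 k2 k3] := mem_plane (z i) (z j) (z (succ j)).
split=> [[[rM V] [_ P]]|[rM [V L]]]; split=> //; split=> //.
  apply/(VLb_plane n4 tp rM nij V).
  by apply: submx_trans P _; rewrite (col_mx_sub (z i)) h2 (col_mx_sub (z j)) h1 h3.
apply: submx_trans ((VLb_plane n4 tp rM nij V).1 L) _.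
by rewrite (col_mx_sub (z j)) k2 (col_mx_sub (z i)) k1 k3.
Qed.

(** The pencil in the plane of i at the point e where this plane meets Z_j Z_{j+1}; e replaces
    Z_{i-1} in the basis of the plane. *)
Lemma irr1III i j : [disjoint tr i & pr j] ->
  (forall M, X M <-> rank2 M /\ Pb i M /\ Lb j M) -> irrdim X 1.
Proof.
move=> dij H.
have indj : ind4 (z (pred i)) (z i) (z (succ i)) (z j) by apply: zpt_ind => //; move: dij; ords.
have inds : ind4 (z (pred i)) (z i) (z (succ i)) (z (succ j)) by apply: zpt_ind => //; move: dij; ords.
have [e [a [b [[a0 b0] ee eP He]]]] := plane_line indj inds.
have /sub_col3P[x [y [t et]]] := eP.
(* If x were 0, e would lie on both of the skew lines Z_i Z_{i+1} and Z_j Z_{j+1}. *)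
have x0 : x != 0.
  have ind : ind4 (z i) (z (succ i)) (z j) (z (succ j)) by apply: zpt_ind => //; move: dij; ords.
  apply: contraNneq a0 => x0.
  have [|_ _ -> //] := ind4_eq0 (a := - y) (b := - t) (c := a) (d := b) ind.
  by rewrite -[RHS](subrr e) {1}ee et x0; vring.
have ind : ind4 e (z i) (z (succ i)) (z j).
  apply/ind4P => a' b' c' d' E.
  have [|k1 k2 k3 k4] := ind4_eq0 (a := a' * x) (b := b' + a' * y) (c := c' + a' * t) (d := d') indj.
    by rewrite -E et; vring.
  have a'0 : a' = 0 by apply/eqP; move/eqP: k1; rewrite mulf_eq0 (negbTE x0) orbF.
  by move: k2 k3; rewrite a'0 !mul0r !addr0.
apply: irrdim_ext (irrdim_pencil ind) => M; rewrite H /Defs.inter /SV /SP.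
split=> [[[rM V] [_ P]]|[rM [P L]]].
  have P' : Pb i M by rewrite /Pb (plane_span _ et x0).
  by split=> //; split=> //; apply/(LbP Z j rM)/(He M rM P').
have V : (e <= M)%MS by apply/(He M rM P)/(LbP Z j rM).
by split; split=> //; rewrite -(plane_span _ et x0).
Qed.

Lemma irr1IV i j k : [disjoint pr i & pr j] -> [disjoint pr i & pr k] -> [disjoint pr j & pr k] ->
  (forall M, X M <-> rank2 M /\ [/\ Lb i M, Lb j M & Lb k M]) -> irrdim X 1.
Proof.
move=> dij dik djk H.
have i1 : ind4 (z i) (z (succ i)) (z j) (z (succ j)) by apply: zpt_ind => //; move: dij; ords.
have i2 : ind4 (z i) (z (succ i)) (z k) (z (succ k)) by apply: zpt_ind => //; move: dik; ords.
have i3 : ind4 (z j) (z (succ j)) (z k) (z (succ k)) by apply: zpt_ind => //; move: djk; ords.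
apply: irrdim_ext (irrdim_skew_lines i1 i2 i3) => M; rewrite H; split.
  by move=> [[rM m1] [[_ m2] [_ m3]]]; split=> //; split; apply/LbP.
by move=> [rM [/(LbP Z i rM) m1 /(LbP Z j rM) m2 /(LbP Z k rM) m3]]; split; last split; split.
Qed.

End Shape.

Definition onept (C : M24 -> Prop) := exists N : M24, rank2 N /\ forall M, rank2 M -> (C M <-> (M == N)%MS).

Lemma onept_irr C X : onept C -> (forall M, X M <-> rank2 M /\ C M) -> irrdim X 0.
Proof.
move=> [N [rN HN]] H; apply: irrdim_ext (irrdim_Spt rN) => M; rewrite H.
by split=> -[rM HM]; split=> //; apply/(HN M rM).
Qed.

Lemma onept0I i j : i != j -> onept (fun M => Vb i M /\ Vb j M).
Proof.
move=> ij; have [c Hc] := ex4 n4 i j j; have [d Hd] := ex4 n4 i j c.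
have ind : ind4 (z i) (z j) (z c) (z d) by apply: zpt_ind => //; move: ij Hc Hd; ords.
exists (col_mx (z i) (z j)); split; first exact: ind_rank2_12 ind.
move=> M rM; split=> [[Vi Vj]|MN]; first exact: (VVb_line n4 tp rM ij).
by split; [exact: eqmx_mem1 MN | exact: eqmx_mem2 MN].
Qed.

Lemma onept_ext (C C' : M24 -> Prop) : (forall M, rank2 M -> (C M <-> C' M)) -> onept C -> onept C'.
Proof. by move=> CC' [N [rN HN]]; exists N; split=> // M rM; rewrite -(CC' M rM) HN. Qed.

Lemma onept0III i j : [disjoint tr i & pr j] -> onept (fun M => [/\ Vb i M, Pb i M & Lb j M]).
Proof.
move=> dij.
have indj : ind4 (z (pred i)) (z i) (z (succ i)) (z j) by apply: zpt_ind => //; move: dij; ords.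
have inds : ind4 (z (pred i)) (z i) (z (succ i)) (z (succ j)) by apply: zpt_ind => //; move: dij; ords.
have ind3 : ind4 (z (pred i)) (z i) (z j) (z (succ j)) by apply: zpt_ind => //; move: dij; ords.
apply: onept_ext (star_point indj inds ind3) => M rM.
by split=> -[V P L]; split=> //; apply/(LbP Z j rM).
Qed.

Lemma onept0IV i j k : [disjoint pr j & pr k] -> i \notin pr j -> i \notin pr k ->
  onept (fun M => [/\ Vb i M, Lb j M & Lb k M]).
Proof.
move=> djk nij nik.
have i1 : ind4 (z j) (z i) (z (succ j)) (z k) by apply: zpt_ind => //; move: djk nij nik; ords.
have i2 : ind4 (z j) (z i) (z (succ j)) (z (succ k)) by apply: zpt_ind => //; move: djk nij nik; ords.
have i3 : ind4 (z j) (z i) (z k) (z (succ k)) by apply: zpt_ind => //; move: djk nij nik; ords.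
apply: onept_ext (star_point i1 i2 i3) => M rM.
have HV V := VLb_plane n4 tp rM nij V.
split=> [[V P L]|[V L1 L2]]; split=> //.
- by apply/(HV V).
- by apply/(LbP Z k rM).
- by apply/(HV V).
by apply/(LbP Z k rM).
Qed.

Lemma onept0V i j k : [disjoint tr i & pr j] -> [disjoint tr i & pr k] -> [disjoint pr j & pr k] ->
  onept (fun M => [/\ Pb i M, Lb j M & Lb k M]).
Proof.
move=> dij dik djk.
have i1 : ind4 (z (pred i)) (z i) (z (succ i)) (z j) by apply: zpt_ind => //; move: dij; ords.
have i2 : ind4 (z (pred i)) (z i) (z (succ i)) (z (succ j)) by apply: zpt_ind => //; move: dij; ords.
have i3 : ind4 (z (pred i)) (z i) (z (succ i)) (z k) by apply: zpt_ind => //; move: dik; ords.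
have i4 : ind4 (z (pred i)) (z i) (z (succ i)) (z (succ k)) by apply: zpt_ind => //; move: dik; ords.
have ind : ind4 (z j) (z (succ j)) (z k) (z (succ k)) by apply: zpt_ind => //; move: djk; ords.
apply: (onept_ext _ (plane_two_lines i1 i2 i3 i4 _)) => [M rM|a b c d a0 b0 c0 d0].
  by split=> -[P L L']; split=> //; apply/(LbP Z _ rM).
apply: (ind_rank2 (a := a) (b := b) (c := 0) (d := 0) (a' := 0) (b' := 0) (c' := c) (d' := d) ind).
- by vring.
- by vring.
move=> s u; rewrite !(mulr0, addr0, add0r) => /eqP + _ /eqP; rewrite !mulf_eq0.
by rewrite (negbTE a0) (negbTE c0) !orbF => /eqP -> /eqP ->.
Qed.

(** Lying in the plane of j is replaced by meeting Z_{j-1} Z_j and Z_j Z_{j+1}. The alternative,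
    passing through Z_j, is excluded because Z_j is not in the plane of i. *)
Lemma onept0II i j : [disjoint tr i & tr j] -> onept (fun M => Pb i M /\ Pb j M).
Proof.
move=> dij.
have tri m : m \notin tr i -> ind4 (z (pred i)) (z i) (z (succ i)) (z m).
  by move=> nm; apply: zpt_ind => //; move: nm; ords.
have trj m : m \in tr j -> m \notin tr i by move=> mj; rewrite (disjointFl dij mj).
have i1 : ind4 (z (pred i)) (z i) (z (succ i)) (z (pred j)) by apply/tri/trj; rewrite !inE eqxx.
have i2 : ind4 (z (pred i)) (z i) (z (succ i)) (z j) by apply/tri/trj; rewrite !inE eqxx orbT.
have i3 : ind4 (z (pred i)) (z i) (z (succ i)) (z (succ j)) by apply/tri/trj; rewrite !inE eqxx orbT.
have ind : ind4 (z (pred j)) (z j) (z (succ j)) (z i).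
  apply: zpt_ind => //; have : i \notin tr j by rewrite (disjointFr dij) // !inE eqxx orbT.
  by ords.
apply: (onept_ext _ (plane_two_lines i1 i2 i2 i3 _)) => [M rM|a b c d a0 b0 c0 d0].
  split=> [[P m1 m2]|[P P']]; last by have [] := plane_meets rM P'.
  split=> //; have [Vj|//] := meets_corner ind rM m1 m2.
  by have := VPb_tr n4 tp Vj P; move: dij; rewrite disjoint_sym disjoint_tr => /and3P[_ /negbTE ->].
apply: (ind_rank2 (a := a) (b := b) (c := 0) (d := 0) (a' := 0) (b' := c) (c' := d) (d' := 0) ind).
- by vring.
- by vring.
move=> s u; rewrite !(mulr0, addr0, add0r) => /eqP + _ /eqP; rewrite !mulf_eq0.
by rewrite (negbTE a0) (negbTE d0) !orbF => /eqP -> /eqP ->.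
Qed.

End Irreducibility.

(** * Normal forms of lines *)

(* The numbers of conditions V_i, P_i and L_i. For lines through Z_i the condition
   L_{(i-1)(i+1)} amounts to P_i, so that no other conditions are needed. *)
Definition tcards (t : stype) : nat * nat * nat :=
  match t with
  | T3_I => (0, 0, 1) | T2_I => (1, 0, 0) | T2_II => (0, 1, 0) | T2_III => (0, 0, 2)
  | T1_I => (1, 1, 0) | T1_II => (1, 0, 1) | T1_III => (0, 1, 1) | T1_IV => (0, 0, 3)
  | T0_I => (2, 0, 0) | T0_II => (0, 2, 0) | T0_III => (1, 1, 1) | T0_IV => (1, 0, 2)
  | T0_V => (0, 1, 2) | T0_VI => (0, 0, 4)
  end%N.

Lemma tcards_inj : injective tcards.
Proof. by do 2 case. Qed.

Section NormalForm.
Variables (n : nat) (Z : 'M[RR]_(n, 4)).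
Hypotheses (n4 : (4 <= n)%N) (tp : totally_positive Z) (aG : assumptionG Z).

Local Notation z := (zpt Z).
Local Notation succ := (@Defs.succ n).
Local Notation pred := (@Defs.pred n).
Local Notation Vb := (Vb Z).
Local Notation Pb := (Pb Z).
Local Notation Lb := (Lb Z).

Lemma trpr_notin (i j : 'I_n) : [disjoint tr i & pr j] -> i \notin pr j.
Proof. by rewrite disjoint_tr => /and3P[]. Qed.

Lemma tr_succ_notin (i a : 'I_n) : i \notin pr a -> i \notin pr (succ a) -> i \notin tr (succ a).
Proof. by rewrite /tr /pr !inE succK !negb_or => /andP[-> ->] /andP[_ ->]. Qed.

Definition sigV M := [set i | Vb i M].
Definition sigP M := [set i | Pb i M].
Definition sigL M := [set i | Lb i M].

Definition data := ({set 'I_n} * {set 'I_n} * {set 'I_n})%type.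

Definition G (d : data) : gset := fun M =>
  rank2 M /\ [&& d.1.1 \subset sigV M, d.1.2 \subset sigP M & d.2 \subset sigL M].

(** The first clause makes the pairs of distinct indices of A disjoint ([indep_pr]). The last one
    allows V_i and P_j together only for i = j, where P_i encodes L_{(i-1)(i+1)}. *)
Definition adm (d : data) :=
  [&& [forall a in d.2, succ a \notin d.2],
      [forall i in d.1.1, forall a in d.2, i \notin pr a],
      [forall i in d.1.2, forall a in d.2, [disjoint tr i & pr a]],
      [forall i in d.1.2, forall j in d.1.2, (i != j) ==> [disjoint tr i & tr j]]
    & [forall i in d.1.1, forall j in d.1.2, i == j]].

Definition ok t (d : data) := adm d && ((#|d.1.1|, #|d.1.2|, #|d.2|) == tcards t).

Lemma admP (V P A : {set 'I_n}) : reflect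
  [/\ forall a, a \in A -> succ a \notin A,
      forall i a, i \in V -> a \in A -> i \notin pr a,
      forall i a, i \in P -> a \in A -> [disjoint tr i & pr a],
      forall i j, i \in P -> j \in P -> i != j -> [disjoint tr i & tr j]
    & forall i j, i \in V -> j \in P -> i = j] (adm (V, P, A)).
Proof.
apply: (iffP and5P) => [[h1 h2 h3 h4 h5]|[h1 h2 h3 h4 h5]]; split.
- by move=> a aA; apply: (forall_inP h1).
- by move=> i a iV aA; apply: (forall_inP (forall_inP h2 i iV)).
- by move=> i a iV aA; apply: (forall_inP (forall_inP h3 i iV)).
- by move=> i j iV aA ij; apply: (implyP (forall_inP (forall_inP h4 i iV) j aA)).
- by move=> i j iV aA; apply/eqP; apply: (forall_inP (forall_inP h5 i iV)).
- exact/forall_inP.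
- by apply/forall_inP => i iV; apply/forall_inP => a aA; apply: h2.
- by apply/forall_inP => i iV; apply/forall_inP => a aA; apply: h3.
- by apply/forall_inP => i iV; apply/forall_inP => j jV; apply/implyP; apply: h4.
by apply/forall_inP => i iV; apply/forall_inP => j jV; apply/eqP; apply: h5.
Qed.

(** V_i and P_i each imply L_{i-1} and L_i, which are therefore left out. *)
Definition rest M i := sigL M :\: [set pred i; i].

(* A minimal set of conditions that implies all the conditions met by the line M. *)
Definition nd M : data :=
  if (1 < #|sigV M|)%N then (sigV M, set0, set0) else
  if [pick i in sigV M] is Some i then
    (if i \in sigP M then ([set i], [set i], rest M i) else ([set i], set0, rest M i)) else
  if (1 < #|sigP M|)%N then (set0, sigP M, set0) else
  if [pick i in sigP M] is Some i then (set0, [set i], rest M i) else (set0, set0, sigL M).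

Variant nd_spec M : data -> Prop :=
| NdVV of (1 < #|sigV M|)%N : nd_spec M (sigV M, set0, set0)
| NdVP i of sigV M = [set i] & i \in sigP M : nd_spec M ([set i], [set i], rest M i)
| NdV i of sigV M = [set i] & i \notin sigP M : nd_spec M ([set i], set0, rest M i)
| NdPP of sigV M = set0 & (1 < #|sigP M|)%N : nd_spec M (set0, sigP M, set0)
| NdP i of sigV M = set0 & sigP M = [set i] : nd_spec M (set0, [set i], rest M i)
| NdL of sigV M = set0 & sigP M = set0 : nd_spec M (set0, set0, sigL M).

Lemma card_le1 (S : {set 'I_n}) i : (#|S| <= 1)%N -> i \in S -> S = [set i].
Proof.
move=> S1 iS; apply/eqP; rewrite eq_sym eqEcard sub1set iS cards1.
by [].
Qed.

Lemma ndP M : nd_spec M (nd M).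
Proof.
rewrite /nd; case: ltnP => [|V1]; first exact: NdVV.
case: pickP => [i iV|V0].
  have eV := card_le1 V1 iV.
  by case: ifPn; [exact: NdVP | exact: NdV].
have {}V0 : sigV M = set0 by apply/setP => i; rewrite V0 inE.
case: ltnP => [|P1]; first exact: NdPP.
case: pickP => [i iP|P0]; first exact: (NdP V0 (card_le1 P1 iP)).
by apply: NdL => //; apply/setP => i; rewrite P0 inE.
Qed.

Section OneLine.
Variable M : M24.
Hypothesis rM : rank2 M.

Lemma sigL_le4 : (#|sigL M| <= 4)%N.
Proof. exact: aG rM. Qed.

Lemma sigVL i : i \in sigV M -> (i \in sigL M) && (pred i \in sigL M).
Proof. by rewrite !inE => V; rewrite (Vb_Lb rM V) (Vb_Lbp rM V). Qed.

Lemma sigPL i : i \in sigP M -> (i \in sigL M) && (pred i \in sigL M).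
Proof. by rewrite !inE => V; rewrite (Pb_Lb rM V) (Pb_Lbp rM V). Qed.

Lemma corner a : a \in sigL M -> succ a \in sigL M -> (succ a \in sigV M) || (succ a \in sigP M).
Proof.
rewrite !inE => La Ls; apply/orP; apply: (Lb_corner n4 tp rM) => //.
by rewrite succK.
Qed.

Lemma card_rest i : i \in sigV M :|: sigP M -> (#|rest M i| + 2 = #|sigL M|)%N.
Proof.
move=> iVP; have /andP[Li Lp] : (i \in sigL M) && (pred i \in sigL M).
  by move: iVP; rewrite inE => /orP[/sigVL|/sigPL].
have pi : pred i != i by ords.
rewrite -(cardsID [set pred i; i] (sigL M)) addnC; congr (_ + _)%N.
rewrite (setIidPr _) ?cards2 ?pi //; apply/subsetP => j; rewrite in_set2.
by case/orP => /eqP ->.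
Qed.

Lemma in_rest i a : a \in rest M i -> [/\ a \in sigL M, a != i & succ a != i].
Proof.
rewrite inE in_set2 negb_or -andbA => /and3P[ap ai aL]; split=> //.
by apply: contraNneq ap => <-; rewrite succK.
Qed.

Lemma VV_card : (1 < #|sigV M|)%N -> #|sigV M| = 2%N.
Proof.
move=> V2; apply/eqP; rewrite eqn_leq V2 andbT leqNgt; apply/negP.
move=> /card_gt2P[i [j [k [[]]]]]; rewrite !inE => iV jV kV [ij jk ki].
by apply: (VVVb n4 tp rM _ iV jV kV); rewrite /= !inE negb_or ij jk eq_sym ki.
Qed.

Lemma PP_disjoint i j : sigV M = set0 -> i \in sigP M -> j \in sigP M -> i != j ->
  [disjoint tr i & tr j].
Proof.
move=> V0 iP jP ij; apply/pred0P => m /=; apply/negP => /andP[mi mj].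
have : m \in sigV M by move: iP jP; rewrite !inE => iP jP; apply: (PPb_common n4 tp rM ij mi mj iP jP).
by rewrite V0 inE.
Qed.

(** The planes have disjoint index triples, so three of them would force six distinct conditions L,
    against (G). *)
Lemma PP_card : sigV M = set0 -> (1 < #|sigP M|)%N -> #|sigP M| = 2%N.
Proof.
move=> V0 P2; apply/eqP; rewrite eqn_leq P2 andbT leqNgt; apply/negP.
move=> /card_gt2P[i [j [k [[iP jP kP] [ij jk ki]]]]].
have dj := PP_disjoint V0 iP jP ij; have dk := PP_disjoint V0 jP kP jk.
have di := PP_disjoint V0 kP iP ki.
have disj (a b c d : 'I_n) : [disjoint tr a & tr b] -> c \in tr a -> d \in tr b -> c != d.
  by move=> D ca db; apply: contraTneq db => <-; rewrite (disjointFr D ca).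
have ti (a : 'I_n) : a \in tr a by rewrite !inE eqxx orbT.
have tp' a : pred a \in tr a by rewrite !inE eqxx.
have u : uniq [:: pred i; i; pred j; j; pred k; k].
  have pn a : pred a != a by ords.
  rewrite !cons_uniq !in_cons !in_nil !negb_or; do ?[apply/andP; split] => //;
  first [exact: pn | by apply: (disj _ _ _ _ dj); rewrite ?ti ?tp'
    | by apply: (disj _ _ _ _ dk); rewrite ?ti ?tp'
    | by rewrite eq_sym; apply: (disj _ _ _ _ di); rewrite ?ti ?tp'].
have : (size [:: pred i; i; pred j; j; pred k; k] <= #|sigL M|)%N.
  rewrite -(card_uniqP u); apply/subset_leq_card/subsetP => a; rewrite !inE.
  have /andP[i1 i2] := sigPL iP; have /andP[j1 j2] := sigPL jP; have /andP[k1 k2] := sigPL kP.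
  rewrite !inE in i1 i2 j1 j2 k1 k2.
  by case/or4P => [/eqP ->|/eqP ->|/eqP ->|/or3P[] /eqP ->].
by move/leq_trans/(_ sigL_le4).
Qed.

(** By [PLb_corner], an overlap would put Z_a or Z_{a+1} on M, and both differ from Z_i since
    L_{i-1} and L_i are left out. *)
Lemma rest_disjoint i a : i \in sigP M -> sigV M \subset [set i] -> a \in rest M i ->
  [disjoint tr i & pr a].
Proof.
move=> iP V1 /in_rest[aL ai sai]; apply: contraT => nd'.
rewrite !inE in iP aL.
have api : a != pred i by apply: contraNneq sai => ->; rewrite predK.
have [V|V] := PLb_corner n4 tp rM iP aL ai api nd'.
  by move/subsetP/(_ a): V1; rewrite !inE => /(_ V); rewrite (negbTE ai).
by move/subsetP/(_ (succ a)): V1; rewrite !inE => /(_ V); rewrite (negbTE sai).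
Qed.

(** Consecutive conditions L_a and L_{a+1} on M require V_{a+1} or P_{a+1}, so it is enough to
    exclude these. *)
Lemma indep_of_corner (A : {set 'I_n}) : A \subset sigL M ->
  (forall a, a \in A -> succ a \in A -> (succ a \in sigV M) || (succ a \in sigP M) -> False) ->
  forall a, a \in A -> succ a \notin A.
Proof.
move=> /subsetP AL H a aA; apply/negP => sA; apply: (H a aA sA).
by apply: corner; apply: AL.
Qed.

Lemma rest_subset i : rest M i \subset sigL M.
Proof. exact: subsetDl. Qed.

Lemma VP_tr i j : i \in sigV M -> j \in sigP M -> i \in tr j.
Proof. by rewrite !inE => V P; have := VPb_tr n4 tp V P; rewrite !inE. Qed.

(** What remains is to bound the number of conditions L: (G) leaves at most two besides the L_{i-1}
    and L_i implied by V_i or P_i, and for V_i with P_i [VPLLb_false] leaves at most one. *)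
Lemma classify : sigL M != set0 -> exists t, ok t (nd M).
Proof.
move=> L0; have L4 := sigL_le4; case: ndP.
- move=> V2; exists T0_I; rewrite /ok /= !cards0 (VV_card V2) eqxx andbT.
  by apply/admP; split=> [a|i a _|i a|i j|i j _]; rewrite inE.
- move=> i eV iP.
  have dis a : a \in rest M i -> [disjoint tr i & pr a].
    by apply: rest_disjoint => //; rewrite eV.
  have indep : forall a, a \in rest M i -> succ a \notin rest M i.
    apply: indep_of_corner (rest_subset i) _ => a aA sA.
    have [_ ai sai] := in_rest aA; rewrite eV in_set1 (negbTE sai) /= => sP.
    have : i \in tr (succ a) by apply: VP_tr => //; rewrite eV set11.
    by rewrite (negbTE (tr_succ_notin (trpr_notin (dis _ aA)) (trpr_notin (dis _ sA)))).
  have c1 : (#|rest M i| <= 1)%N.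
    rewrite leqNgt; apply/negP => /card_gt1P[a [b [aA bA ab]]].
    have dab : [disjoint pr a & pr b].
      have := indep _ aA; have := indep _ bA.
      have : succ a != b by apply: contraTneq bA => <-; apply: indep.
      have : succ b != a by apply: contraTneq aA => <-; apply: indep.
      by move=> h1 h2 _ _; move: h1 h2 ab; ords.
    have [aL _ _] := in_rest aA; have [bL _ _] := in_rest bA.
    have iV : i \in sigV M by rewrite eV set11.
    rewrite !inE in iP iV aL bL.
    exact: (VPLLb_false n4 tp rM (dis _ aA) (dis _ bA) dab iV iP aL bL).
  have ad : adm ([set i], [set i], rest M i).
    apply/admP; split=> //.
    - by move=> j a; rewrite inE => /eqP -> /dis; rewrite disjoint_tr => /and3P[].
    - by move=> j a; rewrite inE => /eqP -> /dis.
    - by move=> j k; rewrite !inE => /eqP -> /eqP ->; rewrite eqxx.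
    by move=> j k; rewrite !inE => /eqP -> /eqP ->.
  move: c1; rewrite leq_eqVlt ltnS leqn0 => /orP[] /eqP c.
    by exists T0_III; rewrite /ok ad /= !cards1 c.
  by exists T1_I; rewrite /ok ad /= !cards1 c.
- move=> i eV iP; have iV : i \in sigV M by rewrite eV set11.
  have nij a : a \in rest M i -> i \notin pr a.
    by move=> /in_rest[_ ai sai]; rewrite !inE negb_or eq_sym ai eq_sym.
  have indep : forall a, a \in rest M i -> succ a \notin rest M i.
    apply: indep_of_corner (rest_subset i) _ => a aA sA.
    have [_ ai sai] := in_rest aA; rewrite eV in_set1 (negbTE sai) /= => sP.
    have : i \in tr (succ a) by apply: VP_tr.
    by rewrite (negbTE (tr_succ_notin (nij _ aA) (nij _ sA))).
  have ad : adm ([set i], set0, rest M i).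
    apply/admP; split=> //; try by move=> ? ?; rewrite !inE.
    - by move=> j a; rewrite inE => /eqP -> /nij.
  have := card_rest (i := i); rewrite inE iV => /(_ isT) c.
  have : (#|rest M i| <= 2)%N by lia.
  case e: #|rest M i| => [|[|[|?]]] // _.
  + by exists T2_I; rewrite /ok ad /= cards1 cards0 e.
  + by exists T1_II; rewrite /ok ad /= cards1 cards0 e.
  by exists T0_IV; rewrite /ok ad /= cards1 cards0 e.
- move=> V0 P2; exists T0_II; rewrite /ok /= !cards0 (PP_card V0 P2) eqxx andbT.
  apply/admP; split; try by move=> ? ?; rewrite !inE.
  by move=> i j iP jP; apply: PP_disjoint.
- move=> i V0 eP; have iP : i \in sigP M by rewrite eP set11.
  have dis a : a \in rest M i -> [disjoint tr i & pr a].
    by apply: rest_disjoint => //; rewrite V0 sub0set.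
  have indep : forall a, a \in rest M i -> succ a \notin rest M i.
    apply: indep_of_corner (rest_subset i) _ => a aA sA.
    by have [_ ai sai] := in_rest aA; rewrite V0 eP in_set1 (negbTE sai) inE.
  have ad : adm (set0, [set i], rest M i).
    apply/admP; split=> //; try by move=> ? ?; rewrite !inE.
    + by move=> j a; rewrite inE => /eqP -> /dis.
    + by move=> j k; rewrite !inE => /eqP -> /eqP ->; rewrite eqxx.
  have := card_rest (i := i); rewrite inE iP orbT => /(_ isT) c.
  have : (#|rest M i| <= 2)%N by lia.
  case e: #|rest M i| => [|[|[|?]]] // _.
  + by exists T2_II; rewrite /ok ad /= cards1 cards0 e.
  + by exists T1_III; rewrite /ok ad /= cards1 cards0 e.
  by exists T0_V; rewrite /ok ad /= cards1 cards0 e.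
move=> V0 P0.
have indep : forall a, a \in sigL M -> succ a \notin sigL M.
  by apply: indep_of_corner (subxx _) _ => a _ _; rewrite V0 P0 !inE.
have ad : adm (set0, set0, sigL M) by apply/admP; split=> //; move=> ? ?; rewrite !inE.
move: L4 L0; rewrite -card_gt0.
case e: #|sigL M| => [|[|[|[|[|?]]]]] // _ _.
- by exists T3_I; rewrite /ok ad /= !cards0 e.
- by exists T2_III; rewrite /ok ad /= !cards0 e.
- by exists T1_IV; rewrite /ok ad /= !cards0 e.
by exists T0_VI; rewrite /ok ad /= !cards0 e.
Qed.

Lemma nd_mem : G (nd M) M.
Proof.
split=> //; case: ndP => [_|i eV iP|i eV _|_ _|i _ eP|_ _] /=.
- by rewrite subxx !sub0set.
- by rewrite eV subxx sub1set iP rest_subset.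
- by rewrite eV subxx sub0set rest_subset.
- by rewrite subxx !sub0set.
- by rewrite eP subxx sub0set rest_subset.
by rewrite subxx !sub0set.
Qed.

End OneLine.

Lemma sig_eqmx M N : rank2 M -> (M == N)%MS ->
  [/\ sigV M = sigV N, sigP M = sigP N & sigL M = sigL N].
Proof.
move=> rM MN; have rN := eqmx_rank2 MN rM; split; apply/setP => i; rewrite !inE.
- exact: eqmx_mem.
- exact: eqmx_subP.
by apply/idP/idP => /LbP H; apply/(LbP Z i) => //; apply/(meets_eqP _ _ MN)/H.
Qed.

(** Two V or two P determine the line, so then N spans the same line as M. Otherwise [rest] and the
    implied L_{i-1} and L_i give all conditions L; the difficulty is a further P_m of M next to
    V_i. *)
Lemma nd_min M N : rank2 M -> G (nd M) N ->
  [/\ sigV M \subset sigV N, sigP M \subset sigP N & sigL M \subset sigL N].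
Proof.
move=> rM [rN]; have same : (M == N)%MS -> [/\ sigV M \subset sigV N, sigP M \subset sigP N & sigL M \subset sigL N].
  by move=> /(sig_eqmx rM)[-> -> ->].
have restL i : i \in sigV N :|: sigP N -> rest M i \subset sigL N -> sigL M \subset sigL N.
  move=> iN /subsetP H; apply/subsetP => a aL.
  have /andP[iL piL] : (i \in sigL N) && (pred i \in sigL N).
    by move: iN; rewrite inE => /orP[/(sigVL rN)|/(sigPL rN)].
  have [->//|ai] := eqVneq a i; have [->//|api] := eqVneq a (pred i).
  by apply: H; rewrite inE aL in_set2 negb_or api ai.
case: ndP.
- move=> V2 /and3P[/= VN _ _]; apply: same.
  have /card_gt1P[i [j [iV jV ij]]] := V2.
  have [K [rK HK]] := onept0I n4 tp ij.
  have := subsetP VN _ iV; have := subsetP VN _ jV; rewrite !inE in iV jV * => jN iN.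
  have /eqmxP e1 := (HK M rM).1 (conj iV jV); have /eqmxP e2 := (HK N rN).1 (conj iN jN).
  by apply/eqmxP/(eqmx_trans e1)/eqmx_sym.
- move=> i eV iP /and3P[/= VN PN AN].
  have iN : i \in sigV N by move: VN; rewrite sub1set.
  have dis a : a \in rest M i -> [disjoint tr i & pr a].
    by apply: rest_disjoint => //; rewrite eV.
  split; first by rewrite eV.
    (* If m were i + 1 or i - 1, then P_m would give L_{i+1} or L_{i-2}, whose pair meets [tr i],
       contrary to [dis]. So m = i. *)
    apply/subsetP => m mP; have iT : i \in tr m by apply: (VP_tr (M := M)) => //; rewrite eV set11.
    have [->|mi] := eqVneq m i; first by move: PN; rewrite sub1set.
    have /andP[mL pmL] := sigPL rM mP.
    have nin a : a \in sigL M -> ~~ [disjoint tr i & pr a] -> a = i \/ a = pred i.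
      move=> aL nd'; have [->|ai] := eqVneq a i; first by left.
      have [->|api] := eqVneq a (pred i); first by right.
      by move: nd'; rewrite dis // inE aL in_set2 negb_or api ai.
    have [E|ms] := eqVneq m (succ i).
      have [||E'] := nin m mL; first by rewrite E; ords.
        by move=> E'; rewrite E' eqxx in mi.
      by move/eqP: E'; rewrite E => E'; exfalso; move: E'; ords.
    have E : m = pred i by apply/eqP; move: iT mi ms; ords.
    have [||E'] := nin (pred m) pmL; first by rewrite E; ords.
      by move/eqP; rewrite E => E'; exfalso; move: E'; ords.
    by move/eqP: E'; rewrite E => E'; exfalso; move: E'; ords.
  by apply: restL AN; rewrite inE iN.
- move=> i eV iP /and3P[/= VN _ AN].
  have iN : i \in sigV N by move: VN; rewrite sub1set.
  split; first by rewrite eV.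
    (* Here m is i + 1 or i - 1. P_m brings L_{i+1} or L_{i-2} into [rest], and with V_i this
       condition gives P_m back for N. *)
    apply/subsetP => m mP; have iT : i \in tr m by apply: (VP_tr (M := M)) => //; rewrite eV set11.
    have mi : m != i by apply: contraTneq mP => ->.
    have /andP[mL pmL] := sigPL rM mP.
    have inN a : a \in sigL M -> a != i -> a != pred i -> Lb a N.
      move=> aL ai api; have := subsetP AN a; rewrite !inE negb_or ai api /=.
      by move: aL; rewrite inE => -> /(_ isT).
    have VN' : Vb i N by move: iN; rewrite inE.
    have [E|ms] := eqVneq m (succ i).
      rewrite inE E; apply: (VLb_Pbs n4 tp rN VN'); rewrite -E; apply: inN => //.
      by rewrite E; ords.
    have E : m = pred i by apply/eqP; move: iT mi ms; ords.
    rewrite inE E; apply: (VLb_Pbp n4 tp rN VN'); rewrite -E; apply: inN => //; rewrite E; ords.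
  by apply: restL AN; rewrite inE iN.
- move=> V0 P2 /and3P[/= _ PN _]; apply: same.
  have /card_gt1P[i [j [iP jP ij]]] := P2.
  have [K [rK HK]] := onept0II n4 tp (PP_disjoint rM V0 iP jP ij).
  have := subsetP PN _ iP; have := subsetP PN _ jP; rewrite !inE in iP jP * => jN iN.
  have /eqmxP e1 := (HK M rM).1 (conj iP jP); have /eqmxP e2 := (HK N rN).1 (conj iN jN).
  by apply/eqmxP/(eqmx_trans e1)/eqmx_sym.
- move=> i V0 eP /and3P[/= _ PN AN].
  split; [by rewrite V0 sub0set|by rewrite eP|].
  by apply: restL AN; move: PN; rewrite sub1set in_setU => ->; rewrite orbT.
move=> V0 P0 /and3P[/= _ _ AN]; split; [by rewrite V0 sub0set|by rewrite P0 sub0set|done].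
Qed.

End NormalForm.

(** * The 14 types as lists of indices and as cardinalities *)

Section Shapes.
Variables (n : nat) (Z : 'M[RR]_(n, 4)).
Hypotheses (n4 : (4 <= n)%N) (tp : totally_positive Z).

Local Notation z := (zpt Z).
Local Notation succ := (@Defs.succ n).
Local Notation pred := (@Defs.pred n).
Local Notation Vb := (Vb Z).
Local Notation Pb := (Pb Z).
Local Notation Lb := (Lb Z).
Local Notation G := (G Z).
Local Notation ok := (@ok n).

Definition shape t (d : data n) : Prop :=
  match t with
  | T3_I => exists i, d = (set0, set0, [set i])
  | T2_I => exists i, d = ([set i], set0, set0)
  | T2_II => exists i, d = (set0, [set i], set0)
  | T2_III => exists i j, [disjoint pr i & pr j] /\ d = (set0, set0, [set i; j])
  | T1_I => exists i, d = ([set i], [set i], set0)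
  | T1_II => exists i j, i \notin pr j /\ d = ([set i], set0, [set j])
  | T1_III => exists i j, [disjoint tr i & pr j] /\ d = (set0, [set i], [set j])
  | T1_IV => exists i j k,
      [/\ [disjoint pr i & pr j], [disjoint pr i & pr k] & [disjoint pr j & pr k]] /\
      d = (set0, set0, [set i; j; k])
  | T0_I => exists i j, i != j /\ d = ([set i; j], set0, set0)
  | T0_II => exists i j, [disjoint tr i & tr j] /\ d = (set0, [set i; j], set0)
  | T0_III => exists i j, [disjoint tr i & pr j] /\ d = ([set i], [set i], [set j])
  | T0_IV => exists i j k,
      [/\ [disjoint pr j & pr k], i \notin pr j & i \notin pr k] /\ d = ([set i], set0, [set j; k])
  | T0_V => exists i j k,
      [/\ [disjoint pr j & tr i], [disjoint pr k & tr i] & [disjoint pr j & pr k]] /\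
      d = (set0, [set i], [set j; k])
  | T0_VI => exists i j k l, adm4 i j k l /\ d = (set0, set0, [set i; j; k; l])
  end.

Lemma pr_neq (i j : 'I_n) : [disjoint pr i & pr j] -> i != j.
Proof. by ords. Qed.

Lemma tr_neq (i j : 'I_n) : [disjoint tr i & tr j] -> i != j.
Proof. by move=> D; apply: contraTneq (D) => ->; rewrite disjoint_tr !inE !eqxx !orbT. Qed.

Lemma indep_pr (A : {set 'I_n}) : (forall a, a \in A -> succ a \notin A) ->
  forall a b, a \in A -> b \in A -> a != b -> [disjoint pr a & pr b].
Proof.
move=> H a b aA bA ab.
have h1 : succ a != b by apply: contraTneq bA => <-; apply: H.
have h2 : succ b != a by apply: contraTneq aA => <-; apply: H.
by move: ab h1 h2; ords.
Qed.

Lemma pr_indep (A : {set 'I_n}) :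
  (forall a b, a \in A -> b \in A -> a != b -> [disjoint pr a & pr b]) ->
  forall a, a \in A -> succ a \notin A.
Proof.
move=> H a aA; apply/negP => sA.
have ab : a != succ a by ords.
by have := H _ _ aA sA ab; rewrite disjoint_pr !inE eqxx ?orbT /= andbF.
Qed.

Lemma card_cons (A : {set 'I_n}) k : #|A| = k.+1 -> exists i A', A = i |: A' /\ i \notin A' /\ #|A'| = k.
Proof.
move=> c; have /card_gt0P[i iA] : (0 < #|A|)%N by rewrite c.
exists i, (A :\ i); rewrite setD1K // !inE eqxx; split=> //; split=> //.
by have := cardsD1 i A; rewrite iA c => -[].
Qed.

Lemma cards_seq (s : seq 'I_n) : uniq s -> #|[set x in s]| = size s.
Proof. by move=> u; rewrite cardsE (card_uniqP u). Qed.

Lemma set3_seq (i j k : 'I_n) : [set i; j; k] = [set x in [:: i; j; k]].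
Proof. by apply/setP => x; rewrite !inE orbA. Qed.

Lemma set4_seq (i j k l : 'I_n) : [set i; j; k; l] = [set x in [:: i; j; k; l]].
Proof. by apply/setP => x; rewrite !inE !orbA. Qed.

(** The lists of indices match [has_type]; the cardinalities serve the classification and the
    counting. *)
Lemma okP t d : ok t d <-> shape t d.
Proof.
split.
  case: d => [[V P] A] /andP[/admP[h1 h2 h3 h4 h5] /eqP]; case: t => /= -[].
  - move=> /eqP/[!cards_eq0]/eqP-> /eqP/[!cards_eq0]/eqP-> /eqP/cards1P[i ->].
    by exists i.
  - by move=> /eqP/cards1P[i ->] /eqP/[!cards_eq0]/eqP-> /eqP/[!cards_eq0]/eqP->; exists i.
  - by move=> /eqP/[!cards_eq0]/eqP-> /eqP/cards1P[i ->] /eqP/[!cards_eq0]/eqP->; exists i.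
  - move=> /eqP/[!cards_eq0]/eqP-> /eqP/[!cards_eq0]/eqP-> /eqP/cards2P[i [j [ij eA]]].
    exists i, j; split; last by rewrite eA.
    by apply: (indep_pr h1) => //; rewrite eA !inE eqxx ?orbT.
  - move=> /eqP/cards1P[i eV] /eqP/cards1P[j eP] /eqP/[!cards_eq0]/eqP->; exists i; rewrite eV eP.
    by have -> : i = j by apply: h5; rewrite ?eV ?eP set11.
  - move=> /eqP/cards1P[i eV] /eqP/[!cards_eq0]/eqP-> /eqP/cards1P[j eA]; exists i, j; rewrite eV eA.
    by split=> //; apply: h2; rewrite ?eV ?eA set11.
  - move=> /eqP/[!cards_eq0]/eqP-> /eqP/cards1P[i eP] /eqP/cards1P[j eA]; exists i, j; rewrite eP eA.
    by split=> //; apply: h3; rewrite ?eP ?eA set11.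
  - move=> /eqP/[!cards_eq0]/eqP-> /eqP/[!cards_eq0]/eqP-> /card_cons[i [A' [eA [iA' /eqP/cards2P[j [k [jk eA']]]]]]].
    have eA3 : A = [set i; j; k] by rewrite eA eA' setUA.
    move: iA'; rewrite eA' !inE negb_or => /andP[ij ik].
    exists i, j, k; split; last by rewrite eA3.
    by split; apply: (indep_pr h1) => //; rewrite eA3 !inE eqxx ?orbT.
  - by move=> /eqP/cards2P[i [j [ij ->]]] /eqP/[!cards_eq0]/eqP-> /eqP/[!cards_eq0]/eqP->; exists i, j.
  - move=> /eqP/[!cards_eq0]/eqP-> /eqP/cards2P[i [j [ij eP]]] /eqP/[!cards_eq0]/eqP->.
    exists i, j; rewrite eP; split=> //.
    by apply: h4; rewrite ?eP ?inE ?eqxx ?orbT.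
  - move=> /eqP/cards1P[i eV] /eqP/cards1P[i' eP] /eqP/cards1P[j eA]; exists i, j; rewrite eV eP eA.
    have E : i = i' by apply: h5; rewrite ?eV ?eP set11.
    by rewrite -E; split=> //; apply: h3; rewrite ?eP ?eA ?E set11.
  - move=> /eqP/cards1P[i eV] /eqP/[!cards_eq0]/eqP-> /eqP/cards2P[j [k [jk eA]]].
    exists i, j, k; rewrite eV eA; split=> //; split.
    + by apply: (indep_pr h1) => //; rewrite eA !inE eqxx ?orbT.
    + by apply: h2; rewrite ?eV ?eA !inE eqxx ?orbT.
    + by apply: h2; rewrite ?eV ?eA !inE eqxx ?orbT.
  - move=> /eqP/[!cards_eq0]/eqP-> /eqP/cards1P[i eP] /eqP/cards2P[j [k [jk eA]]].
    exists i, j, k; rewrite eP eA; split=> //; split.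
    + by rewrite disjoint_sym; apply: h3; rewrite ?eP ?eA !inE eqxx ?orbT.
    + by rewrite disjoint_sym; apply: h3; rewrite ?eP ?eA !inE eqxx ?orbT.
    + by apply: (indep_pr h1) => //; rewrite eA !inE eqxx ?orbT.
  - move=> /eqP/[!cards_eq0]/eqP-> /eqP/[!cards_eq0]/eqP->.
    move=> /card_cons[i [A' [eA [iA' /card_cons[j [A'' [eA' [jA'' /eqP/cards2P[k [l [kl eA'']]]]]]]]]]].
    have eA4 : A = [set i; j; k; l] by rewrite eA eA' eA'' !setUA.
    move: iA'; rewrite eA' eA'' !inE !negb_or => /andP[ij /andP[ik il]].
    move: jA''; rewrite eA'' !inE negb_or => /andP[jk jl].
    exists i, j, k, l; split; last by rewrite eA4.
    by do 5 (split; first by apply: (indep_pr h1) => //; rewrite eA4 !inE eqxx ?orbT);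
      apply: (indep_pr h1) => //; rewrite eA4 !inE eqxx ?orbT.
case: t => /=.
- move=> [i ->]; rewrite /ok /= !cards0 cards1 eqxx andbT; apply/admP.
  split; try by move=> ? ?; rewrite !inE.
  by apply: pr_indep => a b; rewrite !inE => /eqP -> /eqP ->; rewrite eqxx.
- move=> [i ->]; rewrite /ok /= !cards0 cards1 eqxx andbT; apply/admP.
  by split=> [a|j a _|j a|j k|j k _]; rewrite ?inE.
- move=> [i ->]; rewrite /ok /= !cards0 cards1 eqxx andbT; apply/admP.
  by split=> [a|j a|j a _|j k|j k]; rewrite ?inE // => /eqP -> /eqP ->; rewrite eqxx.
- move=> [i [j [D ->]]]; rewrite /ok /= !cards0 cards2 (pr_neq D) eqxx andbT; apply/admP.
  split; try by move=> ? ?; rewrite !inE.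
  by apply: pr_indep => a b; rewrite !inE => /orP[] /eqP -> /orP[] /eqP ->; rewrite ?eqxx // disjoint_sym.
- move=> [i ->]; rewrite /ok /= !cards0 cards1 eqxx andbT; apply/admP.
  by split=> [a|j a _|j a _|j k|j k]; rewrite ?inE // => /eqP -> /eqP ->; rewrite ?eqxx.
- move=> [i [j [D ->]]]; rewrite /ok /= !cards0 !cards1 eqxx andbT; apply/admP.
  split; try by move=> ? ?; rewrite !inE.
    by apply: pr_indep => a b; rewrite !inE => /eqP -> /eqP ->; rewrite eqxx.
  by move=> a b; rewrite !in_set1 => /eqP -> /eqP ->.
- move=> [i [j [D ->]]]; rewrite /ok /= !cards0 !cards1 eqxx andbT; apply/admP.
  split; try by move=> ? ?; rewrite !inE.
  + by apply: pr_indep => a b; rewrite !inE => /eqP -> /eqP ->; rewrite eqxx.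
  + by move=> a b; rewrite !in_set1 => /eqP -> /eqP ->.
  + by move=> a b; rewrite !in_set1 => /eqP -> /eqP ->; rewrite eqxx.
- move=> [i [j [k [[d1 d2 d3] ->]]]].
  rewrite /ok /= !cards0 set3_seq cards_seq ?eqxx ?andbT; last first.
    by rewrite /= !inE negb_or !pr_neq.
  rewrite -set3_seq; apply/admP; split; try by move=> ? ?; rewrite !inE.
  apply: pr_indep => a b; rewrite !inE -!orbA => /or3P[] /eqP -> /or3P[] /eqP ->; rewrite ?eqxx //.
  + by rewrite disjoint_sym.
  + by rewrite disjoint_sym.
  + by rewrite disjoint_sym.
- move=> [i [j [D ->]]]; rewrite /ok /= !cards0 cards2 D eqxx andbT; apply/admP.
  by split=> [a|i' a _|i' a|i' j'|i' j' _]; rewrite inE.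
- move=> [i [j [D ->]]]; rewrite /ok /= !cards0 cards2 (tr_neq D) eqxx andbT; apply/admP.
  split; try by move=> ? ?; rewrite !inE.
  by move=> a b; rewrite !inE => /orP[] /eqP -> /orP[] /eqP ->; rewrite ?eqxx // disjoint_sym.
- move=> [i [j [D ->]]]; rewrite /ok /= !cards1 eqxx andbT; apply/admP.
  split.
  + by apply: pr_indep => a b; rewrite !inE => /eqP -> /eqP ->; rewrite eqxx.
  + by move=> a b; rewrite !in_set1 => /eqP -> /eqP ->; apply: trpr_notin.
  + by move=> a b; rewrite !in_set1 => /eqP -> /eqP ->.
  + by move=> a b; rewrite !in_set1 => /eqP -> /eqP ->; rewrite eqxx.
  + by move=> a b; rewrite !in_set1 => /eqP -> /eqP ->.
- move=> [i [j [k [[D d1 d2] ->]]]]; rewrite /ok /= !cards0 cards1 cards2 (pr_neq D) eqxx andbT; apply/admP.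
  split; try by move=> ? ?; rewrite !inE.
    by apply: pr_indep => a b; rewrite !inE => /orP[] /eqP -> /orP[] /eqP ->; rewrite ?eqxx // disjoint_sym.
  by move=> a b; rewrite in_set1 in_set2 => /eqP -> /orP[] /eqP ->.
- move=> [i [j [k [[d1 d2 D] ->]]]]; rewrite /ok /= !cards0 cards1 cards2 (pr_neq D) eqxx andbT; apply/admP.
  split; try by move=> ? ?; rewrite !inE.
  + by apply: pr_indep => a b; rewrite !inE => /orP[] /eqP -> /orP[] /eqP ->; rewrite ?eqxx // disjoint_sym.
  + by move=> a b; rewrite in_set1 in_set2 => /eqP -> /orP[] /eqP ->; rewrite disjoint_sym.
  + by move=> a b; rewrite !in_set1 => /eqP -> /eqP ->; rewrite eqxx.
move=> [i [j [k [l [[d1 [d2 [d3 [d4 [d5 d6]]]]] ->]]]]].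
rewrite /ok /= !cards0 set4_seq cards_seq ?eqxx ?andbT; last first.
  by rewrite /= !inE !negb_or !pr_neq.
rewrite -set4_seq; apply/admP; split; try by move=> ? ?; rewrite !inE.
apply: pr_indep => a b; rewrite !inE -!orbA => /or4P[] /eqP -> /or4P[] /eqP ->; rewrite ?eqxx //;
  by rewrite disjoint_sym.
Qed.

End Shapes.

(** * From index sets to typed sets of lines *)

Section StratumTypes.
Variables (n : nat) (Z : 'M[RR]_(n, 4)).
Hypotheses (n4 : (4 <= n)%N) (tp : totally_positive Z).

Local Notation z := (zpt Z).
Local Notation succ := (@Defs.succ n).
Local Notation pred := (@Defs.pred n).
Local Notation Vb := (Vb Z).
Local Notation Pb := (Pb Z).
Local Notation Lb := (Lb Z).
Local Notation G := (G Z).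
Local Notation ok := (@ok n).

Lemma G_split d M : G d M <-> rank2 M /\
  [/\ forall i, i \in d.1.1 -> Vb i M, forall i, i \in d.1.2 -> Pb i M & forall a, a \in d.2 -> Lb a M].
Proof.
split=> -[rM H]; split=> //.
  case/and3P: H => /subsetP h1 /subsetP h2 /subsetP h3.
  by split=> i; [move/h1|move/h2|move/h3]; rewrite inE.
case: H => h1 h2 h3; apply/and3P; split; apply/subsetP => i; rewrite inE; [exact: h1|exact: h2|exact: h3].
Qed.

Lemma VLset_Pb i M : Vset Z i M -> (Lset Z (pred i) (succ i) M <-> Pb i M).
Proof.
move=> [rM Vi]; have ps : pred i != succ i by ords.
have [d Hd] := ex4 n4 (pred i) i (succ i).
have ind : ind4 (z (pred i)) (z i) (z (succ i)) (z d) by apply: zpt_ind => //; move: Hd; ords.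
split=> [/(Lset_SL n4 tp ps)[_ m]|P]; first exact/(pencil_meets ind rM Vi).
by apply/(Lset_SL n4 tp ps); split=> //; apply/(pencil_meets ind rM Vi).
Qed.

Lemma G3I i : seteq (Lnext Z i) (G (set0, set0, [set i])).
Proof.
move=> M; rewrite LnextP // G_split; split=> -[rM H]; split=> //.
  by split=> j; rewrite !inE // => /eqP ->.
by case: H => _ _; apply; rewrite set11.
Qed.

Lemma G2I i : seteq (Vset Z i) (G ([set i], set0, set0)).
Proof.
move=> M; rewrite G_split; split=> -[rM H]; split=> //.
  by split=> j; rewrite !inE // => /eqP ->.
by case: H => + _ _; apply; rewrite set11.
Qed.

Lemma G2II i : seteq (Pset Z i) (G (set0, [set i], set0)).
Proof.
move=> M; rewrite G_split; split=> -[rM H]; split=> //.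
  by split=> j; rewrite !inE // => /eqP ->.
by case: H => _ + _; apply; rewrite set11.
Qed.

Lemma seteq_inter X X' Y Y' : seteq X X' -> seteq Y Y' ->
  seteq (Defs.inter X Y) (Defs.inter X' Y').
Proof. by move=> hX hY M; rewrite /Defs.inter hX hY. Qed.

Lemma G_inter V P A V' P' A' : seteq (Defs.inter (G (V, P, A)) (G (V', P', A')))
  (G (V :|: V', P :|: P', A :|: A')).
Proof.
move=> M; rewrite /Defs.inter /G /= !subUset; split.
  by move=> [[rM /and3P[-> -> ->]] [_ /and3P[-> -> ->]]].
by move=> [rM /and3P[/andP[-> ->] /andP[-> ->] /andP[-> ->]]].
Qed.

Lemma seteq_trans X Y W : seteq X Y -> seteq Y W -> seteq X W.
Proof. by move=> h1 h2 M; rewrite h1. Qed.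

Lemma seteq_sym X Y : seteq X Y -> seteq Y X.
Proof. by move=> h1 M; rewrite h1. Qed.

Lemma G2III i j : seteq (Defs.inter (Lnext Z i) (Lnext Z j)) (G (set0, set0, [set i; j])).
Proof.
apply: seteq_trans (seteq_inter (G3I i) (G3I j)) _.
by apply: seteq_trans (G_inter _ _ _ _ _ _) _; rewrite !setU0.
Qed.

Lemma G1I i : seteq (Defs.inter (Vset Z i) (Lset Z (pred i) (succ i))) (G ([set i], [set i], set0)).
Proof.
apply: (@seteq_trans _ (Defs.inter (Vset Z i) (Pset Z i))).
  by move=> M; split=> -[V]; [move/(VLset_Pb V)|move=> [_ /(VLset_Pb V)]] => P; split=> //; split=> //; case: V.
apply: seteq_trans (seteq_inter (G2I i) (G2II i)) _.
by apply: seteq_trans (G_inter _ _ _ _ _ _) _; rewrite !setU0 !set0U.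
Qed.

Lemma G1II i j : seteq (Defs.inter (Vset Z i) (Lnext Z j)) (G ([set i], set0, [set j])).
Proof.
apply: seteq_trans (seteq_inter (G2I i) (G3I j)) _.
by apply: seteq_trans (G_inter _ _ _ _ _ _) _; rewrite !setU0 !set0U.
Qed.

Lemma G1III i j : seteq (Defs.inter (Pset Z i) (Lnext Z j)) (G (set0, [set i], [set j])).
Proof.
apply: seteq_trans (seteq_inter (G2II i) (G3I j)) _.
by apply: seteq_trans (G_inter _ _ _ _ _ _) _; rewrite !setU0 !set0U.
Qed.

Lemma G1IV i j k : seteq (Defs.inter (Lnext Z i) (Defs.inter (Lnext Z j) (Lnext Z k)))
  (G (set0, set0, [set i; j; k])).
Proof.
apply: seteq_trans (seteq_inter (G3I i) (G2III j k)) _.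
by apply: seteq_trans (G_inter _ _ _ _ _ _) _; rewrite !setU0 setUA.
Qed.

Lemma G0I i j : seteq (Defs.inter (Vset Z i) (Vset Z j)) (G ([set i; j], set0, set0)).
Proof.
apply: seteq_trans (seteq_inter (G2I i) (G2I j)) _.
by apply: seteq_trans (G_inter _ _ _ _ _ _) _; rewrite !setU0.
Qed.

Lemma G0II i j : seteq (Defs.inter (Pset Z i) (Pset Z j)) (G (set0, [set i; j], set0)).
Proof.
apply: seteq_trans (seteq_inter (G2II i) (G2II j)) _.
by apply: seteq_trans (G_inter _ _ _ _ _ _) _; rewrite !setU0.
Qed.

Lemma G0III i j : seteq (Defs.inter (Vset Z i) (Defs.inter (Lset Z (pred i) (succ i)) (Lnext Z j)))
  (G ([set i], [set i], [set j])).
Proof.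
apply: (@seteq_trans _ (Defs.inter (Defs.inter (Vset Z i) (Lset Z (pred i) (succ i))) (Lnext Z j))).
  by move=> M; rewrite /Defs.inter; tauto.
apply: seteq_trans (seteq_inter (G1I i) (G3I j)) _.
by apply: seteq_trans (G_inter _ _ _ _ _ _) _; rewrite !setU0 !set0U.
Qed.

Lemma G0IV i j k : seteq (Defs.inter (Vset Z i) (Defs.inter (Lnext Z j) (Lnext Z k)))
  (G ([set i], set0, [set j; k])).
Proof.
apply: seteq_trans (seteq_inter (G2I i) (G2III j k)) _.
by apply: seteq_trans (G_inter _ _ _ _ _ _) _; rewrite !setU0 !set0U.
Qed.

Lemma G0V i j k : seteq (Defs.inter (Pset Z i) (Defs.inter (Lnext Z j) (Lnext Z k)))
  (G (set0, [set i], [set j; k])).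
Proof.
apply: seteq_trans (seteq_inter (G2II i) (G2III j k)) _.
by apply: seteq_trans (G_inter _ _ _ _ _ _) _; rewrite !setU0 !set0U.
Qed.

Lemma G0VI i j k l : seteq (L4 Z i j k l) (G (set0, set0, [set i; j; k; l])).
Proof.
apply: seteq_trans (seteq_inter (G3I i) (G1IV j k l)) _.
by apply: seteq_trans (G_inter _ _ _ _ _ _) _; rewrite !setU0 !setUA.
Qed.

(** Type (0,VI) is excluded because there a stratum is only one of the two points of G d. *)
Lemma has_typeP t X : t <> T0_VI -> (has_type Z t X <-> exists d, ok t d /\ seteq X (G d)).
Proof.
move=> tVI; suff: has_type Z t X <-> exists d, shape t d /\ seteq X (G d).
  by move=> ->; split=> -[d [H1 H2]]; exists d; split=> //; exact/(okP n4).
have to S d : shape t d -> seteq S (G d) -> seteq X S -> exists d, shape t d /\ seteq X (G d).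
  by move=> sh e h; exists d; split=> //; apply: seteq_trans h e.
have fro S d : seteq S (G d) -> seteq X (G d) -> seteq X S.
  by move=> e h; apply: seteq_trans h (seteq_sym e).
case: t tVI to => //= _ to; split.
- by move=> [i H]; apply: to (G3I i) H; exists i.
- by move=> [d [[i ->] H]]; exists i; apply: fro (G3I i) H.
- by move=> [i H]; apply: to (G2I i) H; exists i.
- by move=> [d [[i ->] H]]; exists i; apply: fro (G2I i) H.
- by move=> [i H]; apply: to (G2II i) H; exists i.
- by move=> [d [[i ->] H]]; exists i; apply: fro (G2II i) H.
- by move=> [i [j [D H]]]; apply: to (G2III i j) H; exists i, j.
- by move=> [d [[i [j [D ->]]] H]]; exists i, j; split=> //; apply: fro (G2III i j) H.
- by move=> [i H]; apply: to (G1I i) H; exists i.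
- by move=> [d [[i ->] H]]; exists i; apply: fro (G1I i) H.
- by move=> [i [j [D H]]]; apply: to (G1II i j) H; exists i, j.
- by move=> [d [[i [j [D ->]]] H]]; exists i, j; split=> //; apply: fro (G1II i j) H.
- by move=> [i [j [D H]]]; apply: to (G1III i j) H; exists i, j.
- by move=> [d [[i [j [D ->]]] H]]; exists i, j; split=> //; apply: fro (G1III i j) H.
- by move=> [i [j [k [D H]]]]; apply: to (G1IV i j k) H; exists i, j, k.
- by move=> [d [[i [j [k [D ->]]]] H]]; exists i, j, k; split=> //; apply: fro (G1IV i j k) H.
- by move=> [i [j [D H]]]; apply: to (G0I i j) H; exists i, j.
- by move=> [d [[i [j [D ->]]] H]]; exists i, j; split=> //; apply: fro (G0I i j) H.
- by move=> [i [j [D H]]]; apply: to (G0II i j) H; exists i, j.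
- by move=> [d [[i [j [D ->]]] H]]; exists i, j; split=> //; apply: fro (G0II i j) H.
- by move=> [i [j [D H]]]; apply: to (G0III i j) H; exists i, j.
- by move=> [d [[i [j [D ->]]] H]]; exists i, j; split=> //; apply: fro (G0III i j) H.
- by move=> [i [j [k [D H]]]]; apply: to (G0IV i j k) H; exists i, j, k.
- by move=> [d [[i [j [k [D ->]]]] H]]; exists i, j, k; split=> //; apply: fro (G0IV i j k) H.
- by move=> [i [j [k [D H]]]]; apply: to (G0V i j k) H; exists i, j, k.
- by move=> [d [[i [j [k [D ->]]]] H]]; exists i, j, k; split=> //; apply: fro (G0V i j k) H.
Qed.

Lemma irrdim_ok t d : t <> T0_VI -> ok t d -> irrdim (G d) (tdim t).
Proof.
move=> tVI /(okP n4); case: t tVI => tVI; last by case: tVI.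
- by move=> [i ->]; apply: (irr3I n4 tp (i := i)) => M; rewrite -G3I LnextP.
- by move=> [i ->]; apply: (irr2I n4 tp (i := i)) => M; rewrite -G2I.
- by move=> [i ->]; apply: (irr2II n4 tp (i := i)) => M; rewrite -G2II.
- move=> [i [j [D ->]]]; apply: (irr2III n4 tp D) => M; rewrite -G2III /Defs.inter !LnextP //; tauto.
- move=> [i ->]; apply: (irr1I n4 tp (i := i)) => M; rewrite G_split /=.
  split=> -[rM]; [case=> h1 h2 _|case=> h1 h2]; split=> //; split=> //.
  + by apply: h1; rewrite set11.
  + by apply: h2; rewrite set11.
  + by move=> j; rewrite inE => /eqP ->.
  + by move=> j; rewrite inE => /eqP ->.
  by move=> a; rewrite inE.
- move=> [i [j [D ->]]]; apply: (irr1II n4 tp D) => M; rewrite -G1II /Defs.inter LnextP // /Vset /Vb; tauto.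
- move=> [i [j [D ->]]]; apply: (irr1III n4 tp D) => M; rewrite -G1III /Defs.inter LnextP // /Pset /Pb; tauto.
- move=> [i [j [k [[d1 d2 d3] ->]]]]; apply: (irr1IV n4 tp d1 d2 d3) => M; rewrite -G1IV /Defs.inter !LnextP //.
  by split=> [[[? ?] [[? ?] [? ?]]]|[? [? ? ?]]].
- move=> [i [j [D ->]]]; apply: (onept_irr (onept0I n4 tp D)) => M; rewrite -G0I /Defs.inter /Vset /Vb; tauto.
- move=> [i [j [D ->]]]; apply: (onept_irr (onept0II n4 tp D)) => M; rewrite -G0II /Defs.inter /Pset /Pb; tauto.
- move=> [i [j [D ->]]]; apply: (onept_irr (onept0III n4 tp D)) => M; rewrite G_split /=.
  split=> -[rM []] h1 h2 h3; split=> //; split; try by move=> a; rewrite inE => /eqP ->.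
  + by apply: h1; rewrite set11.
  + by apply: h2; rewrite set11.
  + by apply: h3; rewrite set11.
- move=> [i [j [k [[d1 d2 d3] ->]]]]; apply: (onept_irr (onept0IV n4 tp d1 d2 d3)) => M.
  rewrite -G0IV /Defs.inter !LnextP // /Vset /Vb.
  by split=> [[[? ?] [[? ?] [? ?]]]|[? [? ? ?]]].
move=> [i [j [k [[d1 d2 d3] ->]]]].
rewrite disjoint_sym in d1; rewrite disjoint_sym in d2.
apply: (onept_irr (onept0V n4 tp d1 d2 d3)) => M.
rewrite -G0V /Defs.inter !LnextP // /Pset /Pb.
by split=> [[[? ?] [[? ?] [? ?]]]|[? [? ? ?]]].
Qed.

Lemma enum4_sorted (A : {set 'I_n}) : #|A| = 4%N ->
  exists i j k l : 'I_n, [/\ (i < j)%N, (j < k)%N, (k < l)%N & A = [set i; j; k; l]].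
Proof.
move=> c; have : sorted ltn (map val (enum A)).
  have h : sorted ltn (map val (enum 'I_n)) by rewrite val_enum_ord iota_ltn_sorted.
  move: h; rewrite sorted_map => h; rewrite sorted_map.
  rewrite (_ : enum A = filter (mem A) (enum 'I_n)); last by rewrite enumT.
  by apply: sorted_filter h; move=> x y w; apply: ltn_trans.
have eA : A = [set x in enum A] by apply/setP => x; rewrite inE mem_enum.
move: c; rewrite cardE; case: (enum A) eA => [|i [|j [|k [|l []]]]] // eA _ /= /and4P[ij jk kl _].
by exists i, j, k, l; split=> //; rewrite eA; apply/setP => x; rewrite !inE !orbA.
Qed.

(** Sorting the indices puts the pairs in the order that positivity requires; independence gives the
    gaps, including the one across the wrap-around. *)
Lemma two_points_ok d : ok T0_VI d ->
  exists M1 M2 : M24, [/\ rank2 M1, rank2 M2, ~~ (M1 == M2)%MS &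
    seteq (G d) (fun M => rank2 M /\ ((M == M1)%MS \/ (M == M2)%MS))].
Proof.
case: d => [[V P] A] /andP[/admP[h1 _ _ _ _] /eqP[/eqP + /eqP]].
rewrite !cards_eq0 => /eqP -> /eqP -> /enum4_sorted[i [j [k [l [ij jk kl eA]]]]].
have [iA jA kA lA] : [/\ i \in A, j \in A, k \in A & l \in A].
  by rewrite eA !inE !eqxx ?orbT.
have h a b : a \in A -> b \in A -> succ a != b.
  by move=> aA bA; apply: contraTneq bA => <-; apply: h1.
have ij' : (i.+1 < j)%N by move: (h i j iA jA) ij; ords.
have jk' : (j.+1 < k)%N by move: (h j k jA kA) jk; ords.
have kl' : (k.+1 < l)%N by move: (h k l kA lA) kl; ords.
have li : (l.+1 < i + n)%N by move: (h l i lA iA) ij jk kl; ords.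
have [M1 [M2 [r1 r2 n12 H]]] := two_points_sorted n4 tp ij' jk' kl' li.
exists M1, M2; split=> // M; rewrite eA -G0VI /L4 /Defs.inter !LnextP //.
split=> [[[rM Li] [[_ Lj] [[_ Lk] [_ Ll]]]]|[rM /(H M rM)[]]] //.
by split=> //; apply/(H M rM).
Qed.

End StratumTypes.

(** * Dimension *)

Lemma chain0 X : irreducible X -> has_chain X 0.
Proof. by move=> irr; exists (fun=> X); split=> [k _|k]; [split=> // M | rewrite ltn0]. Qed.

Lemma chainS X Y k : irreducible X -> subset Y X -> ~ subset X Y -> has_chain Y k -> has_chain X k.+1.
Proof.
move=> irr YX XY [f [f1 f2]]; exists (fun m => if (m <= k)%N then f m else X); split=> [m lemk|m ltmk].
  case: leqP => [lem|_]; last by split=> // N.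
  by have [fi fY] := f1 m lem; split=> // N /fY/YX.
rewrite -ltnS ltmk; case: ltnP => [lt|ge]; first exact: f2.
have mk : m = k by apply/eqP; rewrite eqn_leq -ltnS ltmk ge.
have [_ fY] := f1 k (leqnn k); rewrite mk; split=> [N /fY/YX //|sub].
by apply: XY => N /sub/fY.
Qed.

Lemma chain_le X d d' : (d' <= d)%N -> has_chain X d -> has_chain X d'.
Proof.
move=> le [f [f1 f2]]; exists f; split=> k lek; [apply: f1|apply: f2]; exact: leq_trans le.
Qed.

Lemma has_dim_uniq X d d' : has_dim X d -> has_dim X d' -> d = d'.
Proof.
move=> [c n] [c' n']; have [lt|lt|//] := ltngtP d d'.
  by case: n; apply: chain_le c'.
by case: n'; apply: chain_le c.
Qed.

Lemma has_chain_ext X Y d : seteq X Y -> has_chain X d -> has_chain Y d.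
Proof.
move=> XY [f [f1 f2]]; exists f; split=> // k lek.
by have [fi fX] := f1 k lek; split=> // N /fX/XY.
Qed.

Lemma has_dim_ext X Y d : seteq X Y -> has_dim X d -> has_dim Y d.
Proof.
move=> XY [c nc]; split; first exact: has_chain_ext c.
by move=> c'; apply: nc; apply: has_chain_ext c' => M; rewrite XY.
Qed.

Section Dimension.
Variables (n : nat) (Z : 'M[RR]_(n, 4)).
Hypotheses (n4 : (4 <= n)%N) (tp : totally_positive Z).

Local Notation z := (zpt Z).
Local Notation succ := (@Defs.succ n).
Local Notation pred := (@Defs.pred n).
Local Notation Vb := (Vb Z).
Local Notation Pb := (Pb Z).
Local Notation Lb := (Lb Z).
Local Notation G := (G Z).
Local Notation ok := (@ok n).

Lemma flag t d t' d' k : shape t d -> t <> T0_VI -> shape t' d' -> t' <> T0_VI ->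
  subset (G d') (G d) -> (exists2 M, G d M & ~ G d' M) ->
  has_chain (G d') k -> has_chain (G d) k.+1.
Proof.
move=> sh tVI _ _ sub [M dM nM]; have [irr _] := irrdim_ok n4 tp tVI ((okP n4 t d).2 sh).
by apply: (chainS irr sub) => h; apply: nM; apply: h.
Qed.

Lemma chain_dim0 t d : tdim t = 0%N -> t <> T0_VI -> shape t d -> has_chain (G d) 0.
Proof. by move=> _ tVI /(okP n4) o; apply: chain0; have [] := irrdim_ok n4 tp tVI o. Qed.

Lemma line_ij i j : i != j -> exists N : M24, [/\ rank2 N, Vb i N & Vb j N].
Proof.
move=> ij; have [N [rN /(_ N rN) HN]] := onept0I n4 tp ij.
by exists N; have [] := HN.2 (introT eqmxP (eqmx_refl _)).
Qed.

Lemma G0IP i j M : G ([set i; j], set0, set0) M <-> [/\ rank2 M, Vb i M & Vb j M].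
Proof. by rewrite -G0I /Defs.inter /Vset; split=> [[[? ?] [? ?]]|[? ? ?]]. Qed.

Lemma G1 i M : G ([set i], set0, set0) M <-> rank2 M /\ Vb i M.
Proof. by rewrite -G2I. Qed.

(** The smaller member is the line Z_i Z_{i+1}; the line Z_{i-1} Z_i shows that the inclusion is
    strict. *)
Lemma chain1I i : has_chain (G ([set i], [set i], set0)) 1.
Proof.
have si : i != succ i by ords.
apply: (@flag T1_I _ T0_I ([set i; succ i], set0, set0)) => //.
- by exists i.
- by exists i, (succ i).
- move=> N /G0IP[rN Vi Vs]; apply/G_split; split=> //.
  split=> j; rewrite ?inE // => /eqP -> //.
  have := VLb_Pbp n4 tp rN Vs; rewrite succK; apply.
  exact: (Vb_Lbp rN Vi).
- have pi : i != pred i by ords.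
  have [N [rN Vi Vp]] := line_ij pi; exists N.
    apply/G_split; split=> //; split=> j; rewrite ?inE // => /eqP -> //.
    have := VLb_Pbs n4 tp rN Vp; rewrite predK; apply.
    exact: (Vb_Lb rN Vi).
  move=> /G0IP[_ _ Vs]; apply: (VVVb n4 tp rN _ Vi Vp Vs); ords.
by apply: (@chain_dim0 T0_I) => //; exists i, (succ i).
Qed.

Lemma chain1II i j : i \notin pr j -> has_chain (G ([set i], set0, [set j])) 1.
Proof.
move=> nij; have ij : i != j by move: nij; ords.
apply: (@flag T1_II _ T0_I ([set i; j], set0, set0)) => //.
- by exists i, j.
- by exists i, j.
- move=> N /G0IP[rN Vi Vj]; apply/G_split; split=> //.
  split=> k; rewrite ?inE // => /eqP -> //.
  exact: (Vb_Lb rN Vj).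
- have isj : i != succ j by move: nij; ords.
  have [N [rN Vi Vp]] := line_ij isj; exists N.
    apply/G_split; split=> //; split=> k; rewrite ?inE // => /eqP -> //.
    by have := Vb_Lbp rN Vp; rewrite succK.
  move=> /G0IP[_ _ Vs]; apply: (VVVb n4 tp rN _ Vi Vp Vs).
  by move: nij; ords.
by apply: (@chain_dim0 T0_I) => //; exists i, j.
Qed.

(** In the plane of i, the line through Z_i meeting Z_j Z_{j+1} is the smaller member; the one
    through Z_{i-1} shows strictness. *)
Lemma chain1III i j : [disjoint tr i & pr j] -> has_chain (G (set0, [set i], [set j])) 1.
Proof.
move=> D.
apply: (@flag T1_III _ T0_III ([set i], [set i], [set j])) => //.
- by exists i, j.
- by exists i, j.
- move=> N /G_split[rN [_ h1 h2]]; apply/G_split; split=> //.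
  by split=> // k; rewrite inE.
- have i1 : ind4 (z i) (z (pred i)) (z (succ i)) (z j) by apply: zpt_ind => //; move: D; ords.
  have i2 : ind4 (z i) (z (pred i)) (z (succ i)) (z (succ j)) by apply: zpt_ind => //; move: D; ords.
  have i3 : ind4 (z i) (z (pred i)) (z j) (z (succ j)) by apply: zpt_ind => //; move: D; ords.
  have [N [rN /(_ N rN) HN]] := star_point i1 i2 i3.
  have [Vp PN LN] := HN.2 (introT eqmxP (eqmx_refl _)).
  have Lj : Lb j N by apply/LbP.
  exists N.
    apply/G_split; split=> //; split=> k; rewrite ?inE // => /eqP -> //.
    apply: submx_trans PN _.
    have [h1 h2 h3] := mem_plane (z (pred i)) (z i) (z (succ i)).
    by rewrite (col_mx_sub (z i)) h2 (col_mx_sub (z (pred i))) h1 h3.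
  move=> /G_split[_ [/(_ i (set11 i)) Vi _ _]].
  have pi : i != pred i by ords.
  by case: (VVLb n4 tp rN pi Vi Vp Lj); move: D; ords.
by apply: (@chain_dim0 T0_III) => //; exists i, j.
Qed.

(** The transversals of the lines of j and k through Z_i and through Z_{i+1} both meet Z_i Z_{i+1},
    and they differ. *)
Lemma chain1IV i j k : [disjoint pr i & pr j] -> [disjoint pr i & pr k] -> [disjoint pr j & pr k] ->
  has_chain (G (set0, set0, [set i; j; k])) 1.
Proof.
move=> D1 D2 D3.
have iN a b : [disjoint pr a & pr b] -> (a : 'I_n) \notin pr b /\ succ a \notin pr b.
  by rewrite disjoint_pr => /andP[].
have [nij nsij] := iN _ _ D1; have [nik nsik] := iN _ _ D2.
apply: (@flag T1_IV _ T0_IV ([set i], set0, [set j; k])) => //.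
- by exists i, j, k.
- by exists i, j, k.
- move=> N /G_split[rN [/(_ i (set11 i)) Vi _ h2]]; apply/G_split; split=> //.
  split=> l; rewrite ?inE // -orbA => /or3P[] /eqP ->; first exact: (Vb_Lb rN Vi).
    by apply: h2; rewrite !inE eqxx.
  by apply: h2; rewrite !inE eqxx orbT.
- have [N [rN /(_ N rN) HN]] := onept0IV n4 tp D3 nsij nsik.
  have [Vs Lj Lk] := HN.2 (introT eqmxP (eqmx_refl _)); exists N.
    apply/G_split; split=> //; split=> l; rewrite ?inE // -orbA => /or3P[] /eqP -> //.
    by have := Vb_Lbp rN Vs; rewrite succK.
  move=> /G_split[_ [/(_ i (set11 i)) Vi _ _]].
  have si : i != succ i by ords.
  by case: (VVLb n4 tp rN si Vi Vs Lj) => h; move: nij nsij; rewrite h.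
by apply: (@chain_dim0 T0_IV) => //; exists i, j, k.
Qed.

(** The next member is V_i L_{i+1}, which does not contain the line Z_{i-1} Z_i. *)
Lemma chain2I i : has_chain (G ([set i], set0, set0)) 2.
Proof.
have nis : i \notin pr (succ i) by ords.
apply: (@flag T2_I _ T1_II ([set i], set0, [set succ i])) => //.
- by exists i.
- by exists i, (succ i).
- move=> N /G_split[rN [/(_ i (set11 i)) Vi _ _]]; exact/G1.
- have pi : i != pred i by ords.
  have [N [rN Vi Vp]] := line_ij pi; exists N; first exact/G1.
  move=> /G_split[_ [_ _ /(_ (succ i) (set11 _)) Ls]].
  by case: (VVLb n4 tp rN pi Vi Vp Ls); ords.
exact: chain1II.
Qed.

(** The next member is V_i P_i, which does not contain the line Z_{i-1} Z_{i+1}. *)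
Lemma chain2II i : has_chain (G (set0, [set i], set0)) 2.
Proof.
apply: (@flag T2_II _ T1_I ([set i], [set i], set0)) => //.
- by exists i.
- by exists i.
- move=> N /G_split[rN [_ h _]]; apply/G_split; split=> //.
  by split=> // k; rewrite inE.
- have ps : pred i != succ i by ords.
  have [N [rN Vp Vs]] := line_ij ps; exists N.
    apply/G_split; split=> //; split=> k; rewrite ?inE // => /eqP ->.
    have := VLb_Pbs n4 tp rN Vp; rewrite predK; apply.
    by have := Vb_Lbp rN Vs; rewrite succK.
  move=> /G_split[_ [/(_ i (set11 i)) Vi _ _]]; apply: (VVVb n4 tp rN _ Vi Vp Vs); ords.
exact: chain1I.
Qed.

Lemma chain2III i j : [disjoint pr i & pr j] -> has_chain (G (set0, set0, [set i; j])) 2.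
Proof.
move=> D; have nij : i \notin pr j by move: D; rewrite disjoint_pr => /andP[].
apply: (@flag T2_III _ T1_II ([set i], set0, [set j])) => //.
- by exists i, j.
- by exists i, j.
- move=> N /G_split[rN [/(_ i (set11 i)) Vi _ /(_ j (set11 j)) Lj]]; apply/G_split; split=> //.
  by split=> k; rewrite ?inE // => /orP[] /eqP -> //; exact: (Vb_Lb rN Vi).
- have sj : succ i != j by move: D; ords.
  have [N [rN Vs Vj]] := line_ij sj; exists N.
    apply/G_split; split=> //; split=> k; rewrite ?inE // => /orP[] /eqP ->; last exact: (Vb_Lb rN Vj).
    by have := Vb_Lbp rN Vs; rewrite succK.
  move=> /G_split[_ [/(_ i (set11 i)) Vi _ _]]; apply: (VVVb n4 tp rN _ Vi Vs Vj).
  by move: D; ords.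
exact: chain1II.
Qed.

Lemma chain3I i : has_chain (G (set0, set0, [set i])) 3.
Proof.
apply: (@flag T3_I _ T2_I ([set i], set0, set0)) => //.
- by exists i.
- by exists i.
- move=> N /G1[rN Vi]; apply/G_split; split=> //.
  by split=> k; rewrite ?inE // => /eqP ->; exact: (Vb_Lb rN Vi).
- have ss : succ i != succ (succ i) by ords.
  have [N [rN Vs Vss]] := line_ij ss; exists N.
    apply/G_split; split=> //; split=> k; rewrite ?inE // => /eqP ->.
    by have := Vb_Lbp rN Vs; rewrite succK.
  move=> /G1[_ Vi]; apply: (VVVb n4 tp rN _ Vi Vs Vss); ords.
exact: chain2I.
Qed.

Lemma has_dim_ok t d : t <> T0_VI -> ok t d -> has_dim (G d) (tdim t).
Proof.
move=> tVI o; have [_ nc] := irrdim_ok n4 tp tVI o; split=> {nc} //.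
have sh := (okP n4 t d).1 o.
case: t tVI o sh => tVI o sh; try by [exact: chain_dim0 sh].
- by have [i ->] := sh; exact: chain3I.
- by have [i ->] := sh; exact: chain2I.
- by have [i ->] := sh; exact: chain2II.
- by have [i [j [D ->]]] := sh; exact: chain2III.
- by have [i ->] := sh; exact: chain1I.
- by have [i [j [D ->]]] := sh; exact: chain1II.
- by have [i [j [D ->]]] := sh; exact: chain1III.
by have [i [j [k [[D1 D2 D3] ->]]]] := sh; exact: chain1IV.
Qed.

End Dimension.

(** * Generic points *)

(** The vanishing ideal of X is prime: choosing for each [C k] an equation that does not vanish on
    X, the product does not vanish on X either. *)
Lemma irr_avoid (T : Type) (s : seq T) (C : T -> gset) X : irreducible X ->
  (forall k, zclosed (C k)) -> (forall k, List.In k s -> ~ subset X (C k)) ->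
  exists M, X M /\ forall k, List.In k s -> ~ C k M.
Proof.
move=> irr zC nsub; have Xr : forall M, X M -> rank2 M by have [[[]]] := irr.
suff [f [pf [M XM fM] fC]] : exists f, [/\ polyn f, exists2 M, X M & f M != 0 &
    forall k M, List.In k s -> C k M -> f M = 0].
  by exists M; split=> // k ks CM; move: fM; rewrite (fC k M) ?eqxx.
elim: s nsub => [_|k s IH nsub].
  have [M XM] : exists M, X M by have [_ []] := irr.
  by exists (fun=> 1); split=> //; [exact: polynC | exists M; rewrite ?oner_eq0].
have [f [pf [M XM fM] fC]] := IH (fun k' H => nsub k' (or_intror H)).
have [[gC _] [F HF]] := zC k.
have [p Fp [M' XM' pM']] : exists2 p, F p & exists2 M, X M & pval p M != 0.
  apply: boolp.contrapT => nex; apply: (nsub k (or_introl erefl)) => N XN; apply/HF; split.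
    exact: Xr.
  move=> p Fp; apply/eqP; apply: boolp.contrapT => /negP pN; apply: nex.
  by exists p => //; exists N.
have pp : polyn (pval p) by exists p.
exists (fun N => f N * pval p N); split.
- exact: polynM.
- apply: boolp.contrapT => nex.
  have [|h|h] := irr_prime irr pf pp.
  + move=> N XN; apply/eqP; apply: boolp.contrapT => /negP ne; apply: nex; by exists N.
  + by move: fM; rewrite h ?eqxx.
  by move: pM'; rewrite h ?eqxx.
move=> k' N [<-|k's] CN; last by rewrite (fC k') // mul0r.
by have [_ /(_ p Fp) pN] := (HF N).1 CN; rewrite /pval pN mulr0.
Qed.

(** * Recovering the index sets from a generic line *)

Section Recover.
Variables (n : nat) (Z : 'M[RR]_(n, 4)).
Hypotheses (n4 : (4 <= n)%N) (tp : totally_positive Z) (aG : assumptionG Z).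

Local Notation z := (zpt Z).
Local Notation succ := (@Defs.succ n).
Local Notation pred := (@Defs.pred n).
Local Notation Vb := (Vb Z).
Local Notation Pb := (Pb Z).
Local Notation Lb := (Lb Z).
Local Notation G := (G Z).
Local Notation ok := (@ok n).
Local Notation nd := (nd Z).
Local Notation sigV := (sigV Z).
Local Notation sigP := (sigP Z).
Local Notation sigL := (sigL Z).
Local Notation rest := (rest Z).

Lemma sub_seteq_pts (X : gset) M1 M2 : irreducible X ->
  subset X (fun M => rank2 M /\ ((M == M1)%MS \/ (M == M2)%MS)) ->
  subset X (Spt M1) \/ subset X (Spt M2).
Proof.
move=> [_ [_ irr]] H; apply: irr; try exact: zclosed_Spt.
by move=> M /H[rM [e|e]]; [left|right].
Qed.

Definition generic (X : gset) M := X M /\ forall N, X N ->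
  [/\ sigV M \subset sigV N, sigP M \subset sigP N & sigL M \subset sigL N].

Lemma z_neq0 i : z i != 0.
Proof.
have [c Hc] := ex4 n4 i i i; have [d Hd] := ex4 n4 i c c; have [e He] := ex4 n4 i c d.
apply: (@ind_neq0 _ (z c) (z d) (z e)); apply: zpt_ind => //.
by move: Hc Hd He; ords.
Qed.

(** [irr_avoid] is applied to those of the finitely many conditions V_i, P_i and L_i that do not
    hold on all of X. *)
Lemma generic_ex X : irreducible X -> exists M, generic X M.
Proof.
move=> irr; pose C (k : 'I_n * 'I_3) : gset := match k.2 : nat with
  | 0 => SV (z k.1) | 1 => SP (z (pred k.1)) (z k.1) (z (succ k.1))
  | _ => SL (z k.1) (z (succ k.1)) end.
have zC k : zclosed (C k).
  case: k => i [[|[|[|?]]] H] //=; rewrite /C /=.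
  - exact/zclosed_SV/z_neq0.
  - exact: zclosed_SP.
  exact: zclosed_SL.
pose s := [seq k <- enum {: 'I_n * 'I_3} | ~~ boolp.asbool (subset X (C k))].
have ins k : List.In k s <-> ~ subset X (C k).
  have -> : List.In k s <-> k \in s.
    elim: (s) => [|a l IH] //=; rewrite inE IH; split.
      by move=> [->|->]; rewrite ?eqxx ?orbT.
    by move=> /orP[/eqP ->|]; [left|right].
  rewrite mem_filter mem_enum andbT; split; first by move/negP=> h1 h2; apply: h1; apply/boolp.asboolP.
  by move=> h; apply/negP => /boolp.asboolP.
have [M [XM HM]] := irr_avoid irr zC (fun k => (ins k).1).
have Xr : forall M, X M -> rank2 M by have [[[]]] := irr.
have key k : C k M -> subset X (C k).
  by move=> CM; apply: boolp.contrapT => h; apply: (HM k) CM; apply/ins.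
have rM := Xr _ XM.
exists M; split=> // N XN; have rN := Xr _ XN.
split; apply/subsetP => i; rewrite !inE => H.
- by have [] := key (i, ord0) (conj rM H) N XN.
- have := key (i, Ordinal (isT : 1 < 3)%N); rewrite /C /= => /(_ (conj rM H) N XN).
  by case.
have := key (i, Ordinal (isT : 2 < 3)%N); rewrite /C /=.
by case/(_ (conj rM ((LbP Z i rM).1 H)) N XN) => _ m; apply/LbP.
Qed.

Lemma G_ne_sigL t d M : ok t d -> G d M -> sigL M != set0.
Proof.
case: d => [[V P] A] /andP[_ /eqP] c [rM /and3P[/= VM PM AM]].
have {}c : (0 < #|V| + #|P| + #|A|)%N by move: c; case: t => -[-> -> ->].
have [V0|[i iV]] := set_0Vmem V; last first.
  by apply/set0Pn; exists i; have /andP[] := sigVL rM (subsetP VM i iV).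
have [P0|[i iP]] := set_0Vmem P; last first.
  by apply/set0Pn; exists i; have /andP[] := sigPL rM (subsetP PM i iP).
have [A0|[i iA]] := set_0Vmem A; last first.
  by apply/set0Pn; exists i; apply: (subsetP AM).
by move: c; rewrite V0 P0 A0 !cards0.
Qed.

(** Both d and nd M consist of conditions met by M, and each implies all the conditions met by M: d
    because M is generic, nd M by [nd_min]. Type (0,VI) cannot occur for nd M, as two points are
    reducible. *)
Lemma generic_nd t d M : t <> T0_VI -> ok t d -> generic (G d) M ->
  exists t', [/\ t' <> T0_VI, ok t' (nd M), tdim t' = tdim t & seteq (G d) (G (nd M))].
Proof.
move=> tVI o [dM min]; have rM := dM.1.
have [t' o'] := classify n4 tp aG rM (G_ne_sigL o dM).
have e : seteq (G d) (G (nd M)).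
  move=> N; split=> [dN|ndN].
    have [h1 h2 h3] := min N dN; have [_ /and3P[k1 k2 k3]] := nd_mem Z rM.
    split; first by case: dN.
    by rewrite (subset_trans k1 h1) (subset_trans k2 h2) (subset_trans k3 h3).
  have [h1 h2 h3] := nd_min n4 tp rM ndN; have [_ /and3P[k1 k2 k3]] := dM.
  split; first by case: ndN.
  by rewrite (subset_trans k1 h1) (subset_trans k2 h2) (subset_trans k3 h3).
have irr : irreducible (G d) by have [] := irrdim_ok n4 tp tVI o.
have t'VI : t' <> T0_VI.
  move=> E; rewrite E in o'; have [M1 [M2 [r1 r2 /negP n12 H]]] := two_points_ok n4 tp o'.
  have d1 : G d M1 by apply/e/H; split=> //; left; apply/eqmxP.
  have d2 : G d M2 by apply/e/H; split=> //; right; apply/eqmxP.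
  have [h|h] := sub_seteq_pts irr (fun N dN => (H N).1 ((e N).1 dN)).
    by apply: n12; have [_] := h _ d2; rewrite andbC.
  by apply: n12; have [_] := h _ d1.
exists t'; split=> //.
apply: has_dim_uniq (has_dim_ok n4 tp t'VI o') _.
exact: has_dim_ext (has_dim_ok n4 tp tVI o).
Qed.

(** The cases of [nd_spec] with their sizes tied to the dimension k: each further condition L lowers
    k by one. *)
Variant nd_dim M k : data n -> Prop :=
| DimVV of #|sigV M| = 2%N & k = 0%N : nd_dim M k (sigV M, set0, set0)
| DimVP i of sigV M = [set i] & i \in sigP M & (#|rest M i| + k = 1)%N :
    nd_dim M k ([set i], [set i], rest M i)
| DimV i of sigV M = [set i] & i \notin sigP M & (#|rest M i| + k = 2)%N :
    nd_dim M k ([set i], set0, rest M i)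
| DimPP of sigV M = set0 & #|sigP M| = 2%N & k = 0%N : nd_dim M k (set0, sigP M, set0)
| DimP i of sigV M = set0 & sigP M = [set i] & (#|rest M i| + k = 2)%N :
    nd_dim M k (set0, [set i], rest M i)
| DimL of sigV M = set0 & sigP M = set0 & (#|sigL M| + k = 4)%N : nd_dim M k (set0, set0, sigL M).

Lemma nd_dimP M t : ok t (nd M) -> nd_dim M (tdim t) (nd M).
Proof.
rewrite /ok; case/andP=> _; case: ndP => [V2|i eV iP|i eV iP|V0 P2|i V0 eP|V0 P0] /eqP /=;
  rewrite ?cards0 ?cards1; case: t => // -[e].
all: try by rewrite e in V2.
all: try by rewrite e in P2.
all: by constructor; rewrite ?e.
Qed.

Section Line.
Variable M : M24.
Hypothesis rM : rank2 M.

Lemma rest_intro i a : a \in sigL M -> a != i -> a != pred i -> a \in rest M i.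
Proof. by move=> aL ai api; rewrite in_setD in_set2 negb_or api ai. Qed.

(** [rest] leaves out only L_{i-1} and L_i, whose pairs both contain i; of two disjoint pairs at
    most one is left out. *)
Lemma rest_disj i a b : [disjoint pr a & pr b] -> a \in sigL M -> b \in sigL M ->
  a \in rest M i \/ b \in rest M i.
Proof.
move=> D aL bL; have [|na] := boolP (a \in rest M i); first by left.
right; apply: rest_intro => //; apply: contraNneq na => eb; apply: rest_intro => //.
- by move: D; rewrite eb; ords.
- by move: D; rewrite eb; ords.
- by move: D; rewrite eb; ords.
by move: D; rewrite eb; ords.
Qed.

Lemma card1_eq (S : {set 'I_n}) j : #|S| = 1%N -> j \in S -> S = [set j].
Proof. by move=> c; apply: card_le1; rewrite c. Qed.

Lemma card2_eq (S : {set 'I_n}) j k : #|S| = 2%N -> j \in S -> k \in S -> j != k -> S = [set j; k].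
Proof.
move=> c jS kS jk; apply/eqP; rewrite eq_sym eqEcard cards2 jk c andbT.
by apply/subsetP => x; rewrite !inE => /orP[] /eqP ->.
Qed.

Lemma card_ge (S : {set 'I_n}) s : uniq s -> {subset s <= S} -> (size s <= #|S|)%N.
Proof. by move=> u sS; rewrite -(card_uniqP u); apply/subset_leq_card/subsetP. Qed.

Lemma other (S : {set 'I_n}) i : #|S| = 2%N -> i \in S -> exists2 v, v \in S & i != v.
Proof.
move=> c iS; have /eqP/cards2P[a [b [ab eS]]] := c; move: iS; rewrite eS !inE => /orP[] /eqP ->.
  by exists b; rewrite // !inE eqxx orbT.
by exists a; rewrite ?inE ?eqxx // eq_sym.
Qed.

End Line.

Lemma in0 (i : 'I_n) (S : {set 'I_n}) : S = set0 -> i \in S -> False.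
Proof. by move=> ->; rewrite inE. Qed.

(** By (G) the four L_a are all the conditions L on M, and V_i or P_i would require two consecutive
    ones. This holds at each of the two points. *)
Lemma recover_VI d M : ok T0_VI d -> G d M -> nd M = d.
Proof.
case: d => [[V P] A] /andP[/admP[indep _ _ _ _] /eqP[/eqP + /eqP]].
rewrite !cards_eq0 => /eqP -> /eqP -> cA [rM /and3P[/= _ _ AL]].
have eL : sigL M = A by apply/eqP; rewrite eq_sym eqEcard AL cA; exact: (sigL_le4 aG rM).
have bad i : i \in sigL M -> pred i \in sigL M -> False.
  by rewrite eL => iA pA; have := indep _ pA; rewrite predK iA.
have V0 : sigV M = set0.
  by apply/eqP/set0Pn => -[i /(sigVL rM)/andP[h1 h2]]; apply: (bad i).
have P0 : sigP M = set0.
  by apply/eqP/set0Pn => -[i /(sigPL rM)/andP[h1 h2]]; apply: (bad i).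
case: ndP; rewrite ?V0 ?P0 ?cards0 ?eL //.
- by move=> i /setP/(_ i); rewrite !inE eqxx.
- by move=> i /setP/(_ i); rewrite !inE eqxx.
by move=> i _ /setP/(_ i); rewrite !inE eqxx.
Qed.

(** Solves the size equation c once e gives the value of k, and substitutes the size. *)
Ltac dimcard c e := move: c; rewrite e ?addnS ?addn0; case=> ->.

(** M meets the conditions of d, and by [generic_nd] its normal form has the same dimension. For
    each type of d and each case of [nd_dim], either the index sets coincide or the incidences and
    sizes contradict each other. *)
Lemma recover t d M : t <> T0_VI -> ok t d -> generic (G d) M -> nd M = d.
Proof.
move=> tVI o gen; have dM := gen.1; have rM := dM.1.
have [k [Hk ek]] : exists k, nd_dim M k (nd M) /\ k = tdim t.
  have [t' [_ o' e _]] := generic_nd tVI o gen.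
  by exists (tdim t'); split; first exact: nd_dimP.
have [_ [GV GP GL]] := (G_split Z d M).1 dM.
have sh := (okP n4 t d).1 o.
have PL i : i \in sigP M -> (i \in sigL M) && (pred i \in sigL M) by apply: sigPL.
have L4 := sigL_le4 aG rM.
have crest i : i \in sigV M :|: sigP M -> (#|rest M i| + 2 = #|sigL M|)%N by apply: card_rest.
have inV i : i \in d.1.1 -> i \in sigV M by move=> h; rewrite inE; apply: GV.
have inP i : i \in d.1.2 -> i \in sigP M by move=> h; rewrite inE; apply: GP.
have inL i : i \in d.2 -> i \in sigL M by move=> h; rewrite inE; apply: GL.
move: ek {gen dM GV GP GL o}.
case: t tVI sh => tVI sh /= ek; last by case: tVI.
- move: sh inL => [i ->] /= /(_ i (set11 i)) iL.
  case: Hk => [c k0|j eV jP c|j eV jP c|V0 c k0|j V0 eP c|V0 P0 c]; try (exfalso; lia).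
  by rewrite (@card1_eq (sigL M) i) //; dimcard c ek.
- move: sh inV => [i ->] /= /(_ i (set11 i)) iV.
  case: Hk => [c k0|j eV jP c|j eV jP c|V0 c k0|j V0 eP c|V0 P0 c]; try (exfalso; lia);
    try by case: (in0 V0 iV).
  have -> : rest M j = set0 by apply/eqP; rewrite -cards_eq0; dimcard c ek.
  by move: iV; rewrite eV inE => /eqP ->.
- move: sh inP => [i ->] /= /(_ i (set11 i)) iP.
  case: Hk => [c k0|j eV jP c|j eV jP c|V0 c k0|j V0 eP c|V0 P0 c]; try (exfalso; lia);
    try by case: (in0 P0 iP).
    (* V_j alone would leave no further L, but P_i with i different from j gives L_{i-1} and L_i,
       which are not both among L_{j-1} and L_j. *)
    have r0 : rest M j = set0 by apply/eqP; rewrite -cards_eq0; dimcard c ek.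
    have /andP[iL pL] := PL _ iP.
    have ij : i != j by apply: contraNneq jP => <-.
    have : pred i \in rest M j \/ i \in rest M j.
      have [|ni] := boolP (i \in rest M j); first by right.
      left; apply: rest_intro => //; apply: contraNneq ni => E; apply: rest_intro => //.
        by rewrite -E; ords.
      by move: ij; move/pred_inj: E => ->; rewrite eqxx.
    by rewrite r0 !inE; case.
  have -> : rest M j = set0 by apply/eqP; rewrite -cards_eq0; dimcard c ek.
  by move: iP; rewrite eP inE => /eqP ->.
- move: sh inL => [i [j [D ->]]] /= inL.
  have iL : i \in sigL M by apply: inL; rewrite !inE eqxx.
  have jL : j \in sigL M by apply: inL; rewrite !inE eqxx orbT.
  case: Hk => [c k0|l eV lP c|l eV lP c|V0 c k0|l V0 eP c|V0 P0 c]; try (exfalso; lia).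
  + have r0 : rest M l = set0 by apply/eqP; rewrite -cards_eq0; dimcard c ek.
    by case: (rest_disj l D iL jL); rewrite r0 inE.
  + have r0 : rest M l = set0 by apply/eqP; rewrite -cards_eq0; dimcard c ek.
    by case: (rest_disj l D iL jL); rewrite r0 inE.
  by rewrite (@card2_eq (sigL M) i j _ iL jL (pr_neq n4 D)) //; dimcard c ek.
- move: sh inV inP => [i ->] /= /(_ i (set11 i)) iV /(_ i (set11 i)) iP.
  case: Hk => [c k0|j eV jP c|j eV jP c|V0 c k0|j V0 eP c|V0 P0 c]; try (exfalso; lia);
    try by case: (in0 V0 iV).
    have -> : rest M j = set0 by apply/eqP; rewrite -cards_eq0; dimcard c ek.
    by move: iV; rewrite eV inE => /eqP ->.
  by move: iV jP; rewrite eV inE => /eqP <-; rewrite iP.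
- move: sh inV inL => [i [j [nij ->]]] /= /(_ i (set11 i)) iV /(_ j (set11 j)) jL.
  have jr : j \in rest M i.
    by apply: rest_intro => //; move: nij; ords.
  case: Hk => [c k0|l eV lP c|l eV lP c|V0 c k0|l V0 eP c|V0 P0 c]; try (exfalso; lia);
    try by case: (in0 V0 iV).
    have il : i = l by move: iV; rewrite eV inE => /eqP.
    have r0 : rest M l = set0 by apply/eqP; rewrite -cards_eq0; dimcard c ek.
    by rewrite il r0 inE in jr.
  have il : i = l by move: iV; rewrite eV inE => /eqP.
  by rewrite -il in c *; rewrite (@card1_eq (rest M i) j) //; dimcard c ek.
- move: sh inP inL => [i [j [D ->]]] /= /(_ i (set11 i)) iP /(_ j (set11 j)) jL.
  have /andP[iL pL] := PL _ iP.
  have jr : j \in rest M i by apply: rest_intro => //; move: D; ords.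
  case: Hk => [c k0|l eV lP c|l eV lP c|V0 c k0|l V0 eP c|V0 P0 c]; try (exfalso; lia);
    try by case: (in0 P0 iP).
  + have r0 : rest M l = set0 by apply/eqP; rewrite -cards_eq0; dimcard c ek.
    have D' : [disjoint pr i & pr j] by move: D; ords.
    by case: (rest_disj l D' iL jL); rewrite r0 inE.
  (* Z_l is in the plane of i, so l is i - 1 or i + 1. Then L_i or L_{i-1}, and also L_j, are left
     in [rest M l], which should have one element. *)
  + exfalso; have li : l != i by apply: contraNneq lP => ->.
    have lV : l \in sigV M by rewrite eV set11.
    have lt := VP_tr n4 tp lV iP.
    have [E|lp] := eqVneq l (pred i).
      have : (size [:: i; j] <= #|rest M l|)%N.
        apply: card_ge => [|x]; first by move: D; ords.
        rewrite !in_cons orbF => /orP[] /eqP ->; apply: rest_intro => //; rewrite E; first ords.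
        - by ords.
        - by move: D; ords.
        by move: D; ords.
      by dimcard c ek.
    have E : l = succ i by apply/eqP; move: lt li lp; ords.
    have : (size [:: pred i; j] <= #|rest M l|)%N.
      apply: card_ge => [|x]; first by move: D; ords.
      rewrite !in_cons orbF => /orP[] /eqP ->; apply: rest_intro => //; rewrite E; first ords.
      - by ords.
      - by move: D; ords.
      by move: D; ords.
    by dimcard c ek.
  have il : i = l by move: iP; rewrite eP inE => /eqP.
  by rewrite -il in c *; rewrite (@card1_eq (rest M i) j) //; dimcard c ek.
- move: sh inL => [i [j [l [[D1 D2 D3] ->]]]] /= inL.
  have iL : i \in sigL M by apply: inL; rewrite !inE eqxx.
  have jL : j \in sigL M by apply: inL; rewrite !inE eqxx ?orbT.
  have lL : l \in sigL M by apply: inL; rewrite !inE eqxx ?orbT.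
  have two a : (1 < #|rest M a|)%N.
    case: (rest_disj a D1 iL jL) => h1.
      case: (rest_disj a D3 jL lL) => h2; apply/card_gt1P; first by exists i, j; rewrite h1 h2 (pr_neq n4 D1).
      by exists i, l; rewrite h1 h2 (pr_neq n4 D2).
    case: (rest_disj a D2 iL lL) => h2; apply/card_gt1P; first by exists i, j; rewrite h1 h2 (pr_neq n4 D1).
    by exists j, l; rewrite h1 h2 (pr_neq n4 D3).
  case: Hk => [c k0|a eV aP c|a eV aP c|V0 c k0|a V0 eP c|V0 P0 c]; try (exfalso; lia);
    try (exfalso; have := two a; dimcard c ek; discriminate).
  have c3 : #|sigL M| = 3%N by (dimcard c ek).
  congr (_, _); apply/esym/eqP; rewrite eqEcard; apply/andP; split.
    by apply/subsetP => x; rewrite set3_seq in_set !in_cons orbF => /or3P[] /eqP ->.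
  by rewrite set3_seq cards_seq ?c3 // /= !inE negb_or !(pr_neq n4).
- move: sh inV => [i [j [ij ->]]] /= inV.
  have iV : i \in sigV M by apply: inV; rewrite !inE eqxx.
  have jV : j \in sigV M by apply: inV; rewrite !inE eqxx orbT.
  case: Hk => [c k0|a eV aP c|a eV aP c|V0 c k0|a V0 eP c|V0 P0 c]; try by case: (in0 V0 iV).
  + by rewrite (card2_eq c iV jV ij).
  + by move: iV jV ij; rewrite eV !inE => /eqP -> /eqP ->; rewrite eqxx.
  by move: iV jV ij; rewrite eV !inE => /eqP -> /eqP ->; rewrite eqxx.
- move: sh inP => [i [j [D ->]]] /= inP.
  have iP : i \in sigP M by apply: inP; rewrite !inE eqxx.
  have jP : j \in sigP M by apply: inP; rewrite !inE eqxx orbT.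
  have noV v : v \in sigV M -> False.
    move=> vV; have := VP_tr n4 tp vV iP; have := VP_tr n4 tp vV jP.
    by move=> h1 h2; rewrite (disjointFr D h2) in h1.
  case: Hk => [c k0|a eV aP c|a eV aP c|V0 c k0|a V0 eP c|V0 P0 c]; try by case: (in0 P0 iP).
  + have /card_gt0P[v vV] : (0 < #|sigV M|)%N by rewrite c.
    by case: (noV v vV).
  + by case: (noV a); rewrite eV set11.
  + by case: (noV a); rewrite eV set11.
  + by rewrite (card2_eq c iP jP (tr_neq D)).
  by move: iP jP (tr_neq D); rewrite eP !inE => /eqP -> /eqP ->; rewrite eqxx.
- move: sh inV inP inL => [i [j [D ->]]] /= /(_ i (set11 i)) iV /(_ i (set11 i)) iP /(_ j (set11 j)) jL.
  have nij := trpr_notin D.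
  case: Hk => [c k0|a eV aP c|a eV aP c|V0 c k0|a V0 eP c|V0 P0 c]; try by case: (in0 V0 iV).
  + have [v vV iv] := other c iV; exfalso.
    have vt := VP_tr n4 tp vV iP.
    rewrite !inE in iV vV jL; case: (VVLb n4 tp rM iv iV vV jL) => h; first by rewrite h in nij.
    by rewrite (disjointFr D vt) in h.
  + have ia : i = a by move: iV; rewrite eV inE => /eqP.
    rewrite -ia in c *; rewrite (@card1_eq (rest M i) j) //; first by dimcard c ek.
    by apply: rest_intro => //; move: D; ords.
  by move: iV aP; rewrite eV inE => /eqP <-; rewrite iP.
- move: sh inV inL => [i [j [l [[D n1 n2] ->]]]] /= /(_ i (set11 i)) iV inL.
  have jL : j \in sigL M by apply: inL; rewrite !inE eqxx.
  have lL : l \in sigL M by apply: inL; rewrite !inE eqxx ?orbT.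
  have jr : j \in rest M i by apply: rest_intro => //; move: n1; ords.
  have lr : l \in rest M i by apply: rest_intro => //; move: n2; ords.
  case: Hk => [c k0|a eV aP c|a eV aP c|V0 c k0|a V0 eP c|V0 P0 c]; try by case: (in0 V0 iV).
  + have [v vV iv] := other c iV; exfalso.
    rewrite !inE in iV vV jL lL.
    case: (VVLb n4 tp rM iv iV vV jL) => h1; first by rewrite h1 in n1.
    case: (VVLb n4 tp rM iv iV vV lL) => h2; first by rewrite h2 in n2.
    by rewrite (disjointFr D h1) in h2.
  + have ia : i = a by move: iV; rewrite eV inE => /eqP.
    rewrite -ia in c; have : (1 < #|rest M i|)%N.
      by apply/card_gt1P; exists j, l; rewrite jr lr (pr_neq n4 D).
    by dimcard c ek.
  have ia : i = a by move: iV; rewrite eV inE => /eqP.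
  rewrite -ia in c *; rewrite (@card2_eq (rest M i) j l _ jr lr (pr_neq n4 D)) //.
  by dimcard c ek.
move: sh inP inL => [i [j [l [[D1 D2 D] ->]]]] /= /(_ i (set11 i)) iP inL.
have jL : j \in sigL M by apply: inL; rewrite !inE eqxx.
have lL : l \in sigL M by apply: inL; rewrite !inE eqxx ?orbT.
have /andP[iL pL] := PL _ iP.
rewrite disjoint_sym in D1; rewrite disjoint_sym in D2.
have jl := pr_neq n4 D.
have jr : j \in rest M i by apply: rest_intro => //; move: D1; ords.
have lr : l \in rest M i by apply: rest_intro => //; move: D2; ords.
have [jt lt] : j \notin tr i /\ l \notin tr i.
  by split; [move: D1; ords | move: D2; ords].
have jtr x : x \in tr i -> x != j by apply: contraTneq => ->.
have ltr x : x \in tr i -> x != l by apply: contraTneq => ->.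
have pit : pred i \in tr i by rewrite !inE eqxx.
have iit : i \in tr i by rewrite !inE eqxx orbT.
have pii : pred i != i by ords.
case: Hk => [c k0|a eV aP c|a eV aP c|V0 c k0|a V0 eP c|V0 P0 c]; try by case: (in0 P0 iP).
- have /eqP/cards2P[v [v' [vv eV]]] := c; exfalso.
  have vV : v \in sigV M by rewrite eV !inE eqxx.
  have v'V : v' \in sigV M by rewrite eV !inE eqxx orbT.
  have vt := VP_tr n4 tp vV iP; have vt' := VP_tr n4 tp v'V iP.
  rewrite !inE in vV v'V jL.
  by case: (VVLb n4 tp rM vv vV v'V jL) => h; [rewrite (disjointFr D1 vt) in h|rewrite (disjointFr D1 vt') in h].
(* [rest M i] and [rest M a] have equal size, two less than [sigL M]: it is 1 by the normal form,
   but at least 2 because of L_j and L_l. *)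
- have := crest i; rewrite inE iP orbT => /(_ isT) c1.
  have := crest a; rewrite inE aP orbT => /(_ isT) c2.
  have : (1 < #|rest M i|)%N by apply/card_gt1P; exists j, l; rewrite jr lr jl.
  move: c; rewrite ek addn0 => c; rewrite c in c2; rewrite -c2 in c1.
  by move/addIn: c1 => ->.
(* Again a is i - 1 or i + 1; now three conditions are left in [rest M a], which should have two. *)
- exfalso; have ai : a != i by apply: contraNneq aP => ->.
  have aV : a \in sigV M by rewrite eV set11.
  have at' := VP_tr n4 tp aV iP.
  have [E|ap] := eqVneq a (pred i).
    have : (size [:: i; j; l] <= #|rest M a|)%N.
      apply: card_ge => [|x]; first by rewrite /= !inE negb_or (jtr _ iit) (ltr _ iit) jl.
      rewrite !in_cons orbF => /or3P[] /eqP ->; apply: rest_intro => //; rewrite E.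
      - by ords.
      - by ords.
      - by rewrite eq_sym jtr.
      - by move: D1; ords.
      - by rewrite eq_sym ltr.
      by move: D2; ords.
    by dimcard c ek.
  have E : a = succ i by apply/eqP; move: at' ai ap; ords.
  have : (size [:: pred i; j; l] <= #|rest M a|)%N.
    apply: card_ge => [|x]; first by rewrite /= !inE negb_or (jtr _ pit) (ltr _ pit) jl.
    rewrite !in_cons orbF => /or3P[] /eqP ->; apply: rest_intro => //; rewrite E ?succK //.
    - by ords.
    - by move: jt; ords.
    - by rewrite eq_sym jtr.
    - by move: lt; ords.
    by rewrite eq_sym ltr.
  by dimcard c ek.
(* By (G) the conditions L on M are exactly L_{i-1}, L_i, L_j and L_l. A second plane, of index m
   and disjoint from the first, needs L_{m-1} and L_m among L_j and L_l, whose pairs are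
   disjoint. *)
- exfalso; have [m mP im] := other c iP.
  have Dm := PP_disjoint n4 tp rM V0 iP mP im.
  have /andP[mL pmL] := PL _ mP.
  have mt : m \notin tr i by rewrite (disjointFl Dm) // !inE eqxx orbT.
  have pmt : pred m \notin tr i by rewrite (disjointFl Dm) // !inE eqxx.
  have u : uniq [:: pred i; i; j; l] by rewrite /= !inE !negb_or pii (jtr _ pit) (ltr _ pit) (jtr _ iit) (ltr _ iit) jl.
  have eL : sigL M = [set x in [:: pred i; i; j; l]].
    apply/esym/eqP; rewrite eqEcard cards_seq //; apply/andP; split; last exact: L4.
    by apply/subsetP => x; rewrite in_set !in_cons orbF => /or4P[] /eqP ->.
  have sub x : x \in sigL M -> x \notin tr i -> x = j \/ x = l.
    rewrite eL in_set !in_cons orbF => /or4P[] /eqP ->; rewrite ?pit ?iit // => _; by [left|right].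
  have pm : pred m != m by ords.
  case: (sub _ mL mt) => e1; case: (sub _ pmL pmt) => e2.
  + by rewrite e2 e1 eqxx in pm.
  + by move: D; rewrite -e1 -e2 disjoint_sym disjoint_pr predK !inE eqxx /= andbF.
  + by move: D; rewrite -e1 -e2 disjoint_pr predK !inE eqxx /= andbF.
  by rewrite e2 e1 eqxx in pm.
have ia : i = a by move: iP; rewrite eP inE => /eqP.
rewrite -ia in c *; rewrite (@card2_eq (rest M i) j l _ jr lr jl) //.
by dimcard c ek.
Qed.

End Recover.

(** * Counting *)

Section Counting.
Variable n : nat.
Hypothesis n4 : (4 <= n)%N.

Local Notation succ := (@Defs.succ n).
Local Notation pred := (@Defs.pred n).

Definition indep (A : {set 'I_n}) := [forall a in A, succ a \notin A].
Definition isets (W : {set 'I_n}) k := [set A : {set 'I_n} | [&& A \subset W, indep A & #|A| == k]].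

Lemma indepU1 v (A : {set 'I_n}) :
  indep (v |: A) = [&& indep A, succ v \notin A & pred v \notin A].
Proof.
apply/forall_inP/and3P => [H|[/forall_inP h1 h2 h3] a].
  split; last first.
  - apply/negP => pA; have := H (pred v); rewrite predK !inE pA eqxx orbT.
    by move=> /(_ isT).
  - by have := H v; rewrite !inE eqxx /= negb_or => /(_ isT)/andP[].
  by apply/forall_inP => a aA; have := H a; rewrite !inE aA orbT negb_or => /(_ isT)/andP[].
rewrite !inE => /orP[/eqP ->|aA]; rewrite negb_or.
  by rewrite h2 andbT; ords.
rewrite h1 // andbT; apply: contraNneq h3 => <-.
by rewrite succK.
Qed.

Lemma isets_rec (W : {set 'I_n}) v k : v \in W ->
  #|isets W k.+1| = (#|isets (W :\ v) k.+1| + #|isets (W :\: [set v; succ v; pred v]) k|)%N.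
Proof.
move=> vW; rewrite -(cardsID [set A : {set 'I_n} | v \notin A] (isets W k.+1)); congr (_ + _)%N.
  congr #|pred_of_set _|; apply/setP => A; rewrite !inE subsetD1.
  by rewrite -!andbA; case: (A \subset W); case: (v \in A) => //=; rewrite ?andbT ?andbF.
have inj : {in isets (W :\: [set v; succ v; pred v]) k &, injective (fun A => v |: A)}.
  move=> A B; rewrite !inE => /and3P[/subsetP AW _ _] /and3P[/subsetP BW _ _] E.
  have vA : v \notin A by apply/negP => /AW; rewrite !inE eqxx.
  have vB : v \notin B by apply/negP => /BW; rewrite !inE eqxx.
  by rewrite -(setU1K vA) E setU1K.
rewrite -(card_in_imset inj); congr #|pred_of_set _|; apply/setP => A.
apply/idP/imsetP => [|[B + ->]].
  rewrite !inE negbK => /andP[vA /and3P[AW iA cA]].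
  have eA := setD1K vA; exists (A :\ v); last by rewrite eA.
  move: iA; rewrite -{1}eA indepU1 => /and3P[iA sA pA].
  rewrite inE iA; apply/andP; split; last first.
    by move: cA; rewrite (cardsD1 v) vA eqSS.
  apply/subsetP => x xA; have := xA; rewrite !inE => /andP[xv xA'].
  rewrite (subsetP AW) // andbT !negb_or xv /=; apply/andP; split.
    by apply: contraNneq sA => <-.
  by apply: contraNneq pA => <-.
rewrite !inE negbK => /and3P[BW iB /eqP cB].
have notB x : x \in [set v; succ v; pred v] -> x \notin B.
  by move=> xs; apply/negP => /(subsetP BW); rewrite inE xs.
rewrite eqxx /= subUset sub1set vW (subset_trans BW (subsetDl _ _)) indepU1 iB.
by rewrite cardsU1 cB !notB ?eqxx // !inE eqxx ?orbT.
Qed.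

Lemma isets0 W : #|isets W 0| = 1%N.
Proof.
rewrite (_ : isets W 0 = [set set0]) ?cards1 //; apply/setP => A; rewrite !inE cards_eq0.
case: (eqVneq A set0) => [->|_]; rewrite ?andbF // andbT sub0set.
by apply/forall_inP => a; rewrite in_set0.
Qed.

Lemma isets_empty k : #|isets set0 k.+1| = 0%N.
Proof.
apply/eqP; rewrite cards_eq0; apply/eqP/setP => A; rewrite !inE subset0.
by case: (eqVneq A set0) => [->|_]; rewrite ?cards0 ?andbF.
Qed.

(** The number of forward steps from a to i, so that [arc a m] consists of consecutive indices
    starting at a. *)
Definition dst (a i : 'I_n) : nat := (if (a <= i)%N then i - a else i + n - a)%N.
Definition arc a m := [set i | (dst a i < m)%N].

Lemma dst_spec (a i : 'I_n) : ((a <= i)%N /\ dst a i = i - a)%N \/ ((i < a)%N /\ dst a i = i + n - a)%N.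
Proof. by rewrite /dst; case: leqP; [left|right]. Qed.

Ltac dsts := repeat match goal with
  | |- context [dst ?a ?i] => generalize (dst_spec a i); generalize (dst a i)
  end; ords.

Lemma dst_lt a i : (dst a i < n)%N.
Proof. by dsts. Qed.

Lemma dst_eq0 a i : (dst a i == 0%N) = (i == a).
Proof. by dsts. Qed.

Lemma dst_eq1 a i : (dst a i == 1%N) = (i == succ a).
Proof. by dsts. Qed.

Lemma dst_eqn1 a i : (dst a i == n.-1) = (i == pred a).
Proof. by dsts. Qed.

Lemma dst_eqn2 a i : (dst a i == n.-2) = (i == pred (pred a)).
Proof. by dsts. Qed.

Lemma dst_succ a i : i != a -> dst (succ a) i = (dst a i).-1.
Proof. by dsts. Qed.

Lemma arc0 a : arc a 0 = set0.
Proof. by apply/setP => i; rewrite !inE ltn0. Qed.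

Lemma arc_D1 a m : (m < n)%N -> arc a m.+1 :\ a = arc (succ a) m.
Proof.
move=> mn; apply/setP => i; rewrite !inE; case: (eqVneq i a) => [->|ia] /=.
  suff -> : dst (succ a) a = n.-1 by lia.
  by apply/eqP; rewrite dst_eqn1 succK.
by rewrite dst_succ //; move: ia; rewrite -dst_eq0; lia.
Qed.

Lemma arc_in a m : a \in arc a m.+1.
Proof. by rewrite inE (eqP (_ : dst a a == 0%N)) ?dst_eq0. Qed.

Lemma arc_D3 a m : (m.+2 < n)%N ->
  arc a m.+2 :\: [set a; succ a; pred a] = arc (succ (succ a)) m.
Proof.
move=> mn; rewrite -(arc_D1 (succ a) (ltnW (ltnW mn))) -(arc_D1 a (ltnW mn)).
apply/setP => i; rewrite !inE; case: (eqVneq i a) => //= _.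
case: (eqVneq i (succ a)) => //= _; case: (eqVneq i (pred a)) => //= /eqP.
by rewrite -dst_eqn1; lia.
Qed.

(** Independent sets of a path: [isets_rec] at its first vertex is Pascal's rule. As m < n, the arc
    does not close up to the whole cycle. *)
Lemma isets_arc a m k : (m < n)%N -> #|isets (arc a m) k| = 'C(m.+1 - k, k).
Proof.
elim/ltn_ind: m a k => m IH a [|k] mn; first by rewrite isets0 bin0.
case: m IH mn => [|[|m]] IH mn.
- by rewrite arc0 isets_empty subSS sub0n bin0n.
- rewrite (isets_rec _ (arc_in a 0)) arc_D1 ?(ltn_trans _ mn) // arc0 isets_empty add0n.
  rewrite (_ : _ :\: _ = set0); last first.
    by apply/setP => i; rewrite !inE; move: mn; dsts.
  case: k => [|k]; first by rewrite isets0.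
  by rewrite isets_empty !subSS sub0n bin0n.
rewrite (isets_rec _ (arc_in a m.+1)) arc_D1 ?arc_D3 //; last exact: ltnW.
rewrite !IH //; try by lia.
case: (leqP k m.+1) => km.
  by rewrite (_ : m.+3 - k.+1 = (m.+1 - k).+1)%N ?binS ?subSS //; lia.
(* Too many vertices are asked for: the truncated subtractions all give 0. *)
have [-> -> ->] : [/\ m.+3 - k.+1 = 0, m.+2 - k.+1 = 0 & m.+1 - k = 0]%N by split; clear -km; lia.
by rewrite !bin0n; case: k km.
Qed.

(** Cutting the cycle at a vertex leaves a path on n - 1 vertices, or on n - 3 if that vertex is
    chosen. *)
Lemma isets_cyc k : #|isets setT k.+1| = ('C(n - k.+1, k.+1) + 'C(n - 2 - k, k))%N.
Proof.
pose v := cyc n4 0.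
rewrite (isets_rec _ (in_setT v)).
have -> : [set: 'I_n] :\ v = arc (succ v) n.-1.
  by apply/setP => i; rewrite !inE; dsts.
have -> : [set: 'I_n] :\: [set v; succ v; pred v] = arc (succ (succ v)) (n - 3).
  by apply/setP => i; rewrite !inE; dsts.
rewrite !isets_arc; try by lia.
have [-> ->] : n.-1.+1 = n /\ ((n - 3).+1 = n - 2)%N by clear -n4; split; lia.
by [].
Qed.

End Counting.

(** * Numbers of admissible index sets of each type *)

Section TypeCounts.
Variable n : nat.
Hypothesis n4 : (4 <= n)%N.

Local Notation succ := (@Defs.succ n).
Local Notation pred := (@Defs.pred n).
Local Notation ok := (@ok n).

Lemma succ_eq i a : (succ a == i) = (a == pred i).
Proof. by apply/eqP/eqP => [<-|->]; rewrite ?succK ?predK. Qed.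

Lemma away_pr_arc i : [set a | i \notin pr a] = arc (succ i) (n - 2).
Proof.
rewrite -arc_D1 //; last by lia.
apply/setP => a; rewrite !inE negb_or eq_sym (eq_sym i) succ_eq -(dst_eqn1 n4); congr (_ && _).
by have := dst_lt n4 i a; lia.
Qed.

Lemma away_tr_arc i : [set a | [disjoint tr i & pr a]] = arc (succ (succ i)) (n - 4).
Proof.
rewrite -arc_D3 //; last by lia.
rewrite (_ : (n - 4).+2 = n.-2)%N; last by lia.
apply/setP => a; rewrite !inE disjoint_sym disjoint_pr !inE !succ_eq succK.
rewrite -(dst_eqn2 n4 i a) -(dst_eqn1 n4 i a) -(dst_eq1 n4 i a) -(dst_eq0 n4 i a).
by have := dst_lt n4 i a; lia.
Qed.

Lemma card_ok (T : finType) (D : {set T}) (h : T -> data n) t :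
  {in D &, injective h} -> (forall d, ok t d <-> exists2 x, x \in D & d = h x) ->
  #|[set d | ok t d]| = #|D|.
Proof.
move=> inj H; rewrite -(card_in_imset inj); congr #|pred_of_set _|; apply/setP => d.
by rewrite inE; apply/idP/imsetP => [/H //|/H].
Qed.

Lemma card_dep_pairs (T : finType) (F : 'I_n -> {set T}) m : (forall i, #|F i| = m) ->
  #|[set x : 'I_n * T | x.2 \in F x.1]| = (n * m)%N.
Proof.
move=> Fm; rewrite -sum1dep_card -(pair_big_dep xpredT (fun i x => x \in F i) (fun _ _ => 1%N)) /=.
by rewrite (eq_bigr (fun=> m)) => [|i _]; [rewrite sum_nat_const card_ord | rewrite sum1_card].
Qed.

Lemma count_isets t k : tcards t = (0, 0, k)%N -> #|[set d | ok t d]| = #|isets [set: 'I_n] k|.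
Proof.
move=> ct; apply: (@card_ok _ _ (fun A => (set0, set0, A))) => [A B _ _ []//|[[V P] A]]; split.
  rewrite /ok ct => /andP[/and5P[/(id : _ -> indep A) iA _ _ _ _] /eqP[/eqP + /eqP + cA]].
  by rewrite !cards_eq0 => /eqP -> /eqP ->; exists A; rewrite // inE subsetT iA cA /=.
move=> [B + [-> -> ->]]; rewrite inE => /and3P[_ iB /eqP cB].
rewrite /ok ct /= !cards0 cB eqxx andbT; apply/and5P; split=> //;
  by apply/forall_inP => i; rewrite inE.
Qed.

Lemma count_V_isets t k : tcards t = (1, 0, k)%N ->
  #|[set d | ok t d]| = #|[set x : 'I_n * {set 'I_n} | x.2 \in isets [set a | x.1 \notin pr a] k]|.
Proof.
move=> ct; apply: (@card_ok _ _ (fun x => ([set x.1], set0, x.2))) => [[i A] [j B] _ _ /= [/set1_inj -> ->] //|].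
move=> [[V P] A]; split.
  rewrite /ok ct => /andP[/and5P[/(id : _ -> indep A) iA vA _ _ _] /eqP[/eqP/cards1P[i eV] /eqP + cA]].
  rewrite cards_eq0 => /eqP ->; exists (i, A); last by rewrite eV.
  rewrite !inE /= iA cA eqxx !andbT; apply/subsetP => a aA; rewrite inE.
  by apply: (forall_inP (forall_inP vA i _)); rewrite /= ?eV ?inE.
move=> [[i B] + [-> -> ->]]; rewrite !inE /= => /and3P[/subsetP sB iB /eqP cB].
rewrite /ok ct /= !cards0 cards1 cB eqxx andbT; apply/and5P; split=> //.
- by apply/forall_inP => j; rewrite inE => /eqP ->; apply/forall_inP => a /sB; rewrite inE.
- by apply/forall_inP => j; rewrite inE.
- by apply/forall_inP => j; rewrite inE.
by apply/forall_inP => j _; apply/forall_inP => ?; rewrite inE.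
Qed.

(** v is 0 for P_i alone and 1 for V_i P_i. In the second case V is forced to be the same singleton,
    so the count does not change. *)
Lemma count_P_isets t k v : tcards t = (v, 1, k)%N -> (v < 2)%N ->
  #|[set d | ok t d]| =
  #|[set x : 'I_n * {set 'I_n} | x.2 \in isets [set a | [disjoint tr x.1 & pr a]] k]|.
Proof.
move=> ct v2.
pose W i : {set 'I_n} := if v is 0 then set0 else [set i].
pose h (x : 'I_n * {set 'I_n}) : data n := (W x.1, [set x.1], x.2).
apply: (@card_ok _ _ h) => [[i A] [j B] _ _ /= [_ /set1_inj -> ->] //|].
move=> [[V P] A]; split.
  rewrite /ok ct => /andP[/and5P[/(id : _ -> indep A) iA vA pA _ vP] /eqP[/eqP cV /eqP/cards1P[i eP] cA]].
  have eV : V = W i.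
    rewrite /W; move: v2 cV; case: (v) => [|[|//]] _; first by rewrite cards_eq0 => /eqP.
    move=> /cards1P[j eV]; rewrite eV; congr [set _]; apply/eqP.
    by apply: (forall_inP (forall_inP vP j _)); rewrite /= ?eV ?eP inE.
  exists (i, A); last by rewrite /h eV eP.
  rewrite !inE /= iA cA eqxx !andbT; apply/subsetP => a aA; rewrite inE.
  by apply: (forall_inP (forall_inP pA i _)); rewrite /= ?eP ?inE.
move=> [[i B] + [-> -> ->]]; rewrite !inE /= => /and3P[/subsetP sB iB /eqP cB].
have sub j : j \in W i -> j = i.
  by rewrite /W; case: (v) => [|?]; rewrite inE // => /eqP.
rewrite /ok ct /= cards1 cB; apply/andP; split; last first.
  by rewrite /W; move: v2; case: (v) => [|[]] //; rewrite ?cards0 ?cards1.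
apply/and5P; split=> //.
- apply/forall_inP => j vj; rewrite (sub j vj); apply/forall_inP => a /sB; rewrite inE; exact: trpr_notin.
- by apply/forall_inP => j; rewrite inE => /eqP ->; apply/forall_inP => a /sB; rewrite inE.
- apply/forall_inP => j; rewrite inE => /eqP ->; apply/forall_inP => j'; rewrite inE => /eqP ->.
  by rewrite eqxx.
by apply/forall_inP => j vj; rewrite (sub j vj); apply/forall_inP => ?; rewrite inE eq_sym.
Qed.

Lemma count_VV : #|[set d | ok T0_I d]| = 'C(n, 2).
Proof.
rewrite -[n in RHS](card_ord n) -card_draws.
apply: (@card_ok _ _ (fun V => (V, set0, set0))) => [A B _ _ []//|[[V P] A]]; split.
  rewrite /ok => /andP[_ /eqP[cV /eqP + /eqP]].
  by rewrite !cards_eq0 => /eqP -> /eqP ->; exists V; rewrite // inE cV /=.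
move=> [B + [-> -> ->]]; rewrite inE => /eqP cB.
rewrite /ok /= !cards0 cB eqxx andbT; apply/and5P; split; try by apply/forall_inP => i; rewrite inE.
  by apply/forall_inP => i _; apply/forall_inP => ?; rewrite inE.
by apply/forall_inP => i _; apply/forall_inP => ?; rewrite inE.
Qed.

Lemma card_away_tr (i : 'I_n) : #|[set j | [disjoint tr i & tr j]]| = (n - 5)%N.
Proof.
(* For n = 4 two triples always meet, in agreement with the truncated n - 5; for n >= 5 the five
   indices within distance two of i are excluded. *)
have [n5|n5] := ltnP 4 n; last first.
  rewrite (_ : n - 5 = 0)%N; last by lia.
  apply/eqP; rewrite cards_eq0; apply/eqP/setP => j; rewrite in_set inE; apply/negP => D.
  have : (#|tr i :|: tr j| <= 4)%N by rewrite (leq_trans (max_card _)) // card_ord.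
  have c3 (k : 'I_n) : #|tr k| = 3%N by rewrite /tr set3_seq cards_seq //; ords.
  by rewrite cardsU disjoint_setI0 // cards0 !c3.
pose s := [:: pred (pred i); pred i; i; succ i; succ (succ i)].
have us : uniq s by move: n5; ords.
have -> : [set j : 'I_n | [disjoint tr i & tr j]] = ~: [set x in s].
  apply/setP => j; rewrite !inE disjoint_tr !inE !negb_or !(eq_sym j) -!succ_eq !predK.
  have eq_succ x : (x == succ j) = (pred x == j) by rewrite eq_sym succ_eq eq_sym.
  rewrite !eq_succ succK.
  by do ![case: (_ == _)].
by have := cardsC [set x in s]; rewrite card_ord cards_seq //=; lia.
Qed.

(** Unordered pairs are counted as increasing ordered pairs, which are half of all the ordered
    ones. *)
Lemma count_PP : (2 * #|[set d | ok T0_II d]| = n * (n - 5))%N.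
Proof.
pose D (x : 'I_n * 'I_n) := [disjoint tr x.1 & tr x.2].
have symD x y : D (x, y) = D (y, x) by rewrite /D disjoint_sym.
pose U := [set x : 'I_n * 'I_n | (x.1 < x.2)%N && D x].
have -> : #|[set d | ok T0_II d]| = #|U|.
  apply: (@card_ok _ _ (fun x => (set0, [set x.1; x.2], set0))).
    move=> [i j] [k l]; rewrite !inE /= => /andP[ij _] /andP[kl _] [] /setP e.
    have := e i; have := e j; have := e k; have := e l; rewrite !inE !eqxx ?orbT /= => hl hk hj hi.
    by congr (_, _); apply/val_inj; move: ij kl hl hk hj hi; rewrite -!val_eqE /=; lia.
  move=> d; rewrite (okP n4) /=; split=> [[i [j [dij ->]]]|[[i j] + ->]].
    have [ij|ji|/val_inj e] := ltngtP i j; last by have := tr_neq dij; rewrite e eqxx.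
      by exists (i, j); rewrite // inE ij.
    by exists (j, i); rewrite /= 1?setUC // inE ji symD.
  by rewrite inE => /andP[_ dij]; exists i, j.
have -> : (n * (n - 5) = #|[set x | D x]|)%N.
  rewrite -(card_dep_pairs card_away_tr); congr #|pred_of_set _|.
  by apply/setP => -[i j]; rewrite !inE.
rewrite -(cardsID [set x : 'I_n * 'I_n | (x.1 < x.2)%N] [set x | D x]) mul2n -addnn.
congr (_ + _)%N; first by congr #|pred_of_set _|; apply/setP => x; rewrite !inE andbC.
have inj : injective (fun x : 'I_n * 'I_n => (x.2, x.1)) by move=> [i j] [k l] [-> ->].
rewrite -(card_imset _ inj); congr #|pred_of_set _|; apply/setP => -[i j]; rewrite !inE /= -leqNgt.
apply/imsetP/idP => [[[k l] + [-> ->]]|/andP[ji dij]].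
  by rewrite inE symD => /andP[kl ->]; rewrite /= ltnW.
exists (j, i) => //; rewrite inE symD dij andbT ltn_neqAle ji andbT.
by apply: contraTneq dij => /= /val_inj ->; apply/negP => /tr_neq; rewrite eqxx.
Qed.

Lemma binomial_cycle2 : ('C(n - 2, 2) + 'C(n - 3, 1) = 'C(n, 2) - n)%N.
Proof.
have -> : n = (n - 3).+3 by clear -n4; lia.
move: (n - 3)%N => m; have -> : (m.+3 - 2 = m.+1)%N by lia.
have -> : (m.+3 - 3 = m)%N by lia.
rewrite !binS !bin1 !bin0.
by move: 'C(m, 2) => c; lia.
Qed.

Lemma binomial_cycle3 : ('C(n - 3, 3) + 'C(n - 4, 2) = 'C(n, 3) - n * (n - 3))%N.
Proof.
have -> : n = (n - 4).+4 by clear -n4; lia.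
move: (n - 4)%N => m; have -> : (m.+4 - 3 = m.+1)%N by lia.
have -> : (m.+4 - 4 = m)%N by lia.
rewrite !binS !bin1 !bin0.
have : (2 * 'C(m, 2) + m = m * m)%N by rewrite bin2 mul2n; case: m => [//|m]; have := odd_double_half (m.+1 * m); rewrite oddM /= ; case: (odd m) => /=; lia.
by move: 'C(m, 2) 'C(m, 3) => c c'; nia.
Qed.

(** With m = n - 5 the left side is C(m, 4) + 2 C(m, 3), and 24 times it is m (m - 1) (m - 2) ((m -
    3) + 8). For m < 3 both sides vanish, so the truncated subtractions do no harm. *)
Lemma binomial_cycle4 :
  ('C(n - 4, 4) + 'C(n - 5, 3) = (n * (n - 5) * (n - 6) * (n - 7)) %/ 24)%N.
Proof.
have [n5|n5] := ltnP 4 n; last by have -> : n = 4%N by lia.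
have -> : n = (n - 5 + 5)%N by clear -n5; lia.
move: (n - 5)%N => m; rewrite addnK.
have -> : (m + 5 - 4 = m.+1)%N by lia.
have -> : (m + 5 - 6 = m - 1)%N by lia.
have -> : (m + 5 - 7 = m - 2)%N by lia.
have f3 : (m * (m - 1) * (m - 2) = m ^_ 3)%N by rewrite !ffactnSr ffactn0 mul1n subn0.
rewrite -!mulnA (mulnA m) f3 binS -addnA addnn -muln2.
rewrite -[LHS](@mulnK _ 24) //; congr (_ %/ _)%N.
rewrite mulnDl -mulnA (_ : 2 * 24 = 3`! * 8)%N // mulnA bin_ffact (_ : 24 = 4`!)%N // bin_ffact.
rewrite ffactnSr -mulnDr mulnC; have [m3|m3] := ltnP m 3; first by rewrite ffact_small ?muln0.
by congr (_ * _)%N; lia.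
Qed.

Lemma card_ok_types t : #|[set d | ok t d]| = tcount n t.
Proof.
have [l1 e1] : (n - 2 < n)%N /\ ((n - 2).+1 = n - 1)%N by clear -n4; split; lia.
have [l2 e2] : (n - 4 < n)%N /\ ((n - 4).+1 = n - 3)%N by clear -n4; split; lia.
have V1 k : tcards t = (1, 0, k)%N -> #|[set d | ok t d]| = (n * 'C(n - 1 - k, k))%N.
  move=> ct; rewrite (count_V_isets ct).
  apply: (@card_dep_pairs _ (fun i => isets [set a | i \notin pr a] k)) => i.
  by rewrite away_pr_arc (isets_arc n4 _ _ l1) e1.
have P1 v k : (v < 2)%N -> tcards t = (v, 1, k)%N -> #|[set d | ok t d]| = (n * 'C(n - 3 - k, k))%N.
  move=> v2 ct; rewrite (count_P_isets ct v2).
  apply: (@card_dep_pairs _ (fun i => isets [set a | [disjoint tr i & pr a]] k)) => i.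
  by rewrite away_tr_arc (isets_arc n4 _ _ l2) e2.
have A1 k : tcards t = (0, 0, k.+1)%N ->
    #|[set d | ok t d]| = ('C(n - k.+1, k.+1) + 'C(n - 2 - k, k))%N.
  by move=> ct; rewrite (count_isets ct) (isets_cyc n4).
case: t V1 P1 A1 => V1 P1 A1 /=.
- by rewrite (A1 0%N) // bin1 bin0; clear -n4; lia.
- by rewrite (V1 0%N) // bin0 muln1.
- by rewrite (P1 0%N 0%N) // bin0 muln1.
- by rewrite (A1 1%N) // -subnDA binomial_cycle2.
- by rewrite (P1 1%N 0%N) // bin0 muln1.
- by rewrite (V1 1%N) // bin1 -subnDA.
- by rewrite (P1 0%N 1%N) // bin1 -subnDA.
- by rewrite (A1 2%N) // -subnDA binomial_cycle3.
- exact: count_VV.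
- by rewrite -count_PP mulKn.
- by rewrite (P1 1%N 1%N) // bin1 -subnDA.
- by rewrite (V1 2%N) // -subnDA.
- by rewrite (P1 0%N 2%N) // -subnDA.
by rewrite (A1 3%N) // -subnDA binomial_cycle4.
Qed.

End TypeCounts.

(** * Strata *)

Lemma component_ext X X' Y Y' : seteq X X' -> seteq Y Y' -> component X Y -> component X' Y'.
Proof.
move=> eX eY [irr [sub mx]]; split; first exact: irreducible_ext irr.
split=> [M /eY/sub/eX //|W iW YW WX N WN]; apply/eY; apply: (mx W) => //.
  by move=> L /eY/YW.
by move=> L /WX/eX.
Qed.

Lemma component_self X : irreducible X -> component X X.
Proof. by move=> irr; split=> //; split=> [M|W _ _]. Qed.

Section Strata.
Variables (n : nat) (Z : 'M[RR]_(n, 4)).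
Hypotheses (n4 : (4 <= n)%N) (tp : totally_positive Z) (aG : assumptionG Z).

Local Notation z := (zpt Z).
Local Notation succ := (@Defs.succ n).
Local Notation pred := (@Defs.pred n).
Local Notation Vb := (Vb Z).
Local Notation Pb := (Pb Z).
Local Notation Lb := (Lb Z).
Local Notation G := (G Z).
Local Notation ok := (@ok n).
Local Notation nd := (nd Z).
Local Notation generic := (generic Z).

Lemma generic_ext X Y M : seteq X Y -> generic X M -> generic Y M.
Proof. by move=> XY [/XY YM gen]; split=> // N /XY/gen. Qed.

Lemma ok_type_uniq t1 t2 d : ok t1 d -> ok t2 d -> t1 = t2.
Proof. by move=> /andP[_ /eqP e1] /andP[_ /eqP e2]; apply: tcards_inj; rewrite -e1 -e2. Qed.

Lemma sub_two_points d X M : ok T0_VI d -> irreducible X -> subset X (G d) -> X M -> seteq X (Spt M).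
Proof.
move=> o irr XG XM; have [M1 [M2 [_ _ _ e]]] := two_points_ok n4 tp o.
have [[[Xr Xe] _] _] := irr; have rM := Xr M XM.
have sub : subset X (fun N => rank2 N /\ ((N == M1)%MS \/ (N == M2)%MS)) by move=> N /XG/e.
suff [M' h] : exists M', subset X (Spt M').
  move=> N; split=> [XN|[rN NM]]; last by apply: Xe XM => //; rewrite andbC.
  have [rN /eqmxP eN] := h N XN; have [_ /eqmxP eM] := h M XM.
  by split=> //; apply/eqmxP/(eqmx_trans eN (eqmx_sym eM)).
by have [h|h] := sub_seteq_pts irr sub; [exists M1|exists M2].
Qed.

Lemma component_point d M : ok T0_VI d -> G d M -> component (G d) (Spt M).
Proof.
move=> o dM; have rM := dM.1; split; first by have [] := irrdim_Spt rM.
split.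
  have [M1 [M2 [_ _ _ e]]] := two_points_ok n4 tp o.
  move=> N [rN /eqmxP NM]; apply/e; split=> //.
  by have [_ [/eqmxP h|/eqmxP h]] := (e M).1 dM; [left|right]; apply/eqmxP/(eqmx_trans NM h).
move=> W irr MW WG N /(sub_two_points o irr WG) h.
by apply/h/MW; split=> //; apply/eqmxP.
Qed.

Lemma has_type_VI X : has_type Z T0_VI X <-> exists d M, [/\ ok T0_VI d, G d M & seteq X (Spt M)].
Proof.
split=> [[i [j [k [l [a c]]]]]|[d [M [o dM e]]]].
  have o : ok T0_VI (set0, set0, [set i; j; k; l]) by apply/(okP n4); exists i, j, k, l.
  have [irr [sub _]] := component_ext (G0VI n4 tp i j k l) (fun M => iff_refl _) c.
  have [_ [[M XM] _]] := irr.
  by exists (set0, set0, [set i; j; k; l]), M; split=> //; [exact: sub|exact: sub_two_points sub XM].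
have [i [j [k [l [a ed]]]]] := (okP n4 _ _).1 o; exists i, j, k, l; split=> //.
apply: component_ext (component_point o dM); last exact: seteq_sym.
by rewrite ed; apply/seteq_sym/G0VI.
Qed.

(** A form valid for all 14 types: type and index sets can be read off at one generic point, which
    makes the types exclusive. *)
Lemma typed_nd t X : has_type Z t X -> exists d,
  [/\ ok t d, irreducible X, subset X (G d) & forall M, generic X M -> nd M = d].
Proof.
have [->|tVI] : t = T0_VI \/ t <> T0_VI by case: t; (by left) || by right.
  move=> /has_type_VI[d [M [o dM e]]]; exists d.
  have [irr [sub _]] := component_ext (fun N => iff_refl _) (seteq_sym e) (component_point o dM).
  by split=> // N [/sub dN _]; apply: (recover_VI aG o).
move=> /(has_typeP n4 tp X tVI)[d [o e]]; exists d; split=> //; last by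
  move=> M /(generic_ext e); apply: (recover n4 tp aG tVI o).
  by apply: irreducible_ext (seteq_sym e) _; have [] := irrdim_ok n4 tp tVI o.
by move=> M /e.
Qed.

Lemma type_uniq X t1 t2 : has_type Z t1 X -> has_type Z t2 X -> t1 = t2.
Proof.
move=> /typed_nd[d1 [o1 irr _ n1]] /typed_nd[d2 [o2 _ _ n2]].
have [M gM] := generic_ex n4 tp irr.
by move: o1; rewrite -(n1 M gM) (n2 M gM) => o1; apply: ok_type_uniq o1 o2.
Qed.

Lemma G_inj t d d' : ok t d -> ok t d' -> seteq (G d) (G d') -> d = d'.
Proof.
have [->|tVI] : t = T0_VI \/ t <> T0_VI by case: t; (by left) || by right.
  move=> o o' e; have [M [M' [rM _ _ h]]] := two_points_ok n4 tp o.
  have dM : G d M by apply/h; split=> //; left; apply/eqmxP.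
  by rewrite -(recover_VI aG o dM) (recover_VI aG o') //; apply/e.
move=> o o' e; have [irr _] := irrdim_ok n4 tp tVI o.
have [M gM] := generic_ex n4 tp irr.
rewrite -(recover n4 tp aG tVI o gM) (recover n4 tp aG tVI o') //.
exact: generic_ext gM.
Qed.

Lemma enumerate_ok t : exists f : 'I_(tcount n t) -> gset,
  (forall k k', seteq (f k) (f k') -> k = k') /\
  (forall X, (exists d, ok t d /\ seteq X (G d)) <-> exists k, seteq X (f k)).
Proof.
pose S := [set d | ok t d]; have cS : tcount n t = #|S| by rewrite card_ok_types.
exists (fun k => G (enum_val (cast_ord cS k))).
have okS k : ok t (enum_val (cast_ord cS k)) by have := enum_valP (cast_ord cS k); rewrite inE.
split=> [k k' /(G_inj (okS k) (okS k'))/enum_val_inj/cast_ord_inj //|X].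
split=> [[d [o e]]|[k e]]; last by exists (enum_val (cast_ord cS k)).
have dS : d \in S by rewrite inE.
by exists (cast_ord (esym cS) (enum_rank_in dS d)); rewrite cast_ordKV enum_rankK_in.
Qed.

Lemma has_dim_type t X : has_type Z t X -> has_dim X (tdim t).
Proof.
have [->|tVI] : t = T0_VI \/ t <> T0_VI by case: t; (by left) || by right.
  move=> /has_type_VI[d [M [o dM e]]]; apply: has_dim_ext (seteq_sym e) _.
  by have [irr nc] := irrdim_Spt dM.1; split=> //; apply: chain0.
move=> /(has_typeP n4 tp X tVI)[d [o e]]; apply: has_dim_ext (seteq_sym e) _.
exact: has_dim_ok.
Qed.

Lemma Dset_Lnext i : seteq (Dset Z i) (Lnext Z i).
Proof. by move=> M; rewrite LnextP //; split=> -[rM /eqP h]; split=> //; apply/eqP. Qed.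

Lemma stratum_has_type X : stratum Z X -> exists t, has_type Z t X.
Proof.
elim=> {X} [i|A B Y _ [t1 h1] _ [t2 h2] [irr [sub mx]]].
  by exists T3_I; exists i; apply: Dset_Lnext.
have [M gM] := generic_ex n4 tp irr; have [YM min] := gM; have [AM BM] := sub M YM.
have [d1 [o1 _ A1 _]] := typed_nd h1; have [d2 [o2 _ B2 _]] := typed_nd h2.
have dM1 := A1 M AM; have dM2 := B2 M BM; have rM := dM1.1.
have [t o] := classify n4 tp aG rM (G_ne_sigL o1 dM1); exists t.
have Ynd : subset Y (G (nd M)).
  move=> N YN; have [s1 s2 s3] := min N YN.
  have [_ /and3P[m1 m2 m3]] := nd_mem Z rM.
  have [[[Yr _] _] _] := irr.
  by split; [exact: Yr | rewrite (subset_trans m1) // (subset_trans m2) // (subset_trans m3)].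
have [tVI|tVI] : t = T0_VI \/ t <> T0_VI by case: (t); (by left) || by right.
  subst t; apply/has_type_VI; exists (nd M), M; split=> //; first exact: nd_mem.
  exact: (sub_two_points o irr Ynd YM).
(* By [nd_min], G (nd M) lies in each of the two strata, and maximality of Y will give Y = G (nd M).
   A stratum of type (0,VI) is impossible here: by [recover_VI] it would make nd M of that type. *)
have sup C t' d : has_type Z t' C -> ok t' d -> G d M -> C M -> subset (G (nd M)) C.
  move=> hC o' dM CM N NM; have [s1 s2 s3] := nd_min n4 tp rM NM.
  have t'VI : t' <> T0_VI.
    move=> e; subst t'; move: o; rewrite (recover_VI aG o' dM) => o.
    by apply: tVI; apply: ok_type_uniq o o'.
  have [d' [_ e]] := (has_typeP n4 tp C t'VI).1 hC.
  have [_ /and3P[m1 m2 m3]] := (e M).1 CM.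
  apply/e; split; first by case: NM.
  by rewrite (subset_trans m1) // (subset_trans m2) // (subset_trans m3).
apply/(has_typeP n4 tp Y tVI); exists (nd M); split=> // N; split; first exact: Ynd.
apply: mx => //; first by have [] := irrdim_ok n4 tp tVI o.
by move=> L hL; split; [exact: (sup A _ _ h1 o1 dM1 AM L hL)|exact: (sup B _ _ h2 o2 dM2 BM L hL)].
Qed.

Lemma is_stratum_comp A B A' B' X : is_stratum Z A' -> is_stratum Z B' ->
  seteq A A' -> seteq B B' -> component (inter A B) X -> is_stratum Z X.
Proof.
move=> [A1 [sA eA]] [B1 [sB eB]] eA' eB' c; exists X; split=> //.
apply: (stratum_comp sA sB); apply: component_ext c => // M.
by rewrite /inter eA' eB' eA eB.
Qed.

(** An irreducible intersection is a component of itself. *)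
Lemma is_stratum_inter d1 d2 t d : t <> T0_VI -> ok t d ->
  seteq (G d) (inter (G d1) (G d2)) ->
  is_stratum Z (G d1) -> is_stratum Z (G d2) -> is_stratum Z (G d).
Proof.
move=> tVI o e s1 s2; apply: (is_stratum_comp s1 s2 (fun=> iff_refl _) (fun=> iff_refl _)).
apply: component_ext e (fun=> iff_refl _) _; apply: component_self.
by have [] := irrdim_ok n4 tp tVI o.
Qed.

Lemma GI V P A V' P' A' V'' P'' A'' : V'' = V :|: V' -> P'' = P :|: P' -> A'' = A :|: A' ->
  seteq (G (V'', P'', A'')) (inter (G (V, P, A)) (G (V', P', A'))).
Proof. by move=> -> -> ->; apply: seteq_sym; apply: G_inter. Qed.

Lemma stratum_L i : is_stratum Z (G (set0, set0, [set i])).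
Proof.
exists (Dset Z i); split; first exact: stratum_D.
by apply: seteq_trans (seteq_sym (G3I n4 tp i)) _; apply: seteq_sym; apply: Dset_Lnext.
Qed.

(** By [Lb_corner], L_{i-1} L_i is the union of V_i and P_i. Both are irreducible, and neither
    contains the other: otherwise one of them would equal V_i P_i and have two types. *)
Lemma stratum_VP i : is_stratum Z (G ([set i], set0, set0)) /\ is_stratum Z (G (set0, [set i], set0)).
Proof.
have o1 : ok T2_I ([set i], set0, set0) by apply/(okP n4); exists i.
have o2 : ok T2_II (set0, [set i], set0) by apply/(okP n4); exists i.
have o3 : ok T1_I ([set i], [set i], set0) by apply/(okP n4); exists i.
have [irr1 _] := irrdim_ok (t := T2_I) n4 tp ltac:(discriminate) o1.
have [irr2 _] := irrdim_ok (t := T2_II) n4 tp ltac:(discriminate) o2.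
have e3 : seteq (G ([set i], [set i], set0)) (inter (G ([set i], set0, set0)) (G (set0, [set i], set0))).
  by apply: GI; rewrite ?setU0 ?set0U.
have ty t d : t <> T0_VI -> ok t d -> has_type Z t (G d).
  by move=> tVI o; apply/(has_typeP n4 tp _ tVI); exists d.
have nVP : ~ subset (G ([set i], set0, set0)) (G (set0, [set i], set0)).
  move=> sub; suff e : seteq (G ([set i], set0, set0)) (G ([set i], [set i], set0)).
    have h : has_type Z T1_I (G ([set i], set0, set0)).
      by apply/(has_typeP n4 tp) => //; exists ([set i], [set i], set0).
    by have := type_uniq (ty T2_I _ ltac:(discriminate) o1) h.
  by move=> M; rewrite e3 /inter; split=> [h|[]//]; split=> //; apply: sub.
have nPV : ~ subset (G (set0, [set i], set0)) (G ([set i], set0, set0)).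
  move=> sub; suff e : seteq (G (set0, [set i], set0)) (G ([set i], [set i], set0)).
    have h : has_type Z T1_I (G (set0, [set i], set0)).
      by apply/(has_typeP n4 tp) => //; exists ([set i], [set i], set0).
    by have := type_uniq (ty T2_II _ ltac:(discriminate) o2) h.
  by move=> M; rewrite e3 /inter; split=> [h|[]//]; split=> //; apply: sub.
have split W : irreducible W -> subset W (inter (Lnext Z (pred i)) (Lnext Z i)) ->
    subset W (G ([set i], set0, set0)) \/ subset W (G (set0, [set i], set0)).
  move=> [_ [_ irr]] WL; apply: irr; [exact: irr1.1|exact: irr2.1|] => M /WL[].
  rewrite !LnextP // => -[rM h1] [_ h2].
  have [h|h] := Lb_corner n4 tp rM h1 h2; [left; apply/G2I|right; apply/G2II] => //.
have sL := seteq_sym (G3I n4 tp i); have sLp := seteq_sym (G3I n4 tp (pred i)).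
split.
  apply: (is_stratum_comp (stratum_L (pred i)) (stratum_L i)) (seteq_sym sLp) (seteq_sym sL) _.
  split=> //; split.
    move=> M /G2I[rM V]; rewrite /inter !LnextP //.
    by split; split=> //; [apply: Vb_Lbp|apply: Vb_Lb].
  by move=> W iW VW /(split W iW)[//|WP]; case: nVP => M /VW/WP.
apply: (is_stratum_comp (stratum_L (pred i)) (stratum_L i)) (seteq_sym sLp) (seteq_sym sL) _.
split=> //; split.
  move=> M /G2II[rM V]; rewrite /inter !LnextP //.
  by split; split=> //; [apply: Pb_Lbp|apply: Pb_Lb].
by move=> W iW PW /(split W iW)[WV|//]; case: nPV => M /PW/WV.
Qed.

Lemma ok_is_stratum t d : t <> T0_VI -> ok t d -> is_stratum Z (G d).
Proof.
have sL := stratum_L; have sV i := (stratum_VP i).1; have sP i := (stratum_VP i).2.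
have sLL i j : [disjoint pr i & pr j] -> is_stratum Z (G (set0, set0, [set i; j])).
  move=> D; have o : ok T2_III (set0, set0, [set i; j]) by apply/(okP n4); exists i, j.
  by apply: (is_stratum_inter _ o _ (sL i) (sL j)) => //; apply: GI; rewrite ?setU0 ?set0U.
have sVP i : is_stratum Z (G ([set i], [set i], set0)).
  have o : ok T1_I ([set i], [set i], set0) by apply/(okP n4); exists i.
  by apply: (is_stratum_inter _ o _ (sV i) (sP i)) => //; apply: GI; rewrite ?setU0 ?set0U.
move=> tVI o; have := (okP n4 _ _).1 o; case: t tVI o => // _ o.
- by move=> [i ->]; apply: sL.
- by move=> [i ->]; apply: sV.
- by move=> [i ->]; apply: sP.
- by move=> [i [j [D ->]]]; apply: sLL.
- by move=> [i ->]; apply: sVP.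
- move=> [i [j [_ ed]]]; move: o; rewrite ed => o.
  by apply: (is_stratum_inter _ o _ (sV i) (sL j)) => //; apply: GI; rewrite ?setU0 ?set0U.
- move=> [i [j [_ ed]]]; move: o; rewrite ed => o.
  by apply: (is_stratum_inter _ o _ (sP i) (sL j)) => //; apply: GI; rewrite ?setU0 ?set0U.
- move=> [i [j [k [[D _ _] ed]]]]; move: o; rewrite ed => o.
  by apply: (is_stratum_inter _ o _ (sLL i j D) (sL k)) => //; apply: GI; rewrite ?setU0 ?set0U.
- move=> [i [j [_ ed]]]; move: o; rewrite ed => o.
  by apply: (is_stratum_inter _ o _ (sV i) (sV j)) => //; apply: GI; rewrite ?setU0 ?set0U.
- move=> [i [j [_ ed]]]; move: o; rewrite ed => o.
  by apply: (is_stratum_inter _ o _ (sP i) (sP j)) => //; apply: GI; rewrite ?setU0 ?set0U.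
- move=> [i [j [_ ed]]]; move: o; rewrite ed => o.
  by apply: (is_stratum_inter _ o _ (sVP i) (sL j)) => //; apply: GI; rewrite ?setU0 ?set0U.
- move=> [i [j [k [[D _ _] ed]]]]; move: o; rewrite ed => o.
  by apply: (is_stratum_inter _ o _ (sV i) (sLL j k D)) => //; apply: GI; rewrite ?setU0 ?set0U.
move=> [i [j [k [[_ _ D] ed]]]]; move: o; rewrite ed => o.
by apply: (is_stratum_inter _ o _ (sP i) (sLL j k D)) => //; apply: GI; rewrite ?setU0 ?set0U.
Qed.

Lemma has_type_is_stratum t X : has_type Z t X -> is_stratum Z X.
Proof.
have [->|tVI] : t = T0_VI \/ t <> T0_VI by case: t; (by left) || by right.
  move=> [i [j [k [l [[d1 [_ [_ [_ [_ d2]]]]] c]]]]].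
  have o a b : [disjoint pr a & pr b] -> ok T2_III (set0, set0, [set a; b]).
    by move=> D; apply/(okP n4); exists a, b.
  have s a b D := ok_is_stratum (t := T2_III) ltac:(discriminate) (o a b D).
  (* The points are components of the intersection of two strata of type (2,III), L_i L_j and L_k
     L_l. *)
  apply: (is_stratum_comp (s i j d1) (s k l d2) (G2III n4 tp i j) (G2III n4 tp k l)).
  by apply: component_ext c => // M; rewrite /L4 /inter; tauto.
move=> /(has_typeP n4 tp X tVI)[d [o e]].
by have [Y [sY eY]] := ok_is_stratum tVI o; exists Y; split=> //; apply: seteq_trans e eY.
Qed.

Lemma is_stratumP X : is_stratum Z X <-> exists t, has_type Z t X.
Proof.
split=> [[Y [/stratum_has_type[t h] e]]|[t]]; last exact: has_type_is_stratum.
exists t; have [tVI|tVI] : t = T0_VI \/ t <> T0_VI by case: (t); (by left) || by right.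
  subst t; have [d [M [o dM eM]]] := (has_type_VI Y).1 h.
  by apply/has_type_VI; exists d, M; split=> //; apply: seteq_trans e eM.
have [d [o eM]] := (has_typeP n4 tp Y tVI).1 h.
by apply/(has_typeP n4 tp X tVI); exists d; split=> //; apply: seteq_trans e eM.
Qed.

Lemma adm4P X : (exists i j k l, adm4 i j k l /\ seteq X (L4 Z i j k l)) <->
  exists d, ok T0_VI d /\ seteq X (G d).
Proof.
split=> [[i [j [k [l [a e]]]]]|[d [o e]]].
  exists (set0, set0, [set i; j; k; l]); split; first by apply/(okP n4); exists i, j, k, l.
  exact: seteq_trans e (G0VI n4 tp i j k l).
have [i [j [k [l [a ed]]]]] := (okP n4 _ _).1 o; exists i, j, k, l; split=> //.
by apply: seteq_trans e _; rewrite ed; apply/seteq_sym/G0VI.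
Qed.

Lemma L4_two_points i j k l : adm4 i j k l ->
  exists M1 M2 : 'M[CC]_(2, 4), [/\ rank2 M1, rank2 M2, ~~ (M1 == M2)%MS &
    seteq (L4 Z i j k l) (fun M => rank2 M /\ ((M == M1)%MS \/ (M == M2)%MS))].
Proof.
move=> a; have o : ok T0_VI (set0, set0, [set i; j; k; l]) by apply/(okP n4); exists i, j, k, l.
have [M1 [M2 [r1 r2 ne e]]] := two_points_ok n4 tp o; exists M1, M2; split=> //.
exact: seteq_trans (G0VI n4 tp i j k l) e.
Qed.

End Strata.

Theorem theorem3p5 (n : nat) (Z : 'M[RR]_(n, 4)) :
  (4 <= n)%N -> totally_positive Z -> assumptionG Z ->
  (* the closed strata are exactly the sets of the 14 types *)
      (forall X, is_stratum Z X <-> exists t, has_type Z t X) /\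
      (* the types are mutually exclusive *)
      (forall X t1 t2, has_type Z t1 X -> has_type Z t2 X -> t1 = t2) /\
      (* a stratum of type (d, .) has dimension d *)
      (forall t X, has_type Z t X -> has_dim X (tdim t)) /\
      (* counts for the 13 types other than (0,VI) *)
      (forall t, t <> T0_VI ->
         exists f : 'I_(tcount n t) -> gset,
           (forall k k', seteq (f k) (f k') -> k = k') /\
           (forall X, has_type Z t X <-> exists k, seteq X (f k))) /\
      (* each admissible L_{i(i+1)}L_{j(j+1)}L_{k(k+1)}L_{l(l+1)} is a set of two points *)
      (forall i j k l : 'I_n, adm4 i j k l ->
         exists M1 M2 : 'M[CC]_(2, 4),
           [/\ rank2 M1, rank2 M2, ~~ (M1 == M2)%MS &
               seteq (L4 Z i j k l)
                 (fun M => rank2 M /\ ((M == M1)%MS \/ (M == M2)%MS))]) /\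
      (* count for type (0,VI): number of such two-point sets *)
      (exists f : 'I_(tcount n T0_VI) -> gset,
         (forall k k', seteq (f k) (f k') -> k = k') /\
         (forall X, (exists i j k l, adm4 i j k l /\ seteq X (L4 Z i j k l))
                    <-> exists k, seteq X (f k))).
Proof.
move=> n4 tp aG; split; first exact: is_stratumP.
split; first exact: type_uniq.
split; first exact: has_dim_type.
split.
  move=> t tVI; have [f [inj fP]] := enumerate_ok n4 tp aG t; exists f; split=> // X.
  by rewrite -fP; apply: has_typeP.
split; first by move=> i j k l; apply: L4_two_points.
have [f [inj fP]] := enumerate_ok n4 tp aG T0_VI; exists f; split=> // X.
by rewrite -fP; apply: adm4P.
Qed.
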